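(* Let $\vec u\in\mathbb{R}^3$ with $|\vec u|<1$ and $\theta>0$. Then the set of functions $\{\tilde P_{k,m}^{(\ell)}[\vec u,\theta]:\ k,\ell\ge0,\ |m|\le\ell\}$ is an orthonormal basis of $\mathbb{H}^{g^{(0)}_{[\vec u,\theta]}}$, and for every integer $M\ge1$ the set $\{\tilde P_{k,m}^{(\ell)}[\vec u,\theta]:\ k,\ell\ge0,\ |m|\le\ell,\ k+\ell\le M\}$ is an orthonormal basis of $\mathbb{H}_M^{g^{(0)}_{[\vec u,\theta]}}$. (Here ''basis'' is understood in the linear-algebraic sense, i.e. every element is a finite linear combination.)
   Context: Units with $c=m=1$; Minkowski metric $\mathrm{diag}\{1,-1,-1,-1\}$, repeated Greek indices summed. For $\vec p\in\mathbb{R}^3$, $p^0=\sqrt{1+|\vec p|^2}$. $U^0=(1-|\vec u|^2)^{-1/2}$, $U^i=U^0u_i$; $E=U_\alpha p^\alpha=U^0p^0-\sum_iU^ip^i\ge1$. Tetrad vectors ($i,j=1,2,3$): $n_i^0=U^i$, $n_i^j=\frac{U^iU^j}{U^0+1}+\delta_{i,j}$. Variables $y\in[-1,1]$, $\phi\in[0,2\pi)$ are defined (for almost every $\vec p$) by $(\sqrt{1-y^2}\cos\phi,\sqrt{1-y^2}\sin\phi,y)=-(E^2-1)^{-1/2}(n_1^\alpha p_\alpha,n_2^\alpha p_\alpha,n_3^\alpha p_\alpha)$. With $\zeta=\theta^{-1}$ and $K_\nu$ the modified Bessel function of the second kind, the weight is $g^{(0)}_{[\vec u,\theta]}=\frac{\zeta}{4\pi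 K_2(\zeta)}\exp(-E/\theta)$. The spaces are $$\mathbb{H}^{g^{(0)}_{[\vec u,\theta]}}=\mathrm{span}\{p^{\mu_1}\cdots p^{\mu_j}g^{(0)}_{[\vec u,\theta]}:\ \mu_i\in\{0,1,2,3\},\ j\ge0\},\qquad \mathbb{H}_M^{g^{(0)}_{[\vec u,\theta]}}=\mathrm{span}\{p^{\mu_1}\cdots p^{\mu_j}g^{(0)}_{[\vec u,\theta]}:\ \mu_i\in\{0,1,2,3\},\ 0\le j\le M\},$$ with inner product $\langle f,g\rangle=\int_{\mathbb{R}^3}\frac{1}{g^{(0)}_{[\vec u,\theta]}}f(\vec p)g(\vec p)\frac{d^3\vec p}{p^0}$. $P_k^{(\ell)}(x;\zeta)$ ($k\ge0$) are the polynomials of degree $k$ in $x$, with positive leading coefficient, orthonormal on $[1,\infty)$ with respect to $\omega^{(\ell)}(x;\zeta)=\frac{\zeta(x^2-1)^{\ell+1/2}}{(2\ell+1)K_2(\zeta)}e^{-\zeta x}$. Real spherical harmonics: $\hat{P}_{\ell}^{m}(y)=(-1)^{m}(1-y^2)^{m/2}\frac{1}{2^{\ell}\ell!}\frac{d^{\ell+m}}{dy^{\ell+m}}(y^2-1)^{\ell}$, $\check{P}_{\ell}^{m}=\sqrt{\frac{(\ell-m)!}{(\ell+m)!}}\hat{P}_{\ell}^{m}$ for $0\le m\le\ell$; $Y_{\ell,m}(y,\phi)=\sqrt2\check P_\ell^{|m|}(y)\sin(|m|\phi)$ for $m<0$, $Y_{\ell,0}=\check P_\ell^0(y)$, $Y_{\ell,m}=\sqrt2\check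 P_\ell^{m}(y)\cos(m\phi)$ for $m>0$. Finally $\tilde Y_{\ell,m}=(E^2-1)^{\ell/2}Y_{\ell,m}(y,\phi)$ (extended continuously to all $\vec p$) and $\tilde P_{k,m}^{(\ell)}[\vec u,\theta]=g^{(0)}_{[\vec u,\theta]}P_k^{(\ell)}(E;\theta^{-1})\tilde Y_{\ell,m}$. *)

(* Defs.v *)
From HB Require Import structures.
From mathcomp Require Import all_boot all_order all_algebra.
From mathcomp Require Import all_classical all_reals all_analysis.
Import Order.TTheory GRing.Theory Num.Theory.
Import numFieldNormedType.Exports.

Set Implicit Arguments.
Unset Strict Implicit.
Unset Printing Implicit Defensive.

Local Open Scope classical_set_scope.
Local Open Scope ring_scope.

Section LinearAlgebra.
Context {R : realType} {V : lmodType R}.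

Definition lin_span (S : set V) : set V :=
  [set v | exists (n : nat) (c : 'I_n -> R) (s : 'I_n -> V),
     (forall i, S (s i)) /\ v = \sum_(i < n) c i *: s i].

Definition lin_indep {I : choiceType} (D : set I) (b : I -> V) : Prop :=
  forall (s : seq I) (c : I -> R), uniq s -> (forall i, i \in s -> D i) ->
    \sum_(i <- s) c i *: b i = 0 -> forall i, i \in s -> c i = 0.

(* The inner product takes extended real values: an equality with a real number
   thus also expresses that the defining integral converges. *)
Definition orthonormal_basis {I : choiceType} (ip : V -> V -> \bar R)
    (H : set V) (D : set I) (b : I -> V) : Prop :=
  [/\ forall i j, D i -> D j -> ip (b i) (b j) = ((i == j)%:R)%:E,
      lin_indep D b
    & lin_span (b @` D) = H].

End LinearAlgebra.

Section Relativistic.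
Context {R : realType}.

(* The library has a Lebesgue measure on R only; R^3 carries the product. *)
Definition lebesgue3 :
    {measure set (measurableTypeR R * measurableTypeR R * measurableTypeR R)
       -> \bar R} :=
  ((@lebesgue_measure R \x @lebesgue_measure R)%E \x @lebesgue_measure R)%E.

Definition coord (x : R * R * R) (i : 'I_3) : R :=
  tnth [tuple x.1.1; x.1.2; x.2] i.

(* Euclidean norm; the library norm on products is the sup norm. *)
Definition enorm (x : R * R * R) : R := Num.sqrt (\sum_(i < 3) coord x i ^+ 2).

Definition fourvec (a0 : R) (a : 'I_3 -> R) : 'I_4 -> R :=
  fun mu => if unlift ord0 mu is Some i then a i else a0.

Definition minkowski (a b : 'I_4 -> R) : R :=
  a ord0 * b ord0 - \sum_(i < 3) a (lift ord0 i) * b (lift ord0 i).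

Definition mom (p : R * R * R) : 'I_4 -> R :=
  fourvec (Num.sqrt (1 + enorm p ^+ 2)) (coord p).

Definition lorentz (u : R * R * R) : R := (Num.sqrt (1 - enorm u ^+ 2))^-1.

Definition velocity (u : R * R * R) : 'I_4 -> R :=
  fourvec (lorentz u) (fun i => lorentz u * coord u i).

Definition energy (u p : R * R * R) : R := minkowski (velocity u) (mom p).

Definition tetrad (u : R * R * R) (i : 'I_3) : 'I_4 -> R :=
  let U := velocity u in
  fourvec (U (lift ord0 i))
    (fun j => U (lift ord0 i) * U (lift ord0 j) / (U ord0 + 1) + (i == j)%:R).

Definition direction (u p : R * R * R) (i : 'I_3) : R :=
  - (Num.sqrt (energy u p ^+ 2 - 1))^-1 * minkowski (tetrad u i) (mom p).

(* The pair (y, phi). When y = 1 or y = -1 every phi qualifies; the choice does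
   not matter because Y_{l,m} then does not depend on phi. *)
Definition angles (u p : R * R * R) : R * R :=
  get [set a : R * R |
    [/\ -1 <= a.1 <= 1, 0 <= a.2 < 2 * pi,
        Num.sqrt (1 - a.1 ^+ 2) * cos a.2 = direction u p (inord 0),
        Num.sqrt (1 - a.1 ^+ 2) * sin a.2 = direction u p (inord 1)
      & a.1 = direction u p (inord 2)]].

Definition cosh (t : R) : R := (expR t + expR (- t)) / 2.

Definition bessel_K (nu zeta : R) : R :=
  Rintegral (@lebesgue_measure R) `[0, +oo[
    (fun t => expR (- zeta * cosh t) * cosh (nu * t)).

Definition weight0 (u : R * R * R) (theta : R) (p : R * R * R) : R :=
  theta^-1 / (4 * pi * bessel_K 2 theta^-1) * expR (- energy u p / theta).

Definition inner (u : R * R * R) (theta : R) (f g : R * R * R -> R^o) : \bar R :=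
  (\int[lebesgue3]_p
     ((weight0 u theta p)^-1 * f p * g p / mom p ord0)%:E)%E.

Definition monomial_weight (u : R * R * R) (theta : R) (mu : seq 'I_4) :
    R * R * R -> R^o :=
  fun p => (\prod_(a <- mu) mom p a) * weight0 u theta p.

Definition space_H (u : R * R * R) (theta : R) : set (R * R * R -> R^o) :=
  lin_span [set monomial_weight u theta mu | mu in [set: seq 'I_4]].

Definition space_HM (u : R * R * R) (theta : R) (M : nat) :
    set (R * R * R -> R^o) :=
  lin_span
    [set monomial_weight u theta mu | mu in [set mu | (size mu <= M)%N]].

Definition omega (l : nat) (zeta x : R) : R :=
  zeta * (x ^+ 2 - 1) `^ (l%:R + 2^-1) / ((2 * l%:R + 1) * bessel_K 2 zeta)
  * expR (- zeta * x).

Definition orthonormal_polys (w : R -> R) (P : nat -> {poly R}) : Prop :=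
  [/\ forall k, size (P k) = k.+1,
      forall k, 0 < lead_coef (P k)
    & forall j k, (\int[@lebesgue_measure R]_(x in `[1%R, +oo[)
        ((P j).[x] * (P k).[x] * w x)%:E)%E = ((j == k)%:R)%:E].

Definition legendre_hat (l m : nat) (y : R) : R :=
  (-1) ^+ m * (1 - y ^+ 2) `^ (m%:R / 2) * (2 ^+ l * (l`!)%:R)^-1
  * (derivn (l + m) (('X^2 - 1) ^+ l : {poly R})).[y].

Definition legendre_check (l m : nat) (y : R) : R :=
  Num.sqrt (((l - m)`!)%:R / ((l + m)`!)%:R) * legendre_hat l m y.

Definition sph_harm (l : nat) (m : int) (y phi : R) : R :=
  if m < 0 then
    Num.sqrt 2 * legendre_check l `|m|%N y * sin (`|m|%N%:R * phi)
  else if m == 0 then legendre_check l 0 y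
  else Num.sqrt 2 * legendre_check l `|m|%N y * cos (`|m|%N%:R * phi).

Definition solid_harm_raw (u : R * R * R) (l : nat) (m : int) (p : R * R * R) : R :=
  (energy u p ^+ 2 - 1) `^ (l%:R / 2)
  * sph_harm l m (angles u p).1 (angles u p).2.

(* The angles are undefined at the single point where the energy is 1; the
   value there is the one given by continuity. *)
Definition solid_harm (u : R * R * R) (l : nat) (m : int) (p : R * R * R) : R :=
  if 1 < energy u p then solid_harm_raw u l m p
  else lim (solid_harm_raw u l m @ p^').

Definition basis_fun (P : nat -> nat -> {poly R}) (u : R * R * R) (theta : R)
    (i : nat * nat * int) : R * R * R -> R^o :=
  let: (k, l, m) := i in
  fun p => weight0 u theta p * (P l k).[energy u p] * solid_harm u l m p.

Definition basis_index : set (nat * nat * int) :=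
  [set i | (`|i.2| <= i.1.2)%N].

Definition basis_index_le (M : nat) : set (nat * nat * int) :=
  [set i | basis_index i /\ (i.1.1 + i.1.2 <= M)%N].

End Relativistic.

(* Main.v *)
From HB Require Import structures.
Require Import Defs.
From mathcomp Require Import all_boot all_order all_algebra.
From mathcomp Require Import ring lra zify.
From mathcomp Require Import all_classical all_reals all_analysis.
From mathcomp Require Import measurable_realfun.
Import Order.TTheory GRing.Theory Num.Theory.
Import numFieldNormedType.Exports.
Local Open Scope classical_set_scope.
Local Open Scope ring_scope.
Set Implicit Arguments.
Unset Strict Implicit.
Unset Printing Implicit Defensive.

(** Every object becomes simple in the rest frame of the velocity u. Let X be
the spatial part of the momentum p seen from that frame ([rest u p] below).
Then E = sqrt (1 + |X|^2), the point of the sphere with coordinates (y, phi) is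
X / |X|, and the basis function of index (k, l, m) is a weight in E, times
P_k^(l)(E), times the solid harmonic of X of degree l and order m
([basis_funE]), which is a polynomial in X ([solid_harmE]).

Orthonormality. The measure d^3p / p^0 is invariant under p |-> X
([transports_rest]): rotations reduce this to a boost along an axis, hence to a
substitution in one variable. In spherical coordinates of X the integral of the
product of two basis functions separates into a radial, a latitudinal and an
azimuthal integral ([integral_spherical], [rest_gram]). The azimuthal one is
Fourier orthogonality ([azimuth_orthogonality]) and forces m = m'; then the
latitudinal one is the orthogonality of associated Legendre functions of equal
order ([latitude_orthogonality]) and forces l = l'; then, with x = E, the radial
one is the assumed orthonormality of the P_k^(l) ([radial_orthogonality]). Nothing
has to be known about K_2(zeta) beyond its positivity, and that follows from the
normalization of P_0^(0) ([bessel_gt0]). Linear independence follows from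
orthonormality ([orthonormal_free]).

Spanning. The components of X, the energy E, and |X|^2 = E^2 - 1 are polynomials
in p^0, ..., p^3 of degrees 1, 1 and 2, so the basis function of index (k, l, m)
is the weight times a polynomial of degree at most k + l ([degree_le_basis_fun]).
Conversely no explicit inversion is needed: since (p^0)^2 = 1 + |p|^2, the
polynomials of degree at most M are spanned by the monomials that are at most
linear in p^0 ([degree_le_reduced]), and these are in bijection with the indices
such that k + l <= M. An independent family contained in the span of equally many
vectors spans it ([free_exchange]). The statement on the whole space is the union
over M. *)

(** * Changes of variables in integrals *)

Section Transport.
Context {d1 d2 : measure_display} {X : measurableType d1} {Y : measurableType d2}
  {R : realType}.

(** Change of variables for nonnegative functions. Two weights are carried, one on
each side, so that substitutions with a Jacobian, restrictions to a subset and
invariant measures with a density all have this form and compose. *)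
Definition transports (mu : {measure set X -> \bar R})
    (nu : {measure set Y -> \bar R}) (T : X -> Y) (w : X -> R) (w' : Y -> R) :=
  forall F : Y -> \bar R, measurable_fun setT F -> (forall y, 0 <= F y)%E ->
    (\int[mu]_x (F (T x) * (w x)%:E) = \int[nu]_y (F y * (w' y)%:E))%E.

Variables (mu : {measure set X -> \bar R}) (nu : {measure set Y -> \bar R}).

Lemma transports_ext (T T1 : X -> Y) (w w1 : X -> R) (w' w1' : Y -> R) :
  (forall x, w x != 0 -> T x = T1 x) -> w =1 w1 -> w' =1 w1' ->
  transports mu nu T w w' -> transports mu nu T1 w1 w1'.
Proof.
move=> eT ew ew' h F mF F0; have := h F mF F0.
under [in X in _ = X -> _]eq_integral do rewrite ew'.
move=> <-; apply: eq_integral => x _; rewrite -ew.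
by have [->|/eT ->//] := eqVneq (w x) 0; rewrite !mule0.
Qed.

Lemma transports_weight (T : X -> Y) (w : X -> R) (w' h : Y -> R) :
  measurable_fun setT h -> (forall y, 0 <= h y) ->
  transports mu nu T w w' ->
  transports mu nu T (fun x => h (T x) * w x) (fun y => h y * w' y).
Proof.
move=> mh h0 tr F mF F0.
under eq_integral do rewrite EFinM muleA.
under [RHS]eq_integral do rewrite EFinM muleA.
apply: (tr (fun y => F y * (h y)%:E)%E).
  by apply: emeasurable_funM => //; exact/measurable_EFinP.
by move=> y; rewrite mule_ge0// lee_fin.
Qed.

(** Real integrands reduce to nonnegative ones by their positive and negative
parts, since the weights are nonnegative. *)
Lemma transports_signed (T : X -> Y) (w : X -> R) (w' : Y -> R) (F : Y -> R) :
  (forall x, 0 <= w x) -> (forall y, 0 <= w' y) -> measurable_fun setT F ->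
  transports mu nu T w w' ->
  (\int[mu]_x (F (T x) * w x)%:E = \int[nu]_y (F y * w' y)%:E)%E.
Proof.
move=> w0 w'0 mF tr; rewrite [LHS]integralE [RHS]integralE.
have pE (a b : R) : 0 <= b ->
    (maxe (a * b)%:E 0 = maxe a%:E 0 * b%:E /\
    maxe (- (a * b)%:E) 0 = maxe (- a%:E) 0 * b%:E)%E.
  by move=> b0; rewrite -!EFinN -!EFin_max -!EFinM !maxr_pMl// !mul0r mulNr.
congr (_ - _)%E.
- transitivity (\int[mu]_x ((EFin \o F)^\+ (T x) * (w x)%:E))%E.
    by apply: eq_integral => x _; rewrite !funeposE (proj1 (pE _ _ (w0 _))).
  rewrite tr//; last by apply: measurable_funepos; exact/measurable_EFinP.
  by apply: eq_integral => y _; rewrite !funeposE (proj1 (pE _ _ (w'0 _))).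
- transitivity (\int[mu]_x ((EFin \o F)^\- (T x) * (w x)%:E))%E.
    by apply: eq_integral => x _; rewrite !funenegE (proj2 (pE _ _ (w0 _))).
  rewrite tr//; last by apply: measurable_funeneg; exact/measurable_EFinP.
  by apply: eq_integral => y _; rewrite !funenegE (proj2 (pE _ _ (w'0 _))).
Qed.

Import HBNNSimple.

(** By monotone convergence along simple functions it is enough to compare the
two sides on measurable sets. *)
Lemma transports_indic (T : X -> Y) (w : X -> R) :
  measurable_fun setT T -> measurable_fun setT w -> (forall x, 0 <= w x) ->
  (forall A, measurable A ->
    (\int[mu]_x ((\1_A (T x))%:E * (w x)%:E) = nu A)%E) ->
  transports mu nu T w (cst 1).
Proof.
move=> mT mw w0 h F mF F0.
have indT A : measurable A -> measurable_fun setT (fun x => \1_A (T x) : R).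
  by move=> mA; exact: (measurableT_comp (measurable_indic _)).
under [RHS]eq_integral do rewrite mule1.
pose f := nnsfun_approx (@measurableT _ Y) mF.
have fnd (a b : nat) y : (a <= b)%N -> ((f a y)%:E <= (f b y)%:E)%E.
  by move=> ab; rewrite lee_fin; exact/lefP/nd_nnsfun_approx.
have cf y : limn (fun n => (f n y)%:E) = F y.
  by apply/cvg_lim => //; exact: cvg_nnsfun_approx.
transitivity (limn (fun n => \int[nu]_y (f n y)%:E)%E); last first.
  rewrite -monotone_convergence//; first exact: eq_integral.
  - by move=> n; exact/measurable_EFinP.
  - by move=> n y _; rewrite lee_fin.
  - by move=> y _ a b ab; exact: fnd.
transitivity (limn (fun n => \int[mu]_x ((f n (T x))%:E * (w x)%:E))%E).
  rewrite -monotone_convergence//; first last.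
  - by move=> x _ a b ab; apply: lee_wpmul2r; [rewrite lee_fin|exact: fnd].
  - by move=> n x _; rewrite mule_ge0// lee_fin.
  - move=> n; apply: emeasurable_funM; last exact/measurable_EFinP.
    by apply/measurable_EFinP; exact: measurableT_comp.
  apply: eq_integral => x _; apply/esym/cvg_lim => //.
  by apply: cvgeZr => //; exact: cvg_nnsfun_approx.
congr (limn _); apply/funext => n.
transitivity (\sum_(k \in range (f n))
    \int[mu]_x (k%:E * ((\1_(f n @^-1` [set k]) (T x))%:E * (w x)%:E)))%E.
  rewrite -ge0_integral_fsum//; last 2 first.
  - move=> k; apply: emeasurable_funM => //; apply: emeasurable_funM.
      by apply/measurable_EFinP; exact: indT.
    exact/measurable_EFinP.
  - move=> k x _; rewrite muleA mule_ge0 ?lee_fin//.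
    exact: (nnfun_muleindic_ge0 (f n) k (T x)).
  apply: eq_integral => x _.
  under eq_fsbigr do rewrite muleA.
  rewrite -ge0_mule_fsuml; last first.
    by move=> k; exact: (nnfun_muleindic_ge0 (f n) k (T x)).
  by congr (_ * _)%E; rewrite fimfunE -fsumEFin.
under [RHS]eq_integral do rewrite fimfunE -fsumEFin//.
rewrite [RHS]ge0_integral_fsum//; last 2 first.
  - by move=> y; exact/measurable_EFinP/measurable_funM.
  - by move=> y x _; rewrite nnfun_muleindic_ge0.
apply: eq_fsbigr => k /[!inE] -[y _ fk].
have k0 : 0 <= k by rewrite -fk.
rewrite integralZl_indic_nnsfun//= integral_indic//= setIT.
rewrite ge0_integralZl_EFin//; first by rewrite h.
- by move=> x _; rewrite mule_ge0// lee_fin.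
- apply: emeasurable_funM; last exact/measurable_EFinP.
  by apply/measurable_EFinP; exact: indT.
Qed.

End Transport.
Arguments transports {d1 d2 X Y R} mu nu T w w'.

Lemma transports_comp {d1 d2 d3 : measure_display} {X : measurableType d1}
  {Y : measurableType d2} {Z : measurableType d3} {R : realType}
  (mu : {measure set X -> \bar R}) (nu : {measure set Y -> \bar R})
  (la : {measure set Z -> \bar R}) (T : X -> Y) (S : Y -> Z) w w' w'' :
  measurable_fun setT S ->
  transports mu nu T w w' -> transports nu la S w' w'' ->
  transports mu la (S \o T) w w''.
Proof.
move=> mS trT trS F mF F0; rewrite -(trS F mF F0).
apply: (trT (F \o S)); first exact: measurableT_comp.
by move=> y; exact: F0.
Qed.

Section ProductTransport.
Context {d1 d2 e1 e2 : measure_display} {X1 : measurableType d1}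
  {X2 : measurableType d2} {Y1 : measurableType e1} {Y2 : measurableType e2}
  {R : realType}.

(** A map that moves one coordinate only is treated on its fibers, by Tonelli.
The substitutions in several variables below are composed of such maps and of
exchanges of coordinates. *)
Lemma transports_fiber2 (m1 : {sigma_finite_measure set X1 -> \bar R})
    (m2 : {sigma_finite_measure set X2 -> \bar R})
    (n2 : {sigma_finite_measure set Y2 -> \bar R})
    (t : X1 * X2 -> Y2) (w : X1 * X2 -> R) (w' : X1 * Y2 -> R) :
  measurable_fun setT t -> measurable_fun setT w -> measurable_fun setT w' ->
  (forall p, 0 <= w p) -> (forall p, 0 <= w' p) ->
  (forall x, transports m2 n2 (fun y => t (x, y)) (fun y => w (x, y))
     (fun y => w' (x, y))) ->
  transports (m1 \x m2)%E (m1 \x n2)%E (fun p => (p.1, t p)) w w'.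
Proof.
move=> mt mw mw' w0 w'0 tr F mF F0.
rewrite fubini_tonelli1; first last.
- by move=> p; rewrite mule_ge0 ?lee_fin.
- apply: emeasurable_funM; last exact/measurable_EFinP.
  by apply: (measurableT_comp mF); exact: measurable_fun_pair.
rewrite fubini_tonelli1; first last.
- by move=> p; rewrite mule_ge0 ?lee_fin.
- by apply: emeasurable_funM => //; exact/measurable_EFinP.
apply: eq_integral => x _; rewrite /fubini_F/=.
apply: (tr x (fun y => F (x, y))) => //.
exact: (measurableT_comp mF).
Qed.

Lemma transports_fiber1 (m1 : {sigma_finite_measure set X1 -> \bar R})
    (m2 : {sigma_finite_measure set X2 -> \bar R})
    (n1 : {sigma_finite_measure set Y1 -> \bar R})
    (t : X1 * X2 -> Y1) (w : X1 * X2 -> R) (w' : Y1 * X2 -> R) :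
  measurable_fun setT t -> measurable_fun setT w -> measurable_fun setT w' ->
  (forall p, 0 <= w p) -> (forall p, 0 <= w' p) ->
  (forall y, transports m1 n1 (fun x => t (x, y)) (fun x => w (x, y))
     (fun x => w' (x, y))) ->
  transports (m1 \x m2)%E (n1 \x m2)%E (fun p => (t p, p.2)) w w'.
Proof.
move=> mt mw mw' w0 w'0 tr F mF F0.
rewrite fubini_tonelli2; first last.
- by move=> p; rewrite mule_ge0 ?lee_fin.
- apply: emeasurable_funM; last exact/measurable_EFinP.
  by apply: (measurableT_comp mF); exact: measurable_fun_pair.
rewrite fubini_tonelli2; first last.
- by move=> p; rewrite mule_ge0 ?lee_fin.
- by apply: emeasurable_funM => //; exact/measurable_EFinP.
apply: eq_integral => y _; rewrite /fubini_G/=.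
apply: (tr y (fun x => F (x, y))) => //.
exact: (measurableT_comp mF).
Qed.

End ProductTransport.

Section Measurable.
Context {d : measure_display} {X : measurableType d} {R : realType}.

Lemma measurable_fun_inv (f : X -> R) :
  measurable_fun setT f -> measurable_fun setT (fun x => (f x)^-1).
Proof.
move=> mf; apply: (measurableT_comp (f := @GRing.inv R)) => //.
have -> : [set: R] = [set x | x != 0] `|` [set 0].
  by rewrite eqEsubset; split => // x _; have [->|] := eqVneq x 0; [right|left].
have o0 : open [set x : R | x != 0] := @open_neq R 0.
apply/measurable_funU => //; first exact: open_measurable.
split; last exact: measurable_fun_set1.
apply: open_continuous_measurable_fun => // x; rewrite inE/=.
exact: inv_continuous.
Qed.

Lemma measurable_fun_sqrt (f : X -> R) :
  measurable_fun setT f -> measurable_fun setT (fun x => Num.sqrt (f x)).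
Proof.
move=> mf; apply: (measurableT_comp (f := @Num.sqrt R)) => //.
by apply: continuous_measurable_fun; exact: sqrt_continuous.
Qed.

Lemma measurable_fun_norm (f : X -> R) :
  measurable_fun setT f -> measurable_fun setT (fun x => `|f x|).
Proof. exact: measurableT_comp. Qed.

Lemma measurable_fun_sin (f : X -> R) :
  measurable_fun setT f -> measurable_fun setT (fun x => sin (f x)).
Proof.
move=> mf; apply: (measurableT_comp (f := @sin R)) => //.
by apply: continuous_measurable_fun; exact: continuous_sin.
Qed.

Lemma measurable_fun_cos (f : X -> R) :
  measurable_fun setT f -> measurable_fun setT (fun x => cos (f x)).
Proof.
move=> mf; apply: (measurableT_comp (f := @cos R)) => //.
by apply: continuous_measurable_fun; exact: continuous_cos.
Qed.

Lemma measurable_fun_expR (f : X -> R) :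
  measurable_fun setT f -> measurable_fun setT (fun x => expR (f x)).
Proof. exact: measurableT_comp. Qed.

Lemma measurable_fun_indicator (f : X -> R) (A : set R) :
  measurable A -> measurable_fun setT f ->
  measurable_fun setT (fun x => \1_A (f x) : R).
Proof.
by move=> mA mf; exact: (measurableT_comp (measurable_indic mA)).
Qed.

Lemma measurable_fun_horner (p : {poly R}) (f : X -> R) :
  measurable_fun setT f -> measurable_fun setT (fun x => p.[f x]).
Proof.
move=> mf; apply: (measurableT_comp (f := horner p)) => //.
by apply: continuous_measurable_fun; exact: continuous_horner.
Qed.

End Measurable.

Section Projections.
Context {d d1 d2 : measure_display} {X : measurableType d} {A : measurableType d1}
  {B : measurableType d2}.

Lemma measurable_fun_proj1 (f : X -> A * B) :
  measurable_fun setT f -> measurable_fun setT (fun x => (f x).1).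
Proof. by move=> mf; apply: measurableT_comp; first exact: measurable_fst. Qed.

Lemma measurable_fun_proj2 (f : X -> A * B) :
  measurable_fun setT f -> measurable_fun setT (fun x => (f x).2).
Proof. by move=> mf; apply: measurableT_comp; first exact: measurable_snd. Qed.

End Projections.

Section WeightedImage.
Context {d d' : measure_display} {X : measurableType d} {Y : measurableType d'}
  {R : realType}.
Variables (mu : {measure set X -> \bar R}) (T : X -> Y) (w : X -> R).
Hypotheses (mT : measurable_fun setT T) (mw : measurable_fun setT w)
  (w0 : forall x, 0 <= w x).

(** The image of the measure with density w, packed as a measure so that the
uniqueness of the Lebesgue measure can be applied to it. *)
Lemma weighted_image_measure : exists m : {measure set Y -> \bar R},
  forall A, (m A = \int[mu]_(x in T @^-1` A) (w x)%:E)%E.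
Proof.
pose m A := (\int[mu]_(x in T @^-1` A) (w x)%:E)%E.
have m0 : m set0 = 0%E by rewrite /m preimage_set0 integral_set0.
have m_ge0 A : (0 <= m A)%E by apply: integral_ge0 => x _; rewrite lee_fin.
have m_add : semi_sigma_additive m.
  move=> F mF tF mUF; rewrite /m preimage_bigcup ge0_integral_bigcup//.
  - by apply: is_cvg_ereal_nneg_natsum => n _; exact: m_ge0.
  - by move=> k; rewrite -[_ @^-1` _]setTI; exact: mT.
  - by apply/measurable_EFinP; exact: measurable_funTS.
  - by move=> x _; rewrite lee_fin.
  - move=> i j _ _ [x [Fi Fj]]; apply: (tF i j) => //; by exists (T x).
pose m' : {measure set Y -> \bar R} :=
  HB.pack m (isMeasure.Build _ _ _ m m0 m_ge0 m_add).
by exists m'.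
Qed.

End WeightedImage.

Section OneDimension.
Context {R : realType}.
Local Notation lambda := (@lebesgue_measure R).

Lemma integral_derive (f F : R -> R) (a b : R) : a < b ->
  (forall x, x \in `[a, b] -> is_derive x 1 F (f x)) ->
  (forall x, x \in `[a, b] -> {for x, continuous f}) ->
  (\int[lambda]_(x in `[a, b]) (f x)%:E = (F b - F a)%:E)%E.
Proof.
move=> ab dF cf.
have cF x : x \in `[a, b] -> {for x, continuous F}.
  move=> /dF dFx; apply: differentiable_continuous.
  by apply/derivable1_diffP; exact: ex_derive.
rewrite (continuous_FTC2 ab (F := F)).
- by rewrite EFinB.
- apply/continuous_within_itvP => //.
  split=> [x xab||]; first by apply: cf; exact: subset_itv_oo_cc xab.
    by apply: cvg_at_right_filter; apply: cf; rewrite in_itv/= lexx ltW.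
  by apply: cvg_at_left_filter; apply: cf; rewrite in_itv/= lexx ltW.
- split.
  + move=> x xab; apply: ex_derive; apply: dF; exact: subset_itv_oo_cc xab.
  + by apply: cvg_at_right_filter; apply: cF; rewrite in_itv/= lexx ltW.
  + by apply: cvg_at_left_filter; apply: cF; rewrite in_itv/= lexx ltW.
- move=> x xab; rewrite derive1E; apply: derive_val; apply: dF.
  exact: subset_itv_oo_cc xab.
Qed.

(** Substitution in one variable. The image of the measure with density T' on I is a
measure on the line that gives the interval ]a, b] the mass b - a, by the
fundamental theorem of calculus on [S a, S b]; hence it is the Lebesgue
measure. *)
Lemma transports_diffeo (T S f : R -> R) (I : set R) :
  measurable I -> measurable_fun setT T -> measurable_fun setT f ->
  (forall x, 0 <= f x) ->
  (forall y, I (S y)) -> (forall y, T (S y) = y) ->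
  (forall x y, I x -> I y -> x < y -> T x < T y) ->
  (forall a b x, S a <= x -> x <= S b -> I x) ->
  (forall x, I x -> is_derive x 1 T (f x)) ->
  (forall x, I x -> {for x, continuous f}) ->
  transports lambda lambda T (fun x => \1_I x * f x) (cst 1).
Proof.
move=> mI mT mf f0 SI TS Tmono Iitv dT cf.
have mw : measurable_fun setT (fun x => \1_I x * f x).
  by apply: measurable_funM => //; exact: measurable_indic.
have w0 x : 0 <= \1_I x * f x by rewrite mulr_ge0.
apply: transports_indic => // A mA.
have [m mE] := @weighted_image_measure _ _ (measurableTypeR R)
  (measurableTypeR R) R lambda T _ mT mw w0.
have -> : (\int[lambda]_x ((\1_A (T x))%:E * (\1_I x * f x)%:E) = m A)%E.
  rewrite mE [RHS]integral_mkcond; apply: eq_integral => x _.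
  rewrite patchE indicE; case: (pselect (A (T x))) => h.
    by rewrite !mem_set// mul1e.
  by rewrite !memNset// mul0e.
have SS a b : a < b -> S a < S b.
  move=> ab; rewrite ltNge le_eqVlt; apply/negP => /orP[/eqP e|/Tmono].
    by move: ab; rewrite -(TS a) -(TS b) e ltxx.
  by move=> /(_ (SI _) (SI _)); rewrite !TS => /(lt_trans ab); rewrite ltxx.
apply/esym; apply: (lebesgue_measure_unique (mu := m)) => // _ [[a b] _ <-].
rewrite lebesgue_measure_itv/= lte_fin mE.
case: ifPn => [ab|]; last first.
  rewrite -leNgt => ba; rewrite set_itv_ge ?preimage_set0 ?integral_set0//.
  by rewrite -leNgt bnd_simp.
have <- : (\int[lambda]_(x in `[S a, S b]) (f x)%:E = b%:E - a%:E)%E; last first.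
  rewrite -integral_itv_obnd_cbnd; last first.
    by apply/measurable_EFinP; exact: measurable_funTS.
  rewrite [LHS]integral_mkcond [RHS]integral_mkcond; apply: eq_integral => x _.
  rewrite !patchE/= indicE.
  case: (pselect (I x)) => Ix; last first.
    rewrite (memNset Ix) mul0r if_same; case: ifPn => //; rewrite inE/= in_itv/=.
    by move=> /andP[/ltW ax xb]; case: Ix; exact: Iitv ax xb.
  have lTS u v : I u -> I v -> (T u < T v) = (u < v).
    move=> Iu Iv; case: (ltgtP u v) => [/Tmono->//|vu|->]; last by rewrite ltxx.
    by apply/negbTE; rewrite -leNgt ltW// Tmono.
  have <- : (x \in `]S a, S b]%classic) = (x \in T @^-1` `]a, b]).
    have h1 : (a < T x) = (S a < x) by rewrite -{1}(TS a) lTS.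
    have h2 : (T x <= b) = (x <= S b) by rewrite -{1}(TS b) !leNgt lTS.
    by apply/idP/idP; rewrite !inE/= !in_itv/= h1 h2.
  by rewrite (mem_set Ix) mul1r.
rewrite -[in RHS](TS a) -[in RHS](TS b) -EFinB; apply: integral_derive.
- exact: SS.
- by move=> x; rewrite in_itv/= => /andP[ax xb]; apply/dT/(Iitv a b).
- by move=> x; rewrite in_itv/= => /andP[ax xb]; apply/cf/(Iitv a b).
Qed.

End OneDimension.

Section LineMaps.
Context {R : realType}.
Local Notation lambda := (@lebesgue_measure R).

Lemma transports_opp : transports lambda lambda (@GRing.opp R) (cst 1) (cst 1).
Proof.
have mN : measurable_fun setT (@GRing.opp R) by [].
apply: transports_indic => // A mA.
rewrite -[RHS]lebesgue_measureN// /pushforward.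
rewrite -[in RHS](setIT (_ @^-1` A)) -integral_indic//; last first.
  by rewrite -[_ @^-1` _]setTI; exact: mN.
by apply: eq_integral => x _; rewrite mule1 !indicE.
Qed.

Lemma is_derive_sqrt_sum_sqr (m x : R) : 0 < m ->
  is_derive x 1 (fun t => Num.sqrt (m + t ^+ 2)) (x / Num.sqrt (m + x ^+ 2)).
Proof.
move=> m0; have p : 0 < m + x ^+ 2 by rewrite ltr_pwDl// sqr_ge0.
have d1 : is_derive x 1 (fun t : R => m + t ^+ 2) (2 * x).
  by apply: is_derive_eq; rewrite /GRing.scale/=; ring.
have d2 := is_derive1_sqrt p.
have d3 := @is_derive1_comp _ (@Num.sqrt R) (fun t : R => m + t ^+ 2) x _ _ d2 d1.
apply: is_derive_eq d3 _; field; rewrite gt_eqF ?sqrtr_gt0//.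
Qed.

(** For a < 0 the map is the composite of a reflection and of the case - a. *)
Lemma transports_affine (a b : R) : a != 0 ->
  transports lambda lambda (fun x => a * x + b) (cst `|a|) (cst 1).
Proof.
wlog a0 : a / 0 < a => [wl|] an0.
  case: (ltgtP a 0) an0 => // [a0 _|a0 _]; last by apply: wl => //; rewrite gt_eqF.
  have a0' : 0 < - a by rewrite oppr_gt0.
  have tr := wl (- a) a0' (lt0r_neq0 a0') => F mF F0.
  rewrite -(tr F mF F0)/= normrN.
  have mG : measurable_fun setT (fun x => F (- a * x + b)%R * `|a|%:E)%E.
    apply: emeasurable_funM => //; apply: (measurableT_comp mF).
    by apply: measurable_funD => //; apply: measurable_funM.
  have G0 x : (0 <= F (- a * x + b)%R * `|a|%:E)%E by rewrite mule_ge0 ?lee_fin.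
  have := transports_opp mG G0.
  under eq_integral do rewrite mule1 mulrNN.
  by under [in X in _ = X -> _]eq_integral do rewrite mule1.
have := @transports_diffeo R (fun x => a * x + b) (fun y => (y - b) / a) (cst a) setT.
rewrite (ger0_norm (ltW a0)) => h.
apply: transports_ext (h _ _ _ _ _ _ _ _ _ _) => //.
- by move=> x; rewrite indicT mul1r.
- by apply: measurable_funD => //; apply: measurable_funM.
- by move=> x; exact: ltW.
- by move=> y; field.
- by move=> x y _ _ xy; rewrite ltrD2r ltr_pM2l.
- by move=> x _; apply: is_derive_eq; rewrite addr0 -[_ *: _]/(_ * _) mulr1.
- by move=> x _; exact: cst_continuous.
Qed.

Lemma transports_punctured :
  transports lambda lambda idfun (fun x : R => (x != 0)%:R) (cst 1).
Proof.
move=> F mF F0; under [RHS]eq_integral do rewrite mule1.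
rewrite -[RHS](@integral_setD1 _ _ 0); [|exact: measurableD|exact: measurable_funTS].
rewrite [RHS]integral_mkcond; apply: eq_integral => x _.
rewrite patchE; have [->|x0] := eqVneq x 0.
  by rewrite memNset ?mule0//= => -[].
by rewrite mem_set ?mule1//=; split=> //; exact/eqP.
Qed.

Lemma transports_tan :
  transports lambda lambda (@tan R)
    (fun x => \1_(`](- (pi / 2)), (pi / 2)[) x * (1 + tan x ^+ 2)) (cst 1).
Proof.
have mtan : measurable_fun setT (@tan R).
  apply: measurable_funM; first exact: measurable_fun_sin.
  by apply: measurable_fun_inv; exact: measurable_fun_cos.
have cosn x : `](- (pi / 2)), (pi / 2)[%classic x -> cos x != 0 :> R.
  by rewrite /= in_itv/= => xI; rewrite gt_eqF// cos_gt0_pihalf.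
apply: (@transports_diffeo R tan atan (fun x => 1 + tan x ^+ 2)) => //.
- by apply: measurable_funD => //; exact: measurable_funX.
- by move=> x; rewrite addr_ge0 ?sqr_ge0.
- by move=> y /=; rewrite in_itv/= atan_gtNpi2 atan_ltpi2.
- exact: atanK.
- by move=> x y xI yI; rewrite ltr_tan.
- move=> a b x ax xb; rewrite /= in_itv/= (lt_le_trans (atan_gtNpi2 a) ax).
  by rewrite (le_lt_trans xb (atan_ltpi2 b)).
- move=> x /cosn cx; rewrite -cos2_tan2//; exact: is_derive_tan.
- move=> x /cosn cx; apply: cvgD; first exact: cvg_cst.
  by apply: cvgM; exact: continuous_tan.
Qed.

End LineMaps.

Section BoostRadial.
Context {R : realType}.
Local Notation lambda := (@lebesgue_measure R).

(** With m the squared transverse mass, the momentum x and the energy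
sqrt (m + x^2) are mixed by the hyperbolic rotation (g, h). *)
Lemma sqrt_boost (m g h x : R) : 0 < m -> 0 < g -> g ^+ 2 = 1 + h ^+ 2 ->
  Num.sqrt (m + (g * x - h * Num.sqrt (m + x ^+ 2)) ^+ 2) =
  g * Num.sqrt (m + x ^+ 2) - h * x.
Proof.
move=> m0 g0 gh; set e := Num.sqrt (m + x ^+ 2).
have e0 : 0 <= e by exact: sqrtr_ge0.
have e2 : e ^+ 2 = m + x ^+ 2 by rewrite sqr_sqrtr// addr_ge0 ?sqr_ge0 ?ltW.
have le0 : 0 <= g * e - h * x.
  rewrite subr_ge0 (le_trans (ler_norm _))// -ler_sqr ?nnegrE//; last first.
    by rewrite mulr_ge0// ltW.
  rewrite real_normK ?num_real// !exprMn gh e2.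
  have := sqr_ge0 x; have := sqr_ge0 h; nra.
rewrite -[RHS](ger0_norm le0) -sqrtr_sqr; congr Num.sqrt.
have -> : (g * e - h * x) ^+ 2 = g ^+ 2 * e ^+ 2 - 2 * g * e * h * x + h ^+ 2 * x ^+ 2
  by ring.
have -> : (g * x - h * e) ^+ 2 = g ^+ 2 * x ^+ 2 - 2 * g * e * h * x + h ^+ 2 * e ^+ 2
  by ring.
by rewrite gh e2; ring.
Qed.

(** The derivative of the boosted momentum is the ratio of the boosted energy to
the energy, so dx / energy is invariant. *)
Lemma transports_boost (m g h : R) : 0 < m -> 0 < g -> g ^+ 2 = 1 + h ^+ 2 ->
  transports lambda lambda (fun x => g * x - h * Num.sqrt (m + x ^+ 2))
    (fun x => (Num.sqrt (m + x ^+ 2))^-1) (fun x => (Num.sqrt (m + x ^+ 2))^-1).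
Proof.
move=> m0 g0 gh; pose e (x : R) : R := Num.sqrt (m + x ^+ 2).
have e_gt0 x : 0 < e x by rewrite sqrtr_gt0 ltr_pwDl// sqr_ge0.
have e2 x : e x ^+ 2 = m + x ^+ 2 by rewrite sqr_sqrtr// addr_ge0 ?sqr_ge0 ?ltW.
have me : measurable_fun setT e.
  by apply: measurable_fun_sqrt; apply: measurable_funD => //; exact: measurable_funX.
have mei : measurable_fun setT (fun x => (e x)^-1) by exact: measurable_fun_inv.
have eT x : e (g * x - h * e x) = g * e x - h * x by exact: sqrt_boost.
have hg : `|h| < g.
  by rewrite -ltr_sqr ?nnegrE ?normr_ge0 ?ltW// real_normK ?num_real// gh ltrDr.
have xe x : `|x| < e x.
  by rewrite -ltr_sqr ?nnegrE ?normr_ge0 ?ltW// real_normK ?num_real// e2 ltrDr.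
have fpos x : 0 < g - h * (x / e x).
  rewrite subr_gt0 (le_lt_trans (ler_norm _))// normrM (le_lt_trans _ hg)//.
  rewrite ler_piMr// normrM normfV (gtr0_norm (e_gt0 x)) ler_pdivrMr//.
  by rewrite mul1r ltW.
have emono x y : `|e y - e x| <= `|y - x|.
  rewrite -ler_sqr ?nnegrE ?normr_ge0// !real_normK ?num_real//.
  rewrite !sqrrB !e2.
  suff : m + x * y <= e x * e y by lra.
  rewrite (le_trans (ler_norm _))// -ler_sqr ?nnegrE ?normr_ge0 ?mulr_ge0 ?(ltW (e_gt0 _))//.
  rewrite real_normK ?num_real// exprMn !e2.
  rewrite -subr_ge0.
  have -> : (m + x ^+ 2) * (m + y ^+ 2) - (m + x * y) ^+ 2 = m * (x - y) ^+ 2 by ring.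
  by rewrite mulr_ge0 ?sqr_ge0 ?ltW.
have cf (x : R) : {for x, continuous (fun t : R => (g - h * (t / e t) : R))}.
  apply: cvgB; first exact: cvg_cst.
  apply: cvgM; first exact: cvg_cst.
  apply: cvgM; first exact: cvg_id.
  apply: cvgV; first by rewrite gt_eqF.
  apply: differentiable_continuous; apply/derivable1_diffP.
  by apply: ex_derive; exact: is_derive_sqrt_sum_sqr.
have trT : transports lambda lambda (fun x => g * x - h * e x)
    (fun x => \1_setT x * (g - h * (x / e x))) (cst 1).
  apply: (@transports_diffeo R _ (fun y => g * y + h * e y)) => //.
  - by apply: measurable_funB; apply: measurable_funM.
  - by apply: measurable_funB => //; do 2 apply: measurable_funM => //.
  - by move=> x; exact: ltW.
  - move=> y.
    have eS : e (g * y + h * e y) = g * e y + h * y.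
      have := @sqrt_boost m g (- h) y m0 g0.
      by rewrite sqrrN !mulNr !opprK => /(_ gh).
    rewrite eS.
    have -> : g * (g * y + h * e y) - h * (g * e y + h * y) =
      (g ^+ 2 - h ^+ 2) * y by ring.
    by rewrite gh addrK mul1r.
  - move=> x y _ _ xy; rewrite -subr_gt0.
    have -> : g * y - h * e y - (g * x - h * e x) = g * (y - x) - h * (e y - e x) by ring.
    rewrite subr_gt0 (le_lt_trans (ler_norm _))// normrM.
    rewrite (@le_lt_trans _ _ (`|h| * `|y - x|)) ?ler_wpM2l//.
    have yx : 0 < y - x by rewrite subr_gt0.
    by rewrite (gtr0_norm yx) ltr_pM2r.
  - move=> x _; have := @is_derive_sqrt_sum_sqr R m x m0 => de.
    by apply: is_derive_eq; rewrite /GRing.scale/= mulr1.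
have ei0 x : 0 <= (e x)^-1 by rewrite invr_ge0 ltW.
have := transports_weight (Y := measurableTypeR R) mei ei0 trT.
apply: transports_ext => [//|x|x]; last by rewrite mulr1.
rewrite eT indicT mul1r -/(e x).
have p : 0 < g * e x - h * x.
  rewrite subr_gt0 (le_lt_trans (ler_norm _))// normrM.
  by rewrite ltr_pM.
by field; rewrite !gt_eqF.
Qed.

(** The substitution x = sqrt (1 + r^2) maps a half-line onto a half-line, whereas
[transports_diffeo] has the whole line as its target. Both half-lines are
therefore mapped onto the line, by ln (x - 1) and by its composite with the
substitution, and the two results are compared. *)
Lemma transports_energy :
  transports lambda lambda (fun r => Num.sqrt (1 + r ^+ 2))
    (fun r => \1_(`]0, +oo[) r * (r / Num.sqrt (1 + r ^+ 2))) (\1_(`]1, +oo[)).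
Proof.
pose e (r : R) : R := Num.sqrt (1 + r ^+ 2).
have e_gt0 x : 0 < e x by rewrite sqrtr_gt0 ltr_pwDl// sqr_ge0.
have e2 x : e x ^+ 2 = 1 + x ^+ 2 by rewrite sqr_sqrtr// addr_ge0 ?sqr_ge0 ?ltW.
have me : measurable_fun setT e.
  by apply: measurable_fun_sqrt; apply: measurable_funD => //; exact: measurable_funX.
have e_ge1 x : 1 <= e x.
  by rewrite -[leLHS]sqrtr1 ler_wsqrtr// lerDl sqr_ge0.
have e_gt1 x : 0 < x -> 1 < e x.
  by move=> x0; rewrite -[ltLHS]sqrtr1 ltr_sqrt ?ltrDl ?exprn_gt0// ltr_pwDl// sqr_ge0.
have ce (x : R) : {for x, continuous e}.
  apply: differentiable_continuous; apply/derivable1_diffP.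
  by apply: ex_derive; exact: is_derive_sqrt_sum_sqr.
have mln (f : R -> R) : measurable_fun setT f -> measurable_fun setT (fun x => ln (f x)).
  by apply: measurableT_comp; exact: measurable_ln.
have E1 (y : R) : 0 <= 1 + expR y by rewrite addr_ge0 ?expR_ge0.
have tr1 : transports lambda lambda (fun r => ln (e r - 1))
    (fun r => \1_(`]0, +oo[) r * ((e r - 1)^-1 * (`|r| / e r))) (cst 1).
  apply: (@transports_diffeo R _ (fun y => Num.sqrt ((1 + expR y) ^+ 2 - 1))) => //.
  - by apply: mln; exact: measurable_funB.
  - apply: measurable_funM; first by apply: measurable_fun_inv; exact: measurable_funB.
    by apply: measurable_funM; [exact: measurable_fun_norm|exact: measurable_fun_inv].
  - by move=> x; rewrite mulr_ge0 ?mulr_ge0 ?invr_ge0 ?subr_ge0// ltW.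
  - move=> y; by rewrite /= in_itv/= andbT sqrtr_gt0 subr_gt0 expr_gt1 ?E1// ltrDl expR_gt0.
  - move=> y; rewrite /e sqr_sqrtr; last first.
      by rewrite subr_ge0 expr_ge1 ?E1// lerDl expR_ge0.
    rewrite addrCA subrr addr0 sqrtr_sqr ger0_norm ?E1//.
    by rewrite addrAC subrr add0r expRK.
  - move=> x y; rewrite /= !in_itv/= !andbT => x0 y0 xy.
    rewrite ltr_ln ?posrE ?subr_gt0 ?e_gt1// ltrD2r ltr_sqrt ?ltrD2l.
      by rewrite ltr_pXn2r ?nnegrE ?ltW.
    by rewrite ltr_pwDl// sqr_ge0.
  - move=> a b x ax _; rewrite /= in_itv/= andbT (lt_le_trans _ ax)//.
    by rewrite sqrtr_gt0 subr_gt0 expr_gt1 ?E1// ltrDl expR_gt0.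
  - move=> x; rewrite /= in_itv/= andbT => x0; rewrite (gtr0_norm x0).
    have p : 0 < e x - 1 by rewrite subr_gt0 e_gt1.
    have de := @is_derive_sqrt_sum_sqr R 1 x ltr01.
    have d1 : is_derive x 1 (fun t => e t - 1) (x / e x).
      by apply: is_derive_eq; rewrite subr0.
    exact: (@is_derive1_comp _ (@ln R) (fun t => e t - 1) x _ _ (is_derive1_ln p) d1).
  - move=> x; rewrite /= in_itv/= andbT => x0.
    apply: cvgM.
      by apply: cvgV; [rewrite gt_eqF// subr_gt0 e_gt1|apply: cvgB;
        [exact: ce|exact: cvg_cst]].
    apply: cvgM; first exact: norm_continuous.
    by apply: cvgV; [rewrite gt_eqF|exact: ce].
have tr2 : transports lambda lambda (fun x : R => ln (x - 1))
    (fun x => \1_(`]1, +oo[) x * `|(x - 1)^-1|) (cst 1).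
  apply: (@transports_diffeo R _ (fun y => 1 + expR y)) => //.
  - by apply: mln; exact: measurable_funB.
  - by apply: measurable_fun_norm; apply: measurable_fun_inv; exact: measurable_funB.
  - by move=> y; rewrite /= in_itv/= andbT ltrDl expR_gt0.
  - by move=> y; rewrite addrAC subrr add0r expRK.
  - move=> x y; rewrite /= !in_itv/= !andbT => x0 y0 xy.
    by rewrite ltr_ln ?posrE ?subr_gt0// ltrD2r.
  - move=> a b x ax _; rewrite /= in_itv/= andbT (lt_le_trans _ ax)//.
    by rewrite ltrDl expR_gt0.
  - move=> x; rewrite /= in_itv/= andbT => x0.
    have p : 0 < x - 1 by rewrite subr_gt0.
    rewrite gtr0_norm ?invr_gt0//.
    have d1 : is_derive x 1 (fun t : R => t - 1) 1.
      by apply: is_derive_eq; rewrite subr0.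
    have := @is_derive1_comp _ (@ln R) (fun t => t - 1) x _ _ (is_derive1_ln p) d1.
    by rewrite mulr1.
  - move=> x; rewrite /= in_itv/= andbT => x0.
    apply: (@continuous_comp _ _ _ (fun x : R => (x - 1)^-1) (fun t : R => `|t|)).
      apply: cvgV; first by rewrite gt_eqF// subr_gt0.
      by apply: cvgB; [exact: cvg_id|exact: cvg_cst].
    exact: norm_continuous.
move=> F mF F0.
pose G (y : measurableTypeR R) := (F (1 + expR y)%R * (expR y)%:E)%E.
have mG : measurable_fun setT G.
  apply: emeasurable_funM; last by apply/measurable_EFinP; exact: measurable_expR.
  by apply: (measurableT_comp mF); apply: measurable_funD => //; exact: measurable_expR.
have G0 y : (0 <= G y)%E by rewrite mule_ge0// lee_fin expR_ge0.
have := tr1 G mG G0; rewrite -(tr2 G mG G0) => h.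
transitivity (\int[lambda]_x (G (ln (e x - 1)%R) *
  (\1_(`]0%R, +oo[) x * ((e x - 1)^-1 * (`|x| / e x)))%R%:E))%E.
  apply: eq_integral => x _; rewrite /G !indicE.
  have [x0|x0] := ltP 0 x; last first.
    rewrite memNset ?mul0r ?mule0//=.
    by rewrite in_itv/= andbT => /lt_le_trans/(_ x0); rewrite ltxx.
  rewrite mem_set ?mul1r/=; last by rewrite in_itv/= x0.
  have p : 0 < e x - 1 by rewrite subr_gt0 e_gt1.
  have e1 : 1 + (e x - 1) = e x by rewrite addrC subrK.
  rewrite lnK ?posrE// e1 -muleA -EFinM; congr (_ * _%:E)%E.
  by rewrite (gtr0_norm x0) mulrA divff ?gt_eqF// mul1r.
rewrite h; apply: eq_integral => x _; rewrite /G !indicE.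
have [x0|x0] := ltP 1 x; last first.
  rewrite memNset ?mul0r ?mule0//=.
  by rewrite in_itv/= andbT => /lt_le_trans/(_ x0); rewrite ltxx.
rewrite mem_set ?mul1r/=; last by rewrite in_itv/= x0.
have p : 0 < x - 1 by rewrite subr_gt0.
have e1 : 1 + (x - 1) = x by rewrite addrC subrK.
rewrite lnK ?posrE// e1 -muleA -EFinM; congr (_ * _%:E)%E.
by rewrite gtr0_norm ?invr_gt0// divff// gt_eqF.
Qed.

End BoostRadial.

(** * Lebesgue measure of the space and its symmetries *)

Section Space.
Context {R : realType}.
Local Notation mR := (measurableTypeR R).
Local Notation lambda := (@lebesgue_measure R).

Lemma sigma_finite_plane : sigma_finite setT (lambda \x lambda)%E.
Proof.
have /sigma_finiteP[F [TF ndF Foo]] := sigma_finiteT lambda.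
exists (fun n => F n `*` F n).
  apply/seteqP; split => // -[x y] _.
  have [m _ Fx] : (\bigcup_n F n) x by rewrite -TF.
  have [n _ Fy] : (\bigcup_n F n) y by rewrite -TF.
  exists (maxn m n) => //; split => /=.
  - by move: x Fx; exact/subsetPset/ndF/leq_maxl.
  - by move: y Fy; exact/subsetPset/ndF/leq_maxr.
move=> k; have [mF Fk] := Foo k; split; first exact: measurableX.
by rewrite [X in (X < _)%E]product_measure1E// lte_mul_pinfty// ge0_fin_numE.
Qed.

(** The measure of the plane together with its sigma-finiteness, which Tonelli
requires of the first factor of the space. *)
Definition plane_measure : {sigma_finite_measure set (mR * mR)%type -> \bar R} :=
  HB.pack_for {sigma_finite_measure set (mR * mR)%type -> \bar R}
    (lambda \x lambda)%E
    (Measure_isSigmaFinite.Build _ _ _ (lambda \x lambda)%E sigma_finite_plane).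

Local Notation plane := plane_measure.
Local Notation space := (plane \x lambda)%E.

Lemma lebesgue3E :
  @lebesgue3 R = space :> {measure set (mR * mR * mR)%type -> \bar R}.
Proof. by []. Qed.

Lemma transports_lift (T : mR * mR -> mR * mR) (w w' : mR * mR -> R) :
  measurable_fun setT T -> measurable_fun setT w -> measurable_fun setT w' ->
  (forall p, 0 <= w p) -> (forall p, 0 <= w' p) ->
  transports plane plane T w w' ->
  transports space space (fun p => (T p.1, p.2)) (fun p => w p.1) (fun p => w' p.1).
Proof.
move=> mT mw mw' w0 w'0 tr.
have := (@transports_fiber1 _ _ _ (mR * mR)%type mR (mR * mR)%type R plane lambda plane
  (fun p => T p.1) (fun p => w p.1) (fun p => w' p.1)).
apply.
- by apply: (measurableT_comp mT); exact: measurable_fst.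
- by apply: (measurableT_comp mw); exact: measurable_fst.
- by apply: (measurableT_comp mw'); exact: measurable_fst.
- by move=> p; exact: w0.
- by move=> p; exact: w'0.
- by move=> y.
Qed.

Lemma measurable_coord1 : measurable_fun setT (fun p : mR * mR * mR => p.1.1).
Proof. by apply: measurable_fun_proj1; exact: measurable_fst. Qed.

Lemma measurable_coord2 : measurable_fun setT (fun p : mR * mR * mR => p.1.2).
Proof. by apply: measurable_fun_proj2; exact: measurable_fst. Qed.

Lemma measurable_coord3 : measurable_fun setT (fun p : mR * mR * mR => p.2).
Proof. exact: measurable_snd. Qed.

Definition swap23 (p : mR * mR * mR) : mR * mR * mR := (p.1.1, p.2, p.1.2).

Lemma measurable_swap23 : measurable_fun setT swap23.
Proof.
apply: measurable_fun_pair; last exact: measurable_coord2.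
apply: measurable_fun_pair; [exact: measurable_coord1|exact: measurable_coord3].
Qed.

Lemma space_integral (F : mR * mR * mR -> \bar R) :
  measurable_fun setT F -> (forall p, (0 <= F p)%E) ->
  (\int[space]_p F p =
   \int[lambda]_x \int[lambda]_y \int[lambda]_z F (x, y, z))%E.
Proof.
move=> mF F0; rewrite (fubini_tonelli1 F mF F0).
rewrite (fubini_tonelli1 _ (measurable_fun_fubini_tonelli_F F mF F0))//.
by move=> p; apply: integral_ge0.
Qed.

Lemma transports_swap23 : transports space space swap23 (cst 1) (cst 1).
Proof.
move=> F mF F0.
under eq_integral do rewrite mule1.
under [RHS]eq_integral do rewrite mule1.
have mG : measurable_fun setT (F \o swap23).
  by apply: (measurableT_comp mF); exact: measurable_swap23.
rewrite (space_integral mG (fun p => F0 _)) (space_integral mF F0).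
apply: eq_integral => x _; apply/esym.
apply: (@fubini_tonelli _ _ mR mR R lambda lambda (fun yz => F (x, yz.1, yz.2))).
  apply: (measurableT_comp mF).
  apply: measurable_fun_pair; last exact: measurable_snd.
  by apply: measurable_fun_pair; [exact: measurable_cst|exact: measurable_fst].
by move=> p.
Qed.

(** A rotation is the product of three shears, of slopes t, - s and t, where
t = s / (1 + c) is the tangent of half the angle. The bound 0 <= c keeps the
denominator away from 0; [planar_alignment] only needs such rotations. *)
Lemma transports_rotation (c s : R) : c ^+ 2 + s ^+ 2 = 1 -> 0 <= c ->
  transports plane plane (fun p : mR * mR => (c * p.1 + s * p.2, - s * p.1 + c * p.2) : mR * mR)
    (cst 1) (cst 1).
Proof.
move=> cs c0; pose t := s / (1 + c).
have c1 : 1 + c != 0 by rewrite gt_eqF// ltr_pwDl.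
have st : 1 - s * t = c.
  have := cs; rewrite /t => h; apply: (mulIf c1); rewrite mulrBl mul1r.
  by rewrite -mulrA divfK// -expr2; lra.
have shear1 (a : R) : transports plane plane (fun p : mR * mR => (p.1 + a * p.2, p.2) : mR * mR)
    (cst 1) (cst 1).
  apply: (@transports_fiber1 _ _ _ mR mR mR R lambda lambda lambda
    (fun p => p.1 + a * p.2)) => // [|y].
    apply: measurable_funD; first exact: measurable_fst.
    by apply: measurable_funM => //; exact: measurable_snd.
  apply: transports_ext (@transports_affine R 1 (a * y) (oner_neq0 _)) => //=.
    by move=> x _; rewrite mul1r.
  by move=> x; rewrite normr1.
have shear2 (a : R) : transports plane plane (fun p : mR * mR => (p.1, p.2 + a * p.1) : mR * mR)
    (cst 1) (cst 1).
  apply: (@transports_fiber2 _ _ _ mR mR mR R lambda lambda lambda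
    (fun p => p.2 + a * p.1)) => // [|y].
    apply: measurable_funD; first exact: measurable_snd.
    by apply: measurable_funM => //; exact: measurable_fst.
  apply: transports_ext (@transports_affine R 1 (a * y) (oner_neq0 _)) => //=.
    by move=> x _; rewrite mul1r.
  by move=> x; rewrite normr1.
have m1 (a : R) : measurable_fun setT (fun p : mR * mR => (p.1 + a * p.2, p.2) : mR * mR).
  apply: measurable_fun_pair; last exact: measurable_snd.
  apply: measurable_funD; first exact: measurable_fst.
  by apply: measurable_funM => //; exact: measurable_snd.
have m2 (a : R) : measurable_fun setT (fun p : mR * mR => (p.1, p.2 + a * p.1) : mR * mR).
  apply: measurable_fun_pair; first exact: measurable_fst.
  apply: measurable_funD; first exact: measurable_snd.
  by apply: measurable_funM => //; exact: measurable_fst.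
have := transports_comp (m1 t) (transports_comp (m2 (- s)) (shear1 t) (shear2 (- s)))
  (shear1 t).
apply: transports_ext => // -[x y] _ /=; congr (_, _); last first.
  by rewrite -st; ring.
transitivity ((1 - s * t) * x + (t * (1 + (1 - s * t))) * y); first by ring.
by rewrite st; congr (_ + _ * _); rewrite /t divfK.
Qed.

End Space.

(** * Lorentz invariance of the measure on the mass shell *)

Section RestFrame.
Context {R : realType}.
Local Notation mR := (measurableTypeR R).
Local Notation mR3 := (mR * mR * mR)%type.
Local Notation lambda := (@lebesgue_measure R).
Local Notation plane := (@plane_measure R).
Local Notation space := (plane \x lambda)%E.
Implicit Types u p : R * R * R.

Definition dot u p := u.1.1 * p.1.1 + u.1.2 * p.1.2 + u.2 * p.2.

Definition shell p := Num.sqrt (1 + dot p p).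

Definition gamma u := (Num.sqrt (1 - dot u u))^-1.

(** The spatial components of p along the tetrad of u, that is, the momentum
after the rotation-free boost to the rest frame of u. *)
Definition rest u p : R * R * R :=
  let k := gamma u ^+ 2 / (gamma u + 1) * dot u p - gamma u * shell p in
  (p.1.1 + k * u.1.1, p.1.2 + k * u.1.2, p.2 + k * u.2).

Lemma dot_ge0 p : 0 <= dot p p.
Proof. by rewrite /dot -!expr2 !addr_ge0 ?sqr_ge0. Qed.

Lemma shell_gt0 p : 0 < shell p.
Proof. by rewrite sqrtr_gt0 ltr_pwDl// dot_ge0. Qed.

Lemma sqr_shell p : shell p ^+ 2 = 1 + dot p p.
Proof. by rewrite sqr_sqrtr// addr_ge0// dot_ge0. Qed.

Lemma gamma_gt0 u : dot u u < 1 -> 0 < gamma u.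
Proof. by move=> u1; rewrite invr_gt0 sqrtr_gt0 subr_gt0. Qed.

Lemma sqr_gamma u : dot u u < 1 -> gamma u ^+ 2 * (1 - dot u u) = 1.
Proof.
move=> u1; have p : 0 < 1 - dot u u by rewrite subr_gt0.
by rewrite exprVn sqr_sqrtr ?(ltW p)// mulVf// gt_eqF.
Qed.

Lemma measurable_dot u : measurable_fun [set: mR3] (dot u).
Proof.
apply: measurable_funD; last by apply: measurable_funM => //; exact: measurable_coord3.
apply: measurable_funD; apply: measurable_funM => //.
- exact: measurable_coord1.
- exact: measurable_coord2.
Qed.

Lemma measurable_shell : measurable_fun [set: mR3] shell.
Proof.
apply: measurable_fun_sqrt; apply: measurable_funD => //.
apply: measurable_funD; last by apply: measurable_funM; exact: measurable_coord3.
apply: measurable_funD; apply: measurable_funM;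
  first [exact: measurable_coord1|exact: measurable_coord2].
Qed.

Lemma measurable_invshell : measurable_fun [set: mR3] (fun p => (shell p)^-1).
Proof. by apply: measurable_fun_inv; exact: measurable_shell. Qed.

Lemma invshell_ge0 p : 0 <= (shell p)^-1.
Proof. by rewrite invr_ge0 ltW// shell_gt0. Qed.

Lemma measurable_rest u : measurable_fun [set: mR3] (rest u : mR3 -> mR3).
Proof.
have mk : measurable_fun [set: mR3] (fun p =>
    gamma u ^+ 2 / (gamma u + 1) * dot u p - gamma u * shell p).
  apply: measurable_funB; apply: measurable_funM => //; first exact: measurable_dot.
  exact: measurable_shell.
apply: measurable_fun_pair; last first.
  by apply: measurable_funD; [exact: measurable_coord3|exact: measurable_funM].
apply: measurable_fun_pair; apply: measurable_funD; try exact: measurable_funM.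
- exact: measurable_coord1.
- exact: measurable_coord2.
Qed.

(** Invariance of the measure d^3p / p^0. *)
Definition boost_invariant u :=
  transports space space (rest u : mR3 -> mR3)
    (fun p => (shell p)^-1) (fun p => (shell p)^-1).

(** The boost moves the first coordinate only, and on each line parallel to the
first axis it is the substitution of [transports_boost] with m = 1 + y^2 + z^2. *)
Lemma boost_invariant_axis w : w ^+ 2 < 1 -> boost_invariant (w, 0, 0).
Proof.
move=> w1; set u := (w, 0, 0).
have uu : dot u u = w ^+ 2 by rewrite /dot/=; ring.
have u1 : dot u u < 1 by rewrite uu.
pose g := gamma u; have g0 : 0 < g by exact: gamma_gt0.
have gh : g ^+ 2 = 1 + (g * w) ^+ 2.
  by have := sqr_gamma u1; rewrite uu -/g => <-; ring.
pose t (p : mR3) : R := g * p.1.1 - g * w * shell p.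
have mt : measurable_fun setT t.
  apply: measurable_funB; apply: measurable_funM => //; first exact: measurable_coord1.
  exact: measurable_shell.
have restE p : rest u p = (t p, p.1.2, p.2).
  rewrite /rest /t -/g/= !mulr0 !addr0; congr (_, _, _).
  rewrite /dot/= !mul0r !addr0.
  have g1 : g + 1 != 0 by rewrite gt_eqF// addr_gt0.
  have -> : g * p.1.1 = p.1.1 + (g ^+ 2 - 1) / (g + 1) * p.1.1 by field.
  have -> : g ^+ 2 - 1 = (g * w) ^+ 2 by rewrite gh addrAC subrr add0r.
  by field.
have tr2 : transports space space (fun p => (t p, p.1.2, p.2) : mR3)
    (fun p => (shell p)^-1) (fun p => (shell p)^-1).
  pose t2 (z : mR) (p : mR * mR) : mR := t (p, z).
  have := @transports_fiber1 _ _ _ (mR * mR)%type mR (mR * mR)%type R plane lambda plane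
   (fun p => (t p, p.1.2)) (fun p => (shell p)^-1) (fun p => (shell p)^-1).
  apply.
  - by apply: measurable_fun_pair => //; exact: measurable_coord2.
  - exact: measurable_invshell.
  - exact: measurable_invshell.
  - by move=> p; exact: invshell_ge0.
  - by move=> p; exact: invshell_ge0.
  move=> z.
  have mpair : measurable_fun setT (fun p : mR * mR => (p, z) : mR3).
    by apply: measurable_fun_pair => //; exact: measurable_cst.
  have := @transports_fiber1 _ _ _ mR mR mR R lambda lambda lambda
   (fun p : mR * mR => t (p, z)) (fun p : mR * mR => (shell ((p, z) : mR3))^-1)
   (fun p : mR * mR => (shell ((p, z) : mR3))^-1).
  apply.
  - exact: (measurableT_comp mt mpair).
  - exact: (measurableT_comp measurable_invshell mpair).
  - exact: (measurableT_comp measurable_invshell mpair).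
  - by move=> p; exact: invshell_ge0.
  - by move=> p; exact: invshell_ge0.
  move=> y; pose m := 1 + y ^+ 2 + z ^+ 2.
  have m0 : 0 < m by rewrite /m -addrA ltr_pwDl// addr_ge0 ?sqr_ge0.
  have sE x : shell (x, y, z) = Num.sqrt (m + x ^+ 2).
    by rewrite /shell /dot/=; congr Num.sqrt; rewrite /m; ring.
  have := transports_boost m0 g0 gh.
  by apply: transports_ext => x *; rewrite /t sE.
by apply: transports_ext tr2 => // p _; rewrite restE.
Qed.

(** A linear isometry T conjugates the boost of velocity u to the boost of
velocity T u. *)
Lemma boost_invariant_conj (T T' : mR3 -> mR3) u :
  measurable_fun setT T -> measurable_fun setT T' ->
  transports space space T (cst 1) (cst 1) ->
  transports space space T' (cst 1) (cst 1) ->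
  (forall p, T' (T p) = p) ->
  (forall p q, dot (T p) (T q) = dot p q) ->
  (forall p q, dot (T' p) (T' q) = dot p q) ->
  (forall k p q, T' (p.1.1 + k * q.1.1, p.1.2 + k * q.1.2, p.2 + k * q.2) =
     ((T' p).1.1 + k * (T' q).1.1, (T' p).1.2 + k * (T' q).1.2,
      (T' p).2 + k * (T' q).2)) ->
  boost_invariant (T u) -> boost_invariant u.
Proof.
move=> mT mT' trT trT' TK dT dT' linT' inv.
have wT := @transports_weight _ _ _ _ _ space space _ _ _ _ measurable_invshell invshell_ge0.
have {trT} := wT _ _ _ trT; have {trT'} := wT _ _ _ trT' => trT' trT.
have tr1 : transports space space T (fun p => (shell p)^-1) (fun p => (shell p)^-1).
  by apply: transports_ext trT => // p; rewrite mulr1// /shell dT.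
have tr2 : transports space space T' (fun p => (shell p)^-1) (fun p => (shell p)^-1).
  by apply: transports_ext trT' => // p; rewrite mulr1// /shell dT'.
have mr := @measurable_rest (T u).
have := transports_comp (measurableT_comp mT' mr) tr1 (transports_comp mT' inv tr2).
apply: transports_ext => // p _ /=.
by rewrite /rest /gamma /shell !dT linT' !TK.
Qed.

(** Lines rather than half-lines are aligned with the first axis, which leaves
the sign of c free. *)
Lemma planar_alignment (a b : R) :
  exists c s, [/\ c ^+ 2 + s ^+ 2 = 1, 0 <= c & - s * a + c * b = 0].
Proof.
pose n := Num.sqrt (a ^+ 2 + b ^+ 2).
have n2 : n ^+ 2 = a ^+ 2 + b ^+ 2 by rewrite sqr_sqrtr// addr_ge0 ?sqr_ge0.
have [n0|n0] := eqVneq n 0.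
  exists 1, 0; split; rewrite ?expr1n ?expr0n ?addr0//.
  have /eqP : a ^+ 2 + b ^+ 2 = 0 by rewrite -n2 n0 expr0n.
  rewrite paddr_eq0 ?sqr_ge0// !sqrf_eq0 => /andP[_ /eqP ->].
  by rewrite oppr0 mul0r mulr0 addr0.
have ngt0 : 0 < n by rewrite lt_neqAle eq_sym n0 sqrtr_ge0.
have [a0|a0] := leP 0 a.
  exists (a / n), (b / n); split; last by field.
    by rewrite !expr_div_n -mulrDl -n2 divff// expf_neq0.
  by rewrite divr_ge0// ltW.
exists (- a / n), (- b / n); split; last by field.
  by rewrite !expr_div_n !sqrrN -mulrDl -n2 divff// expf_neq0.
by rewrite divr_ge0// ?oppr_ge0 ltW.
Qed.

Definition rot12 (c s : R) (p : mR3) : mR3 :=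
  (c * p.1.1 + s * p.1.2, - s * p.1.1 + c * p.1.2, p.2).

Lemma measurable_rot12 c s : measurable_fun setT (rot12 c s).
Proof.
apply: measurable_fun_pair; last exact: measurable_coord3.
apply: measurable_fun_pair; apply: measurable_funD; apply: measurable_funM => //.
- exact: measurable_coord1.
- exact: measurable_coord2.
- exact: measurable_coord1.
- exact: measurable_coord2.
Qed.

Lemma transports_rot12 c s : c ^+ 2 + s ^+ 2 = 1 -> 0 <= c ->
  transports space space (rot12 c s) (cst 1) (cst 1).
Proof.
move=> cs c0; have := transports_lift _ _ _ _ _ (transports_rotation cs c0).
apply => //; apply: measurable_fun_pair; apply: measurable_funD;
  by apply: measurable_funM => //; first [exact: measurable_fst|exact: measurable_snd].
Qed.

Lemma dot_rot12 c s p q : c ^+ 2 + s ^+ 2 = 1 ->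
  dot (rot12 c s p) (rot12 c s q) = dot p q.
Proof.
move=> cs; rewrite /dot /=.
transitivity ((c ^+ 2 + s ^+ 2) * (p.1.1 * q.1.1 + p.1.2 * q.1.2) + p.2 * q.2).
  by ring.
by rewrite cs mul1r.
Qed.

Lemma rot12K c s p : c ^+ 2 + s ^+ 2 = 1 -> rot12 c (- s) (rot12 c s p) = p.
Proof.
move=> cs; case: p => -[x y] z; rewrite /rot12 /=; congr (_, _, _).
  transitivity ((c ^+ 2 + s ^+ 2) * x); first by ring.
  by rewrite cs mul1r.
transitivity ((c ^+ 2 + s ^+ 2) * y); first by ring.
by rewrite cs mul1r.
Qed.

Lemma boost_invariant_rot12 c s u : c ^+ 2 + s ^+ 2 = 1 -> 0 <= c ->
  boost_invariant (rot12 c s u) -> boost_invariant u.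
Proof.
move=> cs c0; have cs' : c ^+ 2 + (- s) ^+ 2 = 1 by rewrite sqrrN.
apply: (@boost_invariant_conj _ (rot12 c (- s))).
- exact: measurable_rot12.
- exact: measurable_rot12.
- exact: transports_rot12.
- exact: transports_rot12.
- by move=> p; exact: rot12K.
- by move=> p q; exact: dot_rot12.
- by move=> p q; exact: dot_rot12.
- by move=> k p q; rewrite /rot12/=; congr (_, _, _); ring.
Qed.

Lemma boost_invariant_swap23 u :
  boost_invariant (@swap23 R u) -> boost_invariant u.
Proof.
apply: (@boost_invariant_conj _ (@swap23 R)).
- exact: measurable_swap23.
- exact: measurable_swap23.
- exact: transports_swap23.
- exact: transports_swap23.
- by move=> [[x y] z].
- by move=> p q; rewrite /dot/= addrAC.
- by move=> p q; rewrite /dot/= addrAC.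
- by [].
Qed.

(** Two rotations in coordinate planes bring the velocity to the first axis. *)
Lemma transports_rest u : dot u u < 1 -> boost_invariant u.
Proof.
move: u => [[a b] d] u1.
have [c [s [cs c0 e1]]] := planar_alignment a b.
apply: (boost_invariant_rot12 cs c0); apply: boost_invariant_swap23.
rewrite /rot12 /swap23/= e1; set a' := c * a + s * b.
(* after the exchange of axes the second component is the original third one *)
have [c' [s' [cs' c0' e2]]] := planar_alignment a' d.
apply: (boost_invariant_rot12 cs' c0').
rewrite /rot12/= e2; set w := c' * a' + s' * d.
apply: boost_invariant_axis.
have -> : w ^+ 2 = dot (a, b, d) (a, b, d) :> R.
  have -> : dot (a, b, d) (a, b, d) = a' ^+ 2 + d ^+ 2.
    rewrite -(dot_rot12 (a, b, d) (a, b, d) cs) /rot12/= e1 /dot/= -/a'; ring.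
  transitivity (w ^+ 2 + (- s' * a' + c' * d) ^+ 2); first by rewrite e2 expr0n addr0.
  transitivity ((c' ^+ 2 + s' ^+ 2) * (a' ^+ 2 + d ^+ 2)); first by rewrite /w; ring.
  by rewrite cs' mul1r.
by [].
Qed.

End RestFrame.

(** * Polar and spherical coordinates *)

Section Separation.
Context {d1 d2 : measure_display} {X : measurableType d1} {Y : measurableType d2}
  {R : realType}.
Variables (m1 : {sigma_finite_measure set X -> \bar R})
  (m2 : {sigma_finite_measure set Y -> \bar R}).

(** Fubini for real integrands. The integrability of the product is a part of the
conclusion so that the lemma can be iterated to three variables. *)
Lemma integral_separable (f : X -> R) (g : Y -> R) :
  m1.-integrable setT (EFin \o f) -> m2.-integrable setT (EFin \o g) ->
  (m1 \x m2)%E.-integrable setT (fun p => (f p.1 * g p.2)%:E) /\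
  (\int[m1 \x m2]_p (f p.1 * g p.2)%:E =
   \int[m1]_x (f x)%:E * \int[m2]_y (g y)%:E)%E.
Proof.
move=> fi gi; have [/measurable_EFinP mf _] := integrableP _ _ _ fi.
have [/measurable_EFinP mg _] := integrableP _ _ _ gi.
have mfg : measurable_fun setT (fun p : X * Y => (f p.1 * g p.2)%:E).
  apply/measurable_EFinP; apply: measurable_funM.
    by apply: (measurableT_comp mf); exact: measurable_fst.
  by apply: (measurableT_comp mg); exact: measurable_snd.
have gfin : (\int[m2]_y (g y)%:E)%E \is a fin_num by exact: integrable_fin_num gi.
have fgi : (m1 \x m2)%E.-integrable setT (fun p => (f p.1 * g p.2)%:E).
  apply/(integrable12ltyP m1 m2 mfg).
  have [_ gn] := integrableP _ _ _ gi; have [_ fn] := integrableP _ _ _ fi.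
  have gn_fin : (\int[m2]_y `|(g y)%:E|)%E \is a fin_num.
    by rewrite ge0_fin_numE// integral_ge0.
  have mag : measurable_fun setT (fun y => (`|g y|)%:E).
    by apply/measurable_EFinP; exact: measurable_fun_norm.
  have maf : measurable_fun setT (fun x => (`|f x|)%:E).
    by apply/measurable_EFinP; exact: measurable_fun_norm.
  under eq_integral => x _.
    under eq_integral => y _ do rewrite /= normrM EFinM.
    rewrite ge0_integralZl//.
    over.
  rewrite ge0_integralZr//; last exact: integral_ge0.
  by rewrite lte_mul_pinfty ?integral_ge0// ge0_fin_numE ?integral_ge0.
split => //; rewrite -(integral12_prod_meas1 fgi) /fubini_F/=.
transitivity (\int[m1]_x ((f x)%:E * \int[m2]_y (g y)%:E))%E.
  apply: eq_integral => x _; rewrite -integralZl//.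
rewrite -(fineK gfin) -integralZr//.
Qed.

End Separation.

Section Polar.
Context {R : realType}.
Local Notation mR := (measurableTypeR R).
Local Notation mR3 := (mR * mR * mR)%type.
Local Notation lambda := (@lebesgue_measure R).
Local Notation plane := (@plane_measure R).
Local Notation space := (plane \x lambda)%E.

(** The factors restricting polar coordinates to their domain, as functions with
values 0 and 1. The full circle is the half circle of positive cosine followed
by its translate by pi. *)
Definition half_turn (t : R) : R := \1_(`](- (pi / 2)), (pi / 2)[) t.
Definition full_turn (t : R) : R := half_turn t + half_turn (t - pi).
Definition positive (r : R) : R := \1_(`]0, +oo[) r.

Lemma positiveE r : positive r = (0 < r)%R%:R.
Proof.
rewrite /positive indicE; congr (_%:R); congr nat_of_bool.
by apply/idP/idP; rewrite inE/= in_itv/= andbT.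
Qed.

Lemma half_turnE t : half_turn t = (- (pi / 2) < t < pi / 2)%R%:R.
Proof.
rewrite /half_turn indicE; congr (_%:R); congr nat_of_bool.
by apply/idP/idP; rewrite inE/= in_itv/=.
Qed.

Lemma half_turn_cos t : half_turn t != 0 -> 0 < cos t.
Proof.
rewrite half_turnE pnatr_eq0 eqb0 negbK => h; exact: cos_gt0_pihalf.
Qed.

Lemma measurable_half_turn d (X : measurableType d) (f : X -> R) :
  measurable_fun setT f -> measurable_fun setT (fun x => half_turn (f x)).
Proof. by move=> mf; exact: measurable_fun_indicator. Qed.

Lemma measurable_positive d (X : measurableType d) (f : X -> R) :
  measurable_fun setT f -> measurable_fun setT (fun x => positive (f x)).
Proof. by move=> mf; exact: measurable_fun_indicator. Qed.

Lemma measurable_nonzero d (X : measurableType d) (f : X -> R) :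
  measurable_fun setT f -> measurable_fun setT (fun x => (f x != 0)%R%:R : R).
Proof.
move=> mf; have mC : measurable (~` [set 0 : R]) by apply: measurableC.
have := measurable_fun_indicator mC mf.
congr (measurable_fun _ _); apply/funext => x; rewrite indicE; congr (_%:R).
by congr nat_of_bool; apply/idP/idP; rewrite inE/= => /eqP.
Qed.

Lemma half_turn_ge0 t : 0 <= half_turn t. Proof. by rewrite half_turnE. Qed.
Lemma full_turn_ge0 t : 0 <= full_turn t.
Proof. by rewrite addr_ge0 ?half_turn_ge0. Qed.
Lemma positive_ge0 t : 0 <= positive t. Proof. by rewrite positiveE. Qed.

Definition polar (p : mR * mR) : mR * mR := (p.1 * cos p.2, p.1 * sin p.2).

Lemma measurable_polar : measurable_fun setT polar.
Proof.
apply: measurable_fun_pair; apply: measurable_funM.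
- exact: measurable_fst.
- by apply: measurable_fun_cos; exact: measurable_snd.
- exact: measurable_fst.
- by apply: measurable_fun_sin; exact: measurable_snd.
Qed.

(** Signed radii: for r of both signs and |t| < pi / 2, the point of polar
coordinates (r, t) covers the plane once, up to the line x = 0. The map is the
composite of the one-dimensional substitutions (r, t) |-> (r, tan t),
(r, s) |-> (x, s) with x = r / sqrt (1 + s^2), and (x, s) |-> (x, x s). *)
Lemma transports_half_polar :
  transports plane plane polar (fun p => `|p.1| * half_turn p.2) (cst 1).
Proof.
have m1 : measurable_fun setT (fun p : mR * mR => p.1) by exact: measurable_fst.
have m2 : measurable_fun setT (fun p : mR * mR => p.2) by exact: measurable_snd.
pose q (s : R) : R := (Num.sqrt (1 + s ^+ 2))^-1.
have q0 s : 0 < q s by rewrite invr_gt0 sqrtr_gt0 ltr_pwDl// sqr_ge0.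
have mq : measurable_fun setT (fun p : mR * mR => q p.2).
  apply: measurable_fun_inv; apply: measurable_fun_sqrt; apply: measurable_funD => //.
  exact: measurable_funX.
pose A (p : mR * mR) : mR * mR := (p.1, p.2).
have trA : transports plane plane A (fun p => (p.1 != 0)%R%:R) (cst 1).
  apply: (@transports_fiber1 _ _ _ mR mR mR R lambda lambda lambda
    (fun p => p.1) (fun p => (p.1 != 0)%R%:R)) => //.
    exact: measurable_nonzero.
  by move=> y; exact: transports_punctured.
pose B (p : mR * mR) : mR * mR := (p.1, p.1 * p.2).
have mB : measurable_fun setT B by apply: measurable_fun_pair => //; exact: measurable_funM.
have trB : transports plane plane B (fun p => `|p.1|) (fun p => (p.1 != 0)%R%:R).
  apply: (@transports_fiber2 _ _ _ mR mR mR R lambda lambda lambda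
    (fun p => p.1 * p.2) (fun p => `|p.1|) (fun p => (p.1 != 0)%R%:R)) => //.
  - exact: measurable_funM.
  - exact: measurable_fun_norm.
  - exact: measurable_nonzero.
  move=> x; have [->|x0] := eqVneq x 0.
    by move=> F mF F0 /=; rewrite normr0; under eq_integral do rewrite mule0;
      under [RHS]eq_integral do rewrite mule0.
  apply: transports_ext (transports_affine 0 x0) => //= y.
  by rewrite addr0.
pose C (p : mR * mR) : mR * mR := (p.1 * q p.2, p.2).
have mC : measurable_fun setT C by apply: measurable_fun_pair => //; exact: measurable_funM.
have trC : transports plane plane C (fun p => q p.2) (cst 1).
  apply: (@transports_fiber1 _ _ _ mR mR mR R lambda lambda lambda
    (fun p => p.1 * q p.2) (fun p => q p.2)) => //.
  - exact: measurable_funM.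
  - by move=> p; exact: ltW.
  move=> s; apply: transports_ext (transports_affine 0 (lt0r_neq0 (q0 s))) => //= x.
    by move=> _; rewrite addr0 mulrC.
  by rewrite gtr0_norm.
pose D (p : mR * mR) : mR * mR := (p.1, tan p.2).
have mtan : measurable_fun setT (fun p : mR * mR => tan p.2).
  apply: measurable_funM; first exact: measurable_fun_sin.
  by apply: measurable_fun_inv; exact: measurable_fun_cos.
have mD : measurable_fun setT D by exact: measurable_fun_pair.
have trD : transports plane plane D (fun p => half_turn p.2 * (1 + tan p.2 ^+ 2)) (cst 1).
  apply: (@transports_fiber2 _ _ _ mR mR mR R lambda lambda lambda
    (fun p => tan p.2) (fun p => half_turn p.2 * (1 + tan p.2 ^+ 2))) => //.
  - apply: measurable_funM; first exact: measurable_half_turn.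
    by apply: measurable_funD => //; exact: measurable_funX.
  - by move=> p; rewrite mulr_ge0 ?half_turn_ge0 ?addr_ge0 ?sqr_ge0.
  - move=> x; exact: transports_tan.
have mn : measurable_fun setT (fun p : mR * mR => `|p.1|) by exact: measurable_fun_norm.
have {}trC := transports_weight mn (fun p => normr_ge0 p.1) trC.
have mw : measurable_fun setT (fun p : mR * mR => `|(C p).1| * q p.2).
  by apply: measurable_funM => //; exact: (measurableT_comp mn).
have w0 (p : mR * mR) : 0 <= `|(C p).1| * q p.2 by rewrite mulr_ge0 ?normr_ge0 ?(ltW (q0 _)).
have trBA : transports plane plane (A \o B) (fun p => `|p.1|) (cst 1).
  by apply: transports_comp trB trA; exact: measurable_fun_pair.
have trCBA : transports plane plane ((A \o B) \o C) (fun p => `|(C p).1| * q p.2) (cst 1).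
  apply: (@transports_comp _ _ _ _ _ _ _ plane plane plane C (A \o B) _ (fun p => `|p.1|)) => //.
  by apply: transports_ext trC => // p; rewrite mulr1.
have trall : transports plane plane (((A \o B) \o C) \o D)
    (fun p => `|(C (D p)).1| * q (D p).2 * (half_turn p.2 * (1 + tan p.2 ^+ 2))) (cst 1).
  apply: (@transports_comp _ _ _ _ _ _ _ plane plane plane D ((A \o B) \o C) _
    (fun p => `|(C p).1| * q p.2 * 1)).
  - exact: (measurableT_comp mB mC).
  - exact: (transports_weight mw w0 trD).
  - by apply: transports_ext trCBA => // p; rewrite mulr1.
have qtan t : 0 < cos t -> q (tan t) = cos t.
  move=> ct; rewrite /q -cos2_tan2 ?gt_eqF// -exprVn sqrtr_sqr ger0_norm ?invrK//.
  by rewrite invr_ge0 ltW.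
apply: transports_ext trall => // -[r t] /=.
  move=> h; have ct : 0 < cos t.
    by apply: half_turn_cos; apply: contraNneq h => ->; rewrite mul0r mulr0.
  rewrite /polar /A/B/C/D/= qtan//; congr (_, _).
  by rewrite /tan -mulrA [cos t * _]mulrC divfK// gt_eqF.
have [->|/half_turn_cos ct] := eqVneq (half_turn t) 0; first by rewrite mul0r !mulr0.
rewrite qtan// normrM (gtr0_norm ct) -cos2_tan2 ?gt_eqF//.
by field; rewrite gt_eqF.
Qed.

(** The points of negative radius are those of positive radius after a
translation of the angle by pi. *)
Lemma transports_polar :
  transports plane plane polar (fun p => positive p.1 * p.1 * full_turn p.2) (cst 1).
Proof.
have m1 : measurable_fun setT (fun p : mR * mR => p.1) by exact: measurable_fst.
have m2 : measurable_fun setT (fun p : mR * mR => p.2) by exact: measurable_snd.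
pose N (p : mR * mR) : mR * mR := (- p.1, p.2 - pi).
have mN2 : measurable_fun setT (fun p : mR * mR => p.2 - pi).
  by apply: measurable_funB.
have mN1 : measurable_fun setT (fun p : mR * mR => - p.1).
  exact: measurableT_comp.
have trN : transports plane plane N (cst 1) (cst 1).
  pose N1 (p : mR * mR) : mR * mR := (- p.1, p.2).
  pose N2 (p : mR * mR) : mR * mR := (p.1, p.2 - pi).
  have mN : measurable_fun setT N2 by exact: measurable_fun_pair.
  apply: (@transports_comp _ _ _ _ _ _ _ plane plane plane N1 N2 _ (cst 1)) => //.
    apply: (@transports_fiber1 _ _ _ mR mR mR R lambda lambda lambda
      (fun p => - p.1)) => // y.
    exact: transports_opp.
  apply: (@transports_fiber2 _ _ _ mR mR mR R lambda lambda lambda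
    (fun p => p.2 - pi)) => // x.
  apply: transports_ext (transports_affine (- pi) (oner_neq0 R)) => //= t.
    by rewrite mul1r.
  by rewrite normr1.
have polarN p : polar (N p) = polar p.
  have := sinDpi (p.2 - pi); have := cosDpi (p.2 - pi).
  by rewrite subrK /polar/N/= => -> ->; rewrite !mulNr !mulrN.
move=> F mF F0; rewrite -(transports_half_polar mF F0).
have mFp : measurable_fun setT (fun p => F (polar p)).
  by apply: (measurableT_comp mF); exact: measurable_polar.
pose w1 (p : mR * mR) : R := positive p.1 * p.1 * half_turn p.2.
pose w2 (p : mR * mR) : R := positive (- p.1) * - p.1 * half_turn p.2.
have mw1 : measurable_fun setT w1.
  apply: measurable_funM; last exact: measurable_half_turn.
  by apply: measurable_funM => //; exact: measurable_positive.
have mw2 : measurable_fun setT w2.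
  apply: measurable_funM; last exact: measurable_half_turn.
  by apply: measurable_funM => //; exact: measurable_positive.
have w10 p : 0 <= w1 p.
  rewrite /w1 positiveE mulr_ge0 ?half_turn_ge0//.
  by case: (ltP 0 p.1) => h; rewrite ?mul1r ?mul0r// ltW.
have w20 p : 0 <= w2 p.
  rewrite /w2 positiveE mulr_ge0 ?half_turn_ge0//.
  by case: (ltP 0 (- p.1)) => h; rewrite ?mul1r ?mul0r// ltW.
have mw2N : measurable_fun setT (fun p => w2 (N p)).
  by apply: (measurableT_comp mw2); exact: measurable_fun_pair.
transitivity (\int[plane]_p (F (polar p) * (w1 p)%:E + F (polar p) * (w2 p)%:E))%E;
    last first.
  apply: eq_integral => p _.
  rewrite -ge0_muleDr ?lee_fin// -EFinD; congr (_ * _%:E)%E.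
  rewrite /w1 /w2 !positiveE -mulrDl; congr (_ * _); rewrite oppr_gt0.
  case: (ltgtP p.1 0) => h; rewrite ?mul0r ?mul1r ?add0r ?addr0.
  - by rewrite ltr0_norm.
  - by rewrite gtr0_norm.
  - by rewrite h normr0.
rewrite ge0_integralD//; first last.
- by apply: emeasurable_funM => //; exact/measurable_EFinP.
- by move=> p _; rewrite mule_ge0// lee_fin.
- by apply: emeasurable_funM => //; exact/measurable_EFinP.
- by move=> p _; rewrite mule_ge0// lee_fin.
have mG2 : measurable_fun setT (fun p : mR * mR => F (polar p) * (w2 p)%:E)%E.
  by apply: emeasurable_funM => //; exact/measurable_EFinP.
have G20 (p : mR * mR) : (0 <= F (polar p) * (w2 p)%:E)%E by rewrite mule_ge0// lee_fin.
have := trN _ mG2 G20.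
under [in X in _ = X -> _]eq_integral do rewrite mule1.
move=> <-.
under [X in _ = (_ + X)%E]eq_integral do rewrite mule1 polarN.
rewrite -ge0_integralD//; first last.
- by apply: emeasurable_funM => //; exact/measurable_EFinP.
- by move=> p _; rewrite mule_ge0// lee_fin.
- by apply: emeasurable_funM => //; exact/measurable_EFinP.
- by move=> p _; rewrite mule_ge0// lee_fin.
apply: eq_integral => p _.
rewrite -ge0_muleDr ?lee_fin// -EFinD; congr (_ * _%:E)%E.
by rewrite /w1 /w2 /N/= !opprK -mulrDr.
Qed.

(** The second coordinate is the latitude, not the colatitude: its range
]- pi / 2, pi / 2[ is the one on which the tangent is a bijection. *)
Definition spherical (p : mR3) : mR3 :=
  (p.1.1 * cos p.1.2 * cos p.2, p.1.1 * cos p.1.2 * sin p.2, p.1.1 * sin p.1.2).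

(** Polar coordinates twice: in the meridian half-plane, giving the radius and the
latitude, then in the equatorial plane. The Jacobian is r * (r cos t). *)
Lemma transports_spherical :
  transports space space spherical
    (fun p => positive p.1.1 * p.1.1 ^+ 2 * (half_turn p.1.2 * cos p.1.2) * full_turn p.2)
    (cst 1).
Proof.
have mid : measurable_fun [set: mR3] (fun p => p.1) by exact: measurable_fst.
have m1 : measurable_fun setT (fun p : mR * mR => p.1) by exact: measurable_fst.
have m2 : measurable_fun setT (fun p : mR * mR => p.2) by exact: measurable_snd.
have mfull d (X : measurableType d) (f : X -> R) :
    measurable_fun setT f -> measurable_fun setT (fun x => full_turn (f x)).
  move=> mf; apply: measurable_funD; first exact: measurable_half_turn.
  by apply: measurable_half_turn; exact: measurable_funB.
have mlift (T : mR * mR -> mR * mR) : measurable_fun setT T ->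
    measurable_fun [set: mR3] (fun p => (T p.1, p.2) : mR3).
  move=> mT; apply: measurable_fun_pair; last exact: measurable_coord3.
  by apply: (measurableT_comp mT); exact: measurable_fst.
pose v (p : mR * mR) : R := positive p.1 * p.1 * full_turn p.2.
have mv : measurable_fun setT v.
  by apply: measurable_funM; [apply: measurable_funM => //; exact: measurable_positive|
    exact: mfull].
have v0 p : 0 <= v p.
  rewrite /v positiveE mulr_ge0 ?full_turn_ge0//.
  by case: (ltP 0 p.1) => h; rewrite ?mul1r ?mul0r// ltW.
pose v' (p : mR * mR) : R := `|p.1| * half_turn p.2.
have mv' : measurable_fun setT v'.
  by apply: measurable_funM; [exact: measurable_fun_norm|exact: measurable_half_turn].
have v'0 p : 0 <= v' p by rewrite mulr_ge0 ?half_turn_ge0.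
pose L (p : mR3) : mR3 := (polar p.1, p.2).
have mL : measurable_fun setT L by apply: mlift; exact: measurable_polar.
have tr1 : transports space space L (fun p => v p.1) (cst 1).
  exact: (@transports_lift R polar v (cst 1) measurable_polar mv (measurable_cst _)
    v0 (fun=> ler01) transports_polar).
have tr2 : transports space space L (fun p => v' p.1) (cst 1).
  exact: (@transports_lift R polar v' (cst 1) measurable_polar mv' (measurable_cst _)
    v'0 (fun=> ler01) transports_half_polar).
have msw := @measurable_swap23 R.
have mh1 : measurable_fun [set: mR3] (fun p => v p.1).
  exact: (measurableT_comp mv).
have mh2 : measurable_fun [set: mR3] (fun p => v (swap23 p).1).
  exact: (measurableT_comp mh1 msw).
have h10 (p : mR3) : 0 <= v p.1 by [].
have h20 (p : mR3) : 0 <= v (swap23 p).1 by [].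
have tr : transports space space (L \o @swap23 R) (fun p => v (swap23 p).1) (cst 1).
  apply: (@transports_comp _ _ _ _ _ _ _ space space space (@swap23 R) L _
    (fun p => v p.1 * cst 1 p)) => //.
    apply: transports_ext (transports_weight mh1 h10 (@transports_swap23 R)) => // p.
    by rewrite mulr1.
  by apply: transports_ext tr1 => // p; rewrite mulr1.
have {}tr : transports space space ((L \o @swap23 R) \o L)
    (fun p => v (swap23 (L p)).1 * v' p.1) (cst 1).
  apply: (@transports_comp _ _ _ _ _ _ _ space space space L (L \o @swap23 R) _
    (fun p => v (swap23 p).1 * cst 1 p)).
  - exact: (measurableT_comp mL msw).
  - exact: (transports_weight mh2 h20 tr2).
  - by apply: transports_ext tr => // p; rewrite mulr1.
apply: transports_ext tr => // -[[r t] s] /=.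
rewrite /v /v' /=; have [->|/half_turn_cos ct] := eqVneq (half_turn t) 0.
  by rewrite !mul0r !mulr0 mul0r.
rewrite !positiveE pmulr_lgt0//.
by case: (ltP 0 r) => r0; rewrite ?mul0r// !mul1r ?gtr0_norm//; ring.
Qed.

Lemma integral_spherical (G : mR3 -> R) (f g h : R -> R) :
  measurable_fun setT G ->
  (forall r t s, positive r != 0 -> half_turn t != 0 ->
    G (spherical (r, t, s)) = f r * g t * h s) ->
  lambda.-integrable setT (EFin \o (fun r => positive r * r ^+ 2 * f r)) ->
  lambda.-integrable setT (EFin \o (fun t => half_turn t * cos t * g t)) ->
  lambda.-integrable setT (EFin \o (fun s => full_turn s * h s)) ->
  (\int[space]_p (G p)%:E =
    (\int[lambda]_r (positive r * r ^+ 2 * f r)%:E) *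
    (\int[lambda]_t (half_turn t * cos t * g t)%:E) *
    (\int[lambda]_s (full_turn s * h s)%:E))%E.
Proof.
move=> mG GE fi gi hi.
have w0 (p : mR3) : 0 <= positive p.1.1 * p.1.1 ^+ 2 * (half_turn p.1.2 * cos p.1.2) *
    full_turn p.2.
  rewrite mulr_ge0 ?full_turn_ge0// mulr_ge0//.
    by rewrite mulr_ge0 ?positive_ge0 ?sqr_ge0.
  have [->|/half_turn_cos ct] := eqVneq (half_turn p.1.2) 0; first by rewrite mul0r.
  by rewrite mulr_ge0 ?half_turn_ge0// ltW.
transitivity (\int[space]_p (G p * cst 1 p)%:E)%E.
  by apply: eq_integral => p _; rewrite mulr1.
rewrite -(transports_signed w0 _ mG transports_spherical)//.
have [fgi fgE] := integral_separable fi gi.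
rewrite -fgE.
have [_ sepE] := @integral_separable _ _ (mR * mR)%type mR R plane lambda
  (fun p => positive p.1 * p.1 ^+ 2 * f p.1 * (half_turn p.2 * cos p.2 * g p.2)) _ fgi hi.
rewrite -[RHS]sepE.
apply: eq_integral => -[[r t] s] _ /=; congr EFin.
have [->|r0] := eqVneq (positive r) 0; first by rewrite !mul0r !mulr0.
have [->|t0] := eqVneq (half_turn t) 0; first by rewrite !(mul0r, mulr0).
by rewrite GE//; ring.
Qed.

End Polar.

(** * Orthogonality of associated Legendre functions *)

Section DefiniteIntegral.
Context {F : numFieldType}.
Implicit Types p q f g : {poly F}.

(** Integrals of polynomials over [-1, 1] are treated algebraically, through
primitives; the link with the Lebesgue integral is made by
[integral_latitude]. *)
Definition primitive p : {poly F} := \poly_(i < (size p).+1) (p`_i.-1 / i%:R).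

Lemma deriv_primitive p : (primitive p)^`() = p.
Proof.
apply/polyP => i; rewrite coef_deriv coef_poly ltnS /=.
have [ip|pi] := ltnP i (size p); last by rewrite mul0rn nth_default.
by rewrite -[LHS]mulr_natr divfK// pnatr_eq0.
Qed.

Lemma deriv_eq0_const p : p^`() = 0 -> p = (p`_0)%:P.
Proof.
move=> p0; apply/polyP => -[|i]; rewrite coefC//=.
have := congr1 (fun q : {poly F} => q`_i) p0; rewrite coef_deriv coef0 => /eqP.
by rewrite mulrn_eq0/= => /eqP.
Qed.

Definition defint p := (primitive p).[1] - (primitive p).[-1].

Lemma defint_deriv p : defint p^`() = p.[1] - p.[-1].
Proof.
have /deriv_eq0_const h : (primitive p^`() - p)^`() = 0.
  by rewrite derivB deriv_primitive subrr.
have e x : (primitive p^`()).[x] = p.[x] + (primitive p^`() - p)`_0.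
  have := congr1 (horner^~ x) h; rewrite /= hornerC hornerD hornerN => <-.
  by rewrite addrC subrK.
by rewrite /defint !e; ring.
Qed.

Lemma defintD p q : defint (p + q) = defint p + defint q.
Proof.
rewrite -{1}(deriv_primitive p) -{1}(deriv_primitive q) -derivD defint_deriv.
by rewrite !hornerD /defint; ring.
Qed.

Lemma defintZ a p : defint (a *: p) = a * defint p.
Proof.
by rewrite -{1}(deriv_primitive p) -derivZ defint_deriv !hornerZ -mulrBr.
Qed.

Lemma defint0 : defint 0 = 0.
Proof. by rewrite -(scale0r 0) defintZ mul0r. Qed.

Lemma defint_by_parts f g :
  defint (f * g^`()) = (f * g).[1] - (f * g).[-1] - defint (f^`() * g).
Proof. by rewrite -defint_deriv derivM defintD addrAC subrr add0r. Qed.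

Lemma defint_by_partsn n f g :
  (forall j, (j < n)%N -> (f^`(j) * g^`(n.-1 - j)).[1] = 0 /\
                          (f^`(j) * g^`(n.-1 - j)).[-1] = 0) ->
  defint (f * g^`(n)) = (-1) ^+ n * defint (f^`(n) * g).
Proof.
elim: n f => [|n IH] f h; first by rewrite !derivn0 expr0 mul1r.
rewrite [g^`(n.+1)]derivnS defint_by_parts.
have [] := h 0%N isT; rewrite derivn0 subn0/= => -> ->; rewrite subrr sub0r.
rewrite IH; first by rewrite -derivnS derivSn exprS mulN1r mulNr.
by move=> j jn; have := h j.+1 jn; rewrite derivSn; case: (n) jn.
Qed.

End DefiniteIntegral.

Section Legendre.
Context {F : numFieldType}.
Implicit Types p q f g : {poly F}.

(** The polynomial whose derivative of order l is, up to a constant, the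
Legendre polynomial of degree l. *)
Definition rodrigues l : {poly F} := ('X^2 - 1) ^+ l.

Lemma rodriguesS l : rodrigues l.+1 = ('X^2 - 1) * rodrigues l.
Proof. by rewrite /rodrigues exprS. Qed.

Lemma deriv_rodrigues l : (rodrigues l.+1)^`() = (2 * l.+1%:R) *: ('X * rodrigues l).
Proof.
have dX : ('X^2 - 1 : {poly F})^`() = 2 *: 'X.
  by rewrite derivB derivXn -[1]/(1%:P) derivC subr0 expr1 scaler_nat.
by rewrite /rodrigues deriv_exp dX /= -scaler_nat -scalerAl scalerA mulrC.
Qed.

(** Each differentiation removes at most one factor X^2 - 1; this is what makes
the boundary terms vanish at -1 and 1. *)
Lemma derivn_rodriguesM k a g : (k <= a)%N ->
  exists g', (rodrigues a * g)^`(k) = rodrigues (a - k) * g'.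
Proof.
elim: k => [|k IH] ka; first by exists g; rewrite derivn0 subn0.
have [g' e] := IH (ltnW ka); rewrite derivnS e.
have -> : (a - k = (a - k.+1).+1)%N by rewrite subnSK.
rewrite derivM deriv_rodrigues rodriguesS.
exists ((2 * (a - k.+1).+1%:R) *: ('X * g') + ('X^2 - 1) * g'^`()).
by rewrite -!mul_polyC; ring.
Qed.

Lemma rodrigues_root l x : x ^+ 2 = 1 -> (0 < l)%N -> (rodrigues l).[x] = 0.
Proof.
by move=> x1; case: l => // l _; rewrite rodriguesS !hornerE x1 subrr mul0r.
Qed.

Lemma coefM_top p q a b : (size p <= a.+1)%N -> (size q <= b.+1)%N ->
  (p * q)`_(a + b) = p`_a * q`_b.
Proof.
move=> pa qb; rewrite coefM.
have alt : (a < (a + b).+1)%N by rewrite ltnS leq_addr.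
rewrite (bigD1 (Ordinal alt))//= addKn big1 ?addr0// => -[i ib] /=.
rewrite -val_eqE /= neq_ltn => /orP[ia|ai].
  rewrite [q`__]nth_default ?mulr0// (leq_trans qb)//; lia.
by rewrite nth_default ?mul0r// (leq_trans pa).
Qed.

Lemma size_rodrigues l : size (rodrigues l) = (2 * l).+1.
Proof.
have s2 : size ('X^2 - 1 : {poly F}) = 3%N by rewrite size_XnsubC.
rewrite /rodrigues; elim: l => [|l IH]; first by rewrite expr0 size_poly1.
rewrite exprS size_mul ?IH ?s2 ?mulnS//; first by rewrite -size_poly_eq0 s2.
by rewrite -size_poly_eq0 IH.
Qed.

Lemma lead_rodrigues l : (rodrigues l)`_(2 * l) = 1.
Proof.
have -> : (2 * l = (size (rodrigues l)).-1)%N by rewrite size_rodrigues.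
apply/eqP; rewrite -[_`__]/(lead_coef _) -[_ == _]/(_ \is monic).
by rewrite /rodrigues monic_exp// monicXnsubC.
Qed.

Lemma derivn_size_le p n : (size p <= n.+1)%N -> p^`(n) = (p`_n *+ n`!)%:P.
Proof.
move=> pn; apply/polyP => i; rewrite coef_derivn coefC.
case: i => [|i]; first by rewrite addn0 ffactnn.
by rewrite nth_default ?mul0rn// (leq_trans pn)// addnS ltnS leq_addr.
Qed.

Lemma size_derivn_rodrigues l m : (m <= l)%N ->
  (size (rodrigues l)^`(l + m) <= (l - m).+1)%N.
Proof.
move=> ml; apply/leq_sizeP => j jl; rewrite coef_derivn nth_default ?mul0rn//.
rewrite size_rodrigues mul2n -addnn -ltnS in jl *.
by rewrite -addnA ltn_add2l -(subnKC ml) ltn_add2l.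
Qed.

Definition assoc_legendre_kernel l m : {poly F} :=
  (1 - 'X^2) ^+ m * (rodrigues l)^`(l + m).

Lemma kernelE l m : assoc_legendre_kernel l m =
  (-1) ^+ m *: (rodrigues m * (rodrigues l)^`(l + m)).
Proof.
have e : 1 - 'X^2 = (-1) * ('X^2 - 1) :> {poly F} by ring.
by rewrite /assoc_legendre_kernel e exprMn -mulrA -mul_polyC rmorphXn/= rmorphN1.
Qed.

Lemma size_kernel l m : (m <= l)%N -> (size (assoc_legendre_kernel l m) <= (l + m).+1)%N.
Proof.
move=> ml; rewrite kernelE (leq_trans (size_scale_leq _ _))//.
rewrite (leq_trans (size_polyMleq _ _))// size_rodrigues /=.
rewrite (leq_trans (leq_add (leqnn _) (size_derivn_rodrigues ml)))//.
by rewrite addnS ltnS mul2n -addnn -addnA subnKC// addnC.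
Qed.

Lemma coef_kernel l m : (m <= l)%N ->
  (assoc_legendre_kernel l m)`_(l + m) = (-1) ^+ m * ((2 * l)`!%:R / (l - m)`!%:R).
Proof.
move=> ml; rewrite kernelE coefZ; congr (_ * _).
have -> : (l + m = 2 * m + (l - m))%N by rewrite mul2n -addnn -addnA subnKC// addnC.
rewrite coefM_top ?size_rodrigues// ?lead_rodrigues ?mul1r; last first.
  have -> : (2 * m + (l - m) = l + m)%N by rewrite mul2n -addnn -addnA subnKC// addnC.
  exact: size_derivn_rodrigues.
have -> : (2 * m + (l - m) = l + m)%N by rewrite mul2n -addnn -addnA subnKC// addnC.
rewrite coef_derivn.
have e : (l + m + (l - m) = 2 * l)%N by rewrite -addnA subnKC// mul2n addnn.
rewrite e lead_rodrigues.
have h : (l + m <= 2 * l)%N by rewrite -e leq_addr.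
have -> : (l - m = 2 * l - (l + m))%N by rewrite -e addKn.
by rewrite -(ffact_fact h) natrM mulfK// pnatr_eq0 -lt0n fact_gt0.
Qed.

(** Of the two factors in a boundary term, with j and l' + m - 1 - j derivatives,
the first vanishes at -1 and 1 if j < m, and the second if j >= m. *)
Lemma defint_kernel_ibp l l' m : 
  defint (assoc_legendre_kernel l m * (rodrigues l')^`(l' + m)) =
  (-1) ^+ (l' + m) * defint ((assoc_legendre_kernel l m)^`(l' + m) * rodrigues l').
Proof.
apply: defint_by_partsn => j jlt.
suff h x : x ^+ 2 = 1 ->
    ((assoc_legendre_kernel l m)^`(j) * (rodrigues l')^`((l' + m).-1 - j)).[x] = 0.
  by split; apply: h; rewrite ?expr1n// sqrrN expr1n.
move=> x1; rewrite hornerM; have [jm|mj] := ltnP j m.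
  rewrite kernelE derivnZ hornerZ.
  have [g' ->] := derivn_rodriguesM (rodrigues l)^`(l + m) (ltnW jm).
  by rewrite hornerM rodrigues_root ?subn_gt0// !(mul0r, mulr0).
have kl : ((l' + m).-1 - j < l')%N.
  by rewrite ltn_subLR; lia.
have [g' e] := derivn_rodriguesM 1 (ltnW kl); move: e; rewrite mulr1 => ->.
by rewrite hornerM rodrigues_root ?subn_gt0// !(mul0r, mulr0).
Qed.

(** The recurrence in l comes from integrating the derivative of
(X^2 - 1)^(l+1) X, which vanishes at both ends. *)
Lemma defint_rodrigues l : defint (rodrigues l) =
  (-1) ^+ l * (2 ^+ l * l`!%:R) ^+ 2 * 2 / (2 * l).+1`!%:R.
Proof.
elim: l => [|l IH].
  have -> : rodrigues 0 = deriv 'X by rewrite derivX /rodrigues expr0.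
  rewrite defint_deriv !hornerX.
  by rewrite !expr0 muln0 fact0 factS fact0 !mul1r expr1n mul1r divr1 opprK.
(* (X^2 - 1)^(l+1) + 2 (l + 1) X^2 (X^2 - 1)^l, with X^2 written (X^2 - 1) + 1 *)
have e : (rodrigues l.+1 * 'X)^`() =
    (2 * l + 3)%:R *: rodrigues l.+1 + (2 * l.+1)%:R *: rodrigues l.
  rewrite derivM derivX mulr1 deriv_rodrigues rodriguesS -!mul_polyC.
  rewrite !rmorphM/= !rmorph_nat !natrD !natrM; ring.
have := defint_deriv (rodrigues l.+1 * 'X).
rewrite !hornerM !(@rodrigues_root l.+1) ?sqrrN ?expr1n// !mul0r subrr e.
rewrite defintD !defintZ IH => h.
have n0 n : n.+1%:R != 0 :> F by rewrite pnatr_eq0.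
have f0 n : n`!%:R != 0 :> F by rewrite pnatr_eq0 -lt0n fact_gt0.
have e3 : (2 * l + 3)%:R != 0 :> F by rewrite addnS n0.
apply: (mulfI e3).
move/eqP: h; rewrite addr_eq0 => /eqP ->.
have -> : (2 * l.+1).+1 = (2 * l + 3)%N by lia.
have -> : ((2 * l + 3)`! = (2 * l + 3) * (2 * l + 2) * (2 * l).+1`!)%N.
  by rewrite addnS factS addnS factS addn1 mulnA.
rewrite factS !natrM !exprS.
have -> : (2 * l + 2)%:R = 2 * l.+1%:R :> F by rewrite -natrM; congr (_%:R); lia.
have := f0 (2 * l).+1; have := n0 l; set a := l.+1%:R; set b := (_`!)%:R => a0 b0.
set d := (2 * l + 3)%:R in e3 *; field.
by rewrite f0 -!natrM !nat1r -natrD !pnatr_eq0 addnS.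
Qed.

(** For l <= l', integrating by parts l' + m times leaves the derivative of that
order of a polynomial of degree l + m: it is 0 if l < l', and a constant given
by the leading coefficient if l = l'. *)
Lemma legendre_orthogonality l l' m : (m <= l)%N -> (m <= l')%N ->
  defint ((1 - 'X^2) ^+ m * ((rodrigues l)^`(l + m) * (rodrigues l')^`(l' + m))) =
  (l == l')%:R * ((2 ^+ l * l`!%:R) ^+ 2 * ((l + m)`!%:R / (l - m)`!%:R) *
    (2 / (2 * l + 1)%:R)).
Proof.
wlog ll' : l l' / (l <= l')%N => [wl|] ml ml'.
  have [|/ltnW h] := leqP l l'; first by move=> h; exact: wl.
  rewrite [X in _ * X]mulrC wl// eq_sym.
  by have [->//|_] := eqVneq l l'; rewrite !mul0r.
rewrite [X in defint X]mulrA -/(assoc_legendre_kernel l m) defint_kernel_ibp.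
have [<-{l' ll' ml'}|nll'] := eqVneq l l'; last first.
  rewrite derivn_size_le; last first.
    by rewrite (leq_trans (size_kernel ml))// ltnS leq_add2r.
  rewrite nth_default ?mul0rn ?mul0r ?defint0 ?mulr0//.
  by rewrite (leq_trans (size_kernel ml))// ltn_add2r ltn_neqAle nll'.
rewrite derivn_size_le ?size_kernel// coef_kernel// mul_polyC defintZ defint_rodrigues.
rewrite addn1 factS natrM mul1r -mulr_natr.
have f0 n : n`!%:R != 0 :> F by rewrite pnatr_eq0 -lt0n fact_gt0.
have := f0 (2 * l)%N; have := f0 (l - m)%N; have : (2 * l).+1%:R != 0 :> F.
  by rewrite pnatr_eq0.
set a := (2 * l).+1%:R; set b := (l - m)`!%:R; set d := (2 * l)`!%:R => a0 b0 d0.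
have s1 : (-1) ^+ l * (-1) ^+ l = 1 :> F by rewrite -exprMn mulrNN mulr1 expr1n.
have s2 : (-1) ^+ m * (-1) ^+ m = 1 :> F by rewrite -exprMn mulrNN mulr1 expr1n.
rewrite exprD.
transitivity (((-1) ^+ l * (-1) ^+ l) * ((-1) ^+ m * (-1) ^+ m) *
  ((2 ^+ l * l`!%:R) ^+ 2 * ((l + m)`!%:R / b) * (2 / a))); last by rewrite s1 s2 !mul1r.
by field; rewrite -natrM nat1r a0 b0 d0.
Qed.

End Legendre.

(** * Angular integrals *)

Section AngularIntegrals.
Context {R : realType}.
Local Notation lambda := (@lebesgue_measure R).

Lemma integral_half_turn_shift (f : R -> R) (c : R) :
  (\int[lambda]_t (half_turn (t - c) * f t)%:E =
   \int[lambda]_(t in `](c - pi / 2)%R, (c + pi / 2)%R[) (f t)%:E)%E.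
Proof.
rewrite [RHS]integral_mkcond; apply: eq_integral => t _.
have e : (- (pi / 2) < t - c < pi / 2) = (c - pi / 2 < t < c + pi / 2).
  by apply/idP/idP => /andP[h1 h2]; apply/andP; split; lra.
rewrite patchE half_turnE e; case: (boolP (_ < _ < _)) => h.
  by rewrite mem_set ?mul1r//= in_itv.
by rewrite memNset ?mul0r//= in_itv; exact/negP.
Qed.

Lemma half_turn_shift_integrable (f : R -> R) (c : R) : continuous f ->
  lambda.-integrable setT (EFin \o (fun t => half_turn (t - c) * f t)).
Proof.
move=> cf; have mf := continuous_measurable_fun cf.
have i1 : lambda.-integrable `[(c - pi / 2), (c + pi / 2)] (EFin \o f).
  apply: continuous_compact_integrable; first exact: segment_compact.
  exact: continuous_subspaceT.
have mI : measurable (`[(c - pi / 2), (c + pi / 2)]%classic : set (measurableTypeR R)).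
  exact: measurable_itv.
have i2 := (integrable_mkcond _ mI).1 i1.
apply: le_integrable i2 => //.
  apply/measurable_EFinP; apply: measurable_funM => //.
  by apply: measurable_half_turn; exact: measurable_funB.
move=> t _ /=; rewrite patchE half_turnE.
case: (boolP (_ < _ < _)) => [/andP[h1 h2]|_]; last by rewrite mul0r normr0 abse_ge0.
rewrite mem_set ?mul1r//= in_itv/=; apply/andP; split; lra.
Qed.

Lemma half_turn_integrable (f : R -> R) : continuous f ->
  lambda.-integrable setT (EFin \o (fun t => half_turn t * f t)).
Proof.
move=> /(@half_turn_shift_integrable f 0); apply: eq_integrable => // t _ /=.
by rewrite subr0.
Qed.

Lemma full_turn_integrable (f : R -> R) : continuous f ->
  lambda.-integrable setT (EFin \o (fun t => full_turn t * f t)).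
Proof.
move=> cf; have := integrableD measurableT (half_turn_integrable cf)
  (half_turn_shift_integrable pi cf).
apply: eq_integrable => // t _ /=.
by rewrite -EFinD -mulrDl.
Qed.

Lemma integral_half_turn (f F : R -> R) (c : R) : continuous f ->
  (forall t : R, is_derive t 1 F (f t)) ->
  (\int[lambda]_t (half_turn (t - c) * f t)%:E = (F (c + pi / 2) - F (c - pi / 2))%:E)%E.
Proof.
move=> cf dF; rewrite integral_half_turn_shift.
have mf := continuous_measurable_fun cf.
rewrite -(@integral_itv_bndoo _ _ _ _ true false); last first.
  by apply/measurable_EFinP; exact: measurable_funTS.
apply: integral_derive => //; last by move=> x _; exact: cf.
by rewrite ltrD2l gtrN// divr_gt0// pi_gt0.
Qed.

Lemma integral_half_turn0 (f F : R -> R) : continuous f ->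
  (forall t : R, is_derive t 1 F (f t)) ->
  (\int[lambda]_t (half_turn t * f t)%:E = (F (pi / 2) - F (- (pi / 2)))%:E)%E.
Proof.
move=> cf dF; rewrite -[X in F X - _]add0r -[X in _ - F X]sub0r.
rewrite -(integral_half_turn 0 cf dF).
by apply: eq_integral => t _; rewrite subr0.
Qed.

Lemma integral_full_turn (f F : R -> R) : continuous f ->
  (forall t : R, is_derive t 1 F (f t)) ->
  (\int[lambda]_t (full_turn t * f t)%:E = (F (- (pi / 2) + pi *+ 2) - F (- (pi / 2)))%:E)%E.
Proof.
move=> cf dF.
transitivity (\int[lambda]_t ((half_turn t * f t)%:E + (half_turn (t - pi) * f t)%:E))%E.
  by apply: eq_integral => t _; rewrite -EFinD -mulrDl.
rewrite integralD//; first last.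
- exact: half_turn_shift_integrable.
- exact: half_turn_integrable.
rewrite (integral_half_turn pi cf dF).
rewrite (integral_half_turn0 cf dF) -EFinD; congr EFin.
have -> : - (pi / 2) + pi *+ 2 = pi + pi / 2 :> R by field.
have -> : pi - pi / 2 = pi / 2 :> R by field.
by ring.
Qed.

Lemma integral_latitude (p : {poly R}) :
  (\int[lambda]_t (half_turn t * (cos t * p.[sin t]))%:E = (defint p)%:E)%E.
Proof.
pose F (t : R) := (primitive p).[sin t].
have dF (t : R) : is_derive t 1 F (cos t * p.[sin t]).
  have := @is_derive1_comp _ (horner (primitive p)) (@sin R) t _ _
    (is_derive_poly (primitive p) (sin t)) (is_derive_sin t).
  by rewrite deriv_primitive mulrC.
have cf : continuous (fun t : R => cos t * p.[sin t]).
  move=> t; apply: cvgM; first exact: continuous_cos.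
  apply: (@continuous_comp _ _ _ (@sin R) (horner p)); first exact: continuous_sin.
  exact: continuous_horner.
by rewrite (integral_half_turn0 cf dF) /F sinN sin_pihalf.
Qed.

Lemma sin_periodic_int (k : int) (x : R) : sin (k%:~R * (x + pi *+ 2)) = sin (k%:~R * x).
Proof.
have nat_case (n : nat) (y : R) : sin (n%:R * (y + pi *+ 2)) = sin (n%:R * y).
  by rewrite mulrDr [n%:R * (pi *+ 2)]mulr_natl (periodicn (@sinD2pi R)).
case: k => n; first exact: nat_case.
by rewrite NegzE mulrNz !mulNr !sinN; congr (- _); exact: nat_case.
Qed.

Lemma cos_periodic_int (k : int) (x : R) : cos (k%:~R * (x + pi *+ 2)) = cos (k%:~R * x).
Proof.
have nat_case (n : nat) (y : R) : cos (n%:R * (y + pi *+ 2)) = cos (n%:R * y).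
  by rewrite mulrDr [n%:R * (pi *+ 2)]mulr_natl (periodicn (@cosD2pi R)).
case: k => n; first exact: nat_case.
by rewrite NegzE mulrNz !mulNr !cosN; exact: nat_case.
Qed.

Lemma continuous_trig (a : R) :
  continuous (fun t : R => sin (a * t)) /\ continuous (fun t : R => cos (a * t)).
Proof.
have ca : continuous (fun t : R => a * t).
  by move=> t; apply: cvgM; [exact: cvg_cst|exact: cvg_id].
by split=> t; [apply: (@continuous_comp _ _ _ (fun t : R => a * t) (@sin R))|
  apply: (@continuous_comp _ _ _ (fun t : R => a * t) (@cos R))];
  [exact: ca|exact: continuous_sin|exact: ca|exact: continuous_cos].
Qed.

Lemma integral_cos_full_turn (k : int) :
  (\int[lambda]_t (full_turn t * cos (k%:~R * t))%:E = ((k == 0)%:R * (pi *+ 2))%:E)%E.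
Proof.
have [_ cf] := continuous_trig (k%:~R).
have [k0|k0] := eqVneq k 0.
  have dF (t : R) : is_derive t 1 id (cos (k%:~R * t)).
    by rewrite k0 mul0r cos0; exact: is_derive_id.
  by rewrite (integral_full_turn cf dF); congr EFin; rewrite /=; ring.
have kR : k%:~R != 0 :> R by rewrite intr_eq0.
have dF (t : R) : is_derive t 1 (fun t => sin (k%:~R * t) / k%:~R) (cos (k%:~R * t)).
  have dk : is_derive t 1 (fun t : R => k%:~R * t) k%:~R.
    by apply: is_derive_eq; rewrite /GRing.scale/=; ring.
  have ds := @is_derive1_comp _ (@sin R) _ t _ _ (is_derive_sin _) dk.
  by apply: is_derive_eq; rewrite /GRing.scale/=; field.
by rewrite (integral_full_turn cf dF) sin_periodic_int subrr mul0r.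
Qed.

Lemma integral_sin_full_turn (k : int) :
  (\int[lambda]_t (full_turn t * sin (k%:~R * t))%:E = 0)%E.
Proof.
have [cf _] := continuous_trig (k%:~R).
have [k0|k0] := eqVneq k 0.
  by rewrite integral0_eq// => t _; rewrite k0 mul0r sin0 mulr0.
have kR : k%:~R != 0 :> R by rewrite intr_eq0.
have dF (t : R) : is_derive t 1 (fun t => - cos (k%:~R * t) / k%:~R) (sin (k%:~R * t)).
  have dk : is_derive t 1 (fun t : R => k%:~R * t) k%:~R.
    by apply: is_derive_eq; rewrite /GRing.scale/=; ring.
  have ds := @is_derive1_comp _ (@cos R) _ t _ _ (is_derive_cos _) dk.
  by apply: is_derive_eq; rewrite /GRing.scale/=; field.
by rewrite (integral_full_turn cf dF) cos_periodic_int subrr.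
Qed.

(** The dependence of the spherical harmonic of order m on the angle phi. *)
Definition azimuth (m : int) (t : R) : R :=
  if m < 0 then Num.sqrt 2 * sin (`|m|%N%:R * t)
  else if m == 0 then 1 else Num.sqrt 2 * cos (`|m|%N%:R * t).

Lemma continuous_azimuth m : continuous (azimuth m).
Proof.
have [cs cc] := continuous_trig (`|m|%N%:R).
rewrite /azimuth; case: (m < 0); last case: (m == 0) => t; last first.
- by apply: cvgM; [exact: cvg_cst|exact: cc].
- exact: cvg_cst.
- by move=> t; apply: cvgM; [exact: cvg_cst|exact: cs].
Qed.

Lemma absz_sum_neq0 (m m' : int) : m != 0 -> (`|m|%N%:Z + `|m'|%N%:Z == 0) = false.
Proof. by lia. Qed.

Lemma absz_sub_eq0 (m m' : int) : (m < 0) = (m' < 0) ->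
  (`|m|%N%:Z - `|m'|%N%:Z == 0) = (m == m').
Proof. by lia. Qed.

Lemma eq_of_signs (m m' : int) : (m < 0) != (m' < 0) \/ (0 < m) != (0 < m') ->
  (m == m') = false.
Proof. by lia. Qed.

(** Products of sines and cosines are turned into sums, with frequencies
|m| + |m'| and |m| - |m'|. A product of a sine and a cosine gives two sines, of
integral 0. Otherwise two cosines appear, of integral 0 unless the frequency
is 0, which happens only if m = m'. *)
Lemma azimuth_orthogonality (m m' : int) :
  (\int[lambda]_t (full_turn t * (azimuth m t * azimuth m' t))%:E =
   ((m == m')%:R * (pi *+ 2))%:E)%E.
Proof.
pose a : int := `|m|%N; pose b : int := `|m'|%N.
have int_cos k : lambda.-integrable setT (EFin \o (fun t => full_turn t * cos (k%:~R * t))).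
  by apply: full_turn_integrable; case: (continuous_trig k%:~R).
have int_sin k : lambda.-integrable setT (EFin \o (fun t => full_turn t * sin (k%:~R * t))).
  by apply: full_turn_integrable; case: (continuous_trig k%:~R).
have aE : `|m|%N%:R = a%:~R :> R by [].
have bE : `|m'|%N%:R = b%:~R :> R by [].
have two : Num.sqrt 2 * Num.sqrt 2 = 2 :> R by rewrite -expr2 sqr_sqrtr.
(* the integrand as a combination of two terms of known integral *)
have comb (f g1 g2 : R -> R) (c1 c2 v1 v2 : R) :
    lambda.-integrable setT (EFin \o (fun t => full_turn t * g1 t)) ->
    lambda.-integrable setT (EFin \o (fun t => full_turn t * g2 t)) ->
    (\int[lambda]_t (full_turn t * g1 t)%:E = v1%:E)%E ->
    (\int[lambda]_t (full_turn t * g2 t)%:E = v2%:E)%E ->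
    (forall t, f t = c1 * g1 t + c2 * g2 t) ->
    (\int[lambda]_t (full_turn t * f t)%:E = (c1 * v1 + c2 * v2)%:E)%E.
  move=> i1 i2 e1 e2 fE.
  transitivity (\int[lambda]_t (c1%:E * (full_turn t * g1 t)%:E +
      c2%:E * (full_turn t * g2 t)%:E))%E.
    by apply: eq_integral => t _; rewrite fE -!EFinM -EFinD; congr EFin; rewrite /=; ring.
  rewrite integralD//=; [|exact: integrableZl|exact: integrableZl].
  by rewrite !integralZl// e1 e2 -!EFinM.
have cc := comb _ _ _ 1 1 _ _ (int_cos (a - b)) (int_cos (a + b))
   (integral_cos_full_turn _) (integral_cos_full_turn _).
have ss := comb _ _ _ 1 (-1) _ _ (int_cos (a - b)) (int_cos (a + b))
   (integral_cos_full_turn _) (integral_cos_full_turn _).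
have sc := comb _ _ _ 1 1 _ _ (int_sin (a + b)) (int_sin (a - b))
   (integral_sin_full_turn _) (integral_sin_full_turn _).
have cs := comb _ _ _ 1 (-1) _ _ (int_sin (a + b)) (int_sin (a - b))
   (integral_sin_full_turn _) (integral_sin_full_turn _).
have s1 := comb _ _ _ (Num.sqrt 2) 0 _ _ (int_sin a) (int_sin a)
   (integral_sin_full_turn _) (integral_sin_full_turn _).
have c1 := comb _ _ _ (Num.sqrt 2) 0 _ _ (int_cos a) (int_cos a)
   (integral_cos_full_turn _) (integral_cos_full_turn _).
have s2 := comb _ _ _ (Num.sqrt 2) 0 _ _ (int_sin b) (int_sin b)
   (integral_sin_full_turn _) (integral_sin_full_turn _).
have c2 := comb _ _ _ (Num.sqrt 2) 0 _ _ (int_cos b) (int_cos b)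
   (integral_cos_full_turn _) (integral_cos_full_turn _).
have c0 := comb _ _ _ 1 0 _ _ (int_cos 0) (int_cos 0)
   (integral_cos_full_turn _) (integral_cos_full_turn _).
rewrite /azimuth aE bE.
have eB t : (a - b)%:~R * t = a%:~R * t - b%:~R * t :> R by rewrite intrB mulrBl.
have eD t : (a + b)%:~R * t = a%:~R * t + b%:~R * t :> R by rewrite intrD mulrDl.
have id4 (x y : R) : Num.sqrt 2 * x * (Num.sqrt 2 * y) = 2 * x * y.
  by rewrite mulrACA two mulrA.
case: (ltgtP m 0) => hm; case: (ltgtP m' 0) => hm'.
- rewrite ss => [|t]; last by rewrite id4 eB eD cosB cosD; ring.
  rewrite (absz_sum_neq0 m' (negbT (lt_eqF hm))) absz_sub_eq0 ?hm ?hm'//.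
  by congr EFin; rewrite /=; ring.
- rewrite sc => [|t]; last by rewrite id4 eB eD sinB sinD; ring.
  by rewrite eq_of_signs /= ?mul0r ?mulr0 ?addr0//; left; rewrite hm ltNge ltW.
- rewrite s1 => [|t]; last by rewrite mulr1 mul0r addr0.
  by rewrite eq_of_signs /= ?mul0r ?mulr0 ?addr0//; left; rewrite hm hm' ltxx.
- rewrite cs => [|t]; last by rewrite id4 eB eD sinB sinD; ring.
  by rewrite eq_of_signs /= ?mul0r ?mulr0 ?addr0//; left; rewrite hm' ltNge ltW.
- rewrite cc => [|t]; last by rewrite id4 eB eD cosB cosD; ring.
  rewrite (absz_sum_neq0 m' (negbT (gt_eqF hm))) absz_sub_eq0; last by rewrite !ltNge !ltW.
  by congr EFin; rewrite /=; ring.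
- rewrite c1 => [|t]; last by rewrite mulr1 mul0r addr0.
  rewrite /a eqz_nat absz_eq0 (gt_eqF hm) (_ : (m == m') = false) /=.
    by rewrite !mul0r mulr0 addr0.
  by apply: eq_of_signs; right; rewrite hm hm' ltxx.
- rewrite s2 => [|t]; last by rewrite mul1r mul0r addr0.
  rewrite (_ : (m == m') = false) /= ?mul0r ?mulr0 ?addr0//.
  by apply: eq_of_signs; left; rewrite hm hm' ltxx.
- rewrite c2 => [|t]; last by rewrite mul1r mul0r addr0.
  rewrite /b eqz_nat absz_eq0 (gt_eqF hm') (_ : (m == m') = false) /=.
    by rewrite !mul0r mulr0 addr0.
  by apply: eq_of_signs; right; rewrite hm hm' ltxx.
- rewrite c0 => [|t]; last by rewrite mul0r cos0; ring.
  by rewrite hm hm' !eqxx; congr EFin; rewrite /=; ring.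
Qed.

End AngularIntegrals.

(** * Solid harmonics as polynomials *)

Section SolidHarmonics.
Context {R : realType}.

(** The real and imaginary parts of (x + i y)^m. *)
Fixpoint cpow (m : nat) (x y : R) : R * R :=
  if m is n.+1 then
    let c := cpow n x y in (x * c.1 - y * c.2, x * c.2 + y * c.1)
  else (1, 0).

Lemma cpow_polar m r t : cpow m (r * cos t) (r * sin t) =
  (r ^+ m * cos (m%:R * t), r ^+ m * sin (m%:R * t)).
Proof.
elim: m => [|m IH] /=; first by rewrite mul0r cos0 sin0 expr0 mul1r mulr0.
by rewrite IH /= -natr1 mulrDl mul1r cosD sinD exprS; congr (_, _); ring.
Qed.

Definition sectoral (m : int) (x y : R) : R :=
  if m < 0 then Num.sqrt 2 * (cpow `|m|%N x y).2
  else if m == 0 then 1 else Num.sqrt 2 * (cpow `|m|%N x y).1.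

Lemma sectoral_polar m r t :
  sectoral m (r * cos t) (r * sin t) = r ^+ `|m|%N * azimuth m t.
Proof.
rewrite /sectoral /azimuth cpow_polar /=.
by case: ltgtP => [_|_|->]; rewrite ?expr0 ?mulr1 ?mul1r//; ring.
Qed.

(** With r^2 = rr and q the derivative of order l + m of (y^2 - 1)^l, this is
r^(l-m) q(z / r). The parity of q makes it a polynomial in z and r^2, homogeneous
of degree l - m in the coordinates. *)
Definition zonal (l m : nat) (z rr : R) : R :=
  \sum_(i < l.+1 | (l + m <= 2 * i)%N)
     ((-1) ^+ (l - i) * 'C(l, i)%:R * ((2 * i) ^_ (l + m))%:R) *
     z ^+ (2 * i - (l + m)) * rr ^+ (l - i).

Lemma rodrigues_expand l :
  rodrigues l = \sum_(i < l.+1) ((-1) ^+ (l - i) * 'C(l, i)%:R) *: 'X^(2 * i) :> {poly R}.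
Proof.
rewrite /rodrigues addrC exprDn; apply: eq_bigr => i _.
rewrite -exprM -mulr_natr -mul_polyC rmorphM rmorphXn/= rmorphN1 rmorph_nat; ring.
Qed.

Lemma zonal_rodrigues l m z r : (m <= l)%N ->
  zonal l m (r * z) (r ^+ 2) = r ^+ (l - m) * ((rodrigues l : {poly R})^`(l + m)).[z].
Proof.
move=> ml; rewrite rodrigues_expand linear_sum horner_sum mulr_sumr /zonal big_mkcond.
apply: eq_bigr => i _; rewrite /= derivnZ derivnXn hornerZ hornerMn hornerXn.
case: ifPn => [h|]; last first.
  by rewrite -ltnNge => h; rewrite ffact_small// mulr0n !mulr0.
rewrite -mulr_natr exprMn -exprM.
have -> : (l - m = 2 * i - (l + m) + 2 * (l - i))%N by have := ltn_ord i; lia.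
by rewrite exprD; ring.
Qed.

Definition solid_coef (l m : nat) : R :=
  Num.sqrt ((l - m)`!%:R / (l + m)`!%:R) * (-1) ^+ m / (2 ^+ l * l`!%:R).

Definition solid (l : nat) (m : int) (p : R * R * R) : R :=
  solid_coef l `|m|%N * zonal l `|m|%N p.2 (dot p p) * sectoral m p.1.1 p.1.2.

Definition latitude (l m : nat) (y : R) : R :=
  solid_coef l m * ((rodrigues l : {poly R})^`(l + m)).[y].

Lemma solid_spherical l (m : int) r c s t : (`|m| <= l)%N -> c ^+ 2 + s ^+ 2 = 1 ->
  solid l m (r * c * cos t, r * c * sin t, r * s) =
  r ^+ l * (c ^+ `|m|%N * latitude l `|m|%N s) * azimuth m t.
Proof.
move=> ml cs; rewrite /solid /= sectoral_polar.
have -> : dot (r * c * cos t, r * c * sin t, r * s) (r * c * cos t, r * c * sin t, r * s) = r ^+ 2.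
  rewrite /dot /=; have := cos2Dsin2 t => cst.
  transitivity (r ^+ 2 * (c ^+ 2 * (cos t ^+ 2 + sin t ^+ 2) + s ^+ 2)); first by ring.
  by rewrite cst mulr1 cs mulr1.
have rl : r ^+ l = r ^+ (l - `|m|) * r ^+ `|m| by rewrite -exprD subnK.
rewrite zonal_rodrigues// exprMn /latitude rl; ring.
Qed.

Lemma legendre_checkE l m s c : 0 <= c -> c ^+ 2 + s ^+ 2 = 1 ->
  legendre_check l m s = c ^+ m * latitude l m s.
Proof.
move=> c0 cs; rewrite /legendre_check /legendre_hat /latitude /solid_coef.
have -> : (1 - s ^+ 2) `^ (m%:R / 2) = c ^+ m.
  rewrite (_ : 1 - s ^+ 2 = c ^+ 2); last by rewrite -cs addrK.
  rewrite -(powR_mulrn 2 c0) -powRrM mulrCA divff ?pnatr_eq0// mulr1.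
  exact: powR_mulrn.
rewrite /rodrigues; ring.
Qed.

Lemma sph_harmE l (m : int) s c t : 0 <= c -> c ^+ 2 + s ^+ 2 = 1 ->
  sph_harm l m s t = c ^+ `|m|%N * latitude l `|m|%N s * azimuth m t.
Proof.
move=> c0 cs; rewrite /sph_harm /azimuth !(@legendre_checkE _ _ s c)//.
case: ltgtP => [_|_|->]; rewrite ?absz0 ?mulr1//; ring.
Qed.

End SolidHarmonics.

(** * Kinematics of the rest frame *)

Section Kinematics.
Context {R : realType}.
Implicit Types u p : R * R * R.

Lemma sqr_enorm p : enorm p ^+ 2 = dot p p.
Proof.
rewrite /enorm sqr_sqrtr; last by apply: sumr_ge0 => i _; exact: sqr_ge0.
by rewrite !big_ord_recl big_ord0 /Defs.coord /= /dot !expr2 addr0 addrA.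
Qed.

Lemma lorentzE u : lorentz u = gamma u.
Proof. by rewrite /lorentz sqr_enorm. Qed.

Lemma mom0 p : mom p ord0 = shell p.
Proof. by rewrite /mom /fourvec unlift_none sqr_enorm. Qed.

Lemma momS p i : mom p (lift ord0 i) = Defs.coord p i.
Proof. by rewrite /mom /fourvec liftK. Qed.

Lemma energyE u p : energy u p = gamma u * (shell p - dot u p).
Proof.
rewrite /energy /Defs.minkowski mom0 {1}/velocity /fourvec unlift_none lorentzE mulrBr.
congr (_ - _); rewrite !big_ord_recl big_ord0 !momS /velocity /fourvec !liftK.
by rewrite lorentzE /dot /Defs.coord/=; ring.
Qed.

Lemma directionE u p i :
  direction u p i = (Num.sqrt (energy u p ^+ 2 - 1))^-1 * Defs.coord (rest u p) i.
Proof.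
rewrite /direction mulNr -mulrN; congr (_ * _).
have vS j : velocity u (lift ord0 j) = gamma u * Defs.coord u j.
  by rewrite /velocity /fourvec liftK lorentzE.
have v0 : velocity u ord0 = gamma u by rewrite /velocity /fourvec unlift_none lorentzE.
rewrite /Defs.minkowski mom0 {1}/tetrad {1}/fourvec unlift_none vS.
have tS j : tetrad u i (lift ord0 j) =
    gamma u * Defs.coord u i * (gamma u * Defs.coord u j) / (gamma u + 1) + (i == j)%:R.
  by rewrite /tetrad /fourvec liftK -/(fourvec _ _) -/(velocity u) !vS v0.
rewrite !big_ord_recl big_ord0 !tS !momS /rest /dot.
case: i {tS} => -[|[|[|//]]] hi; rewrite /Defs.coord /tnth /= ?mulr0n ?mulr1n; ring.
Qed.

Lemma dot_sqr_le u p : dot u p ^+ 2 <= dot u u * dot p p.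
Proof.
rewrite -subr_ge0 /dot.
set x := u.1.1; set y := u.1.2; set z := u.2.
set a := p.1.1; set b := p.1.2; set c := p.2.
rewrite (_ : _ - _ = (x * b - y * a) ^+ 2 + (x * c - z * a) ^+ 2 + (y * c - z * b) ^+ 2).
  by rewrite !addr_ge0 ?sqr_ge0.
by ring.
Qed.

(** The boosted momentum stays on the mass shell. The
inequality u.p <= p^0 fixes the sign of the square root. *)
Lemma energy_rest u p : dot u u < 1 -> energy u p = shell (rest u p).
Proof.
move=> u1; have g0 := gamma_gt0 u1; have g2 := sqr_gamma u1.
rewrite energyE; set g := gamma u in g0 g2 *.
set s := shell p; set d := dot u p; set v := dot u u in u1 g2 *.
have s0 : 0 < s := shell_gt0 p.
have s2 : s ^+ 2 = 1 + dot p p := sqr_shell p.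
have ds : d <= s.
  have [d0|d0] := leP d 0; first by rewrite (le_trans d0)// ltW.
  rewrite -ler_sqr ?nnegrE ?(ltW d0) ?(ltW s0)//.
  rewrite (le_trans (dot_sqr_le u p))// s2.
  have := dot_ge0 p; have := dot_ge0 u; rewrite -/v => v0 p0.
  by rewrite ler_wpDl// ler_piMl// ltW.
have E0 : 0 <= g * (s - d) by rewrite mulr_ge0 ?subr_ge0// ltW.
rewrite -[LHS](ger0_norm E0) -sqrtr_sqr /shell; congr Num.sqrt.
have g1 : g + 1 != 0 by rewrite gt_eqF// addr_gt0.
(* k is the coefficient of u in the rest momentum *)
pose a := g ^+ 2 / (g + 1); pose k := a * d - g * s.
have av : a * v = g - 1.
  rewrite /a mulrAC; apply: (mulIf g1); rewrite divfK//.
  have -> : g ^+ 2 * v = g ^+ 2 - 1 by rewrite -[X in _ = _ - X]g2; ring.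
  by ring.
have ag : a * (g + 1) = g ^+ 2 by rewrite /a divfK.
have -> : dot (rest u p) (rest u p) = dot p p + 2 * k * d + k ^+ 2 * v.
  by rewrite /rest -/g -/s -/d -/a -/k /d /v /dot /=; ring.
have -> : dot p p = s ^+ 2 - 1 by rewrite s2 addrAC subrr add0r.
have gv : g ^+ 2 * v = g ^+ 2 - 1 by rewrite -[X in _ = _ - X]g2; ring.
transitivity (s ^+ 2 * (1 + g ^+ 2 * v) - 2 * g * s * d * (1 + a * v) + a * d ^+ 2 * (2 + a * v)).
  rewrite gv av.
  have -> : a * d ^+ 2 * (2 + (g - 1)) = a * (g + 1) * d ^+ 2 by ring.
  by rewrite ag; ring.
by rewrite /k; ring.
Qed.

Lemma sqr_energy u p : dot u u < 1 ->
  energy u p ^+ 2 - 1 = dot (rest u p) (rest u p).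
Proof. by move=> u1; rewrite energy_rest// sqr_shell addrAC subrr add0r. Qed.

Lemma dot_eq0 p : dot p p = 0 -> p = (0, 0, 0).
Proof.
case: p => -[x y] z; rewrite /dot /= -!expr2 => /eqP.
by rewrite !paddr_eq0 ?addr_ge0 ?sqr_ge0// !sqrf_eq0 => /andP[/andP[/eqP-> /eqP->] /eqP->].
Qed.

(** At rest in the frame of u, the four-momentum is the four-velocity. *)
Lemma rest_eq0 u p : dot u u < 1 -> rest u p = (0, 0, 0) ->
  p = (gamma u * u.1.1, gamma u * u.1.2, gamma u * u.2).
Proof.
move=> u1 X0; have g0 := gamma_gt0 u1; have g2 := sqr_gamma u1.
have := energy_rest p u1; rewrite energyE X0 {2}/shell /dot/= !mul0r !addr0 sqrtr1.
rewrite -/(dot u p); move: X0; rewrite /rest.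
set g := gamma u in g0 g2 *; set k := _ - g * shell p => -[e1 e2 e3] E1.
have g1 : g + 1 != 0 by rewrite gt_eqF// addr_gt0.
have p1 : p.1.1 = - k * u.1.1 by rewrite mulNr; apply/eqP; rewrite -addr_eq0 e1.
have p2 : p.1.2 = - k * u.1.2 by rewrite mulNr; apply/eqP; rewrite -addr_eq0 e2.
have p3 : p.2 = - k * u.2 by rewrite mulNr; apply/eqP; rewrite -addr_eq0 e3.
have dE : dot u p = - k * dot u u by rewrite /dot p1 p2 p3; ring.
have kE : k = - shell p.
  have : k * (g + 1) = g ^+ 2 * dot u p - g * (g + 1) * shell p by rewrite /k; field.
  rewrite dE.
  have -> : g ^+ 2 * (- k * dot u u) = - k * (g ^+ 2 - 1).
    by rewrite -[X in _ - X]g2; ring.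
  move=> h; apply: (mulfI (lt0r_neq0 g0)); apply: (mulfI g1); lra.
have sE : shell p = g.
  have v0 : g * (1 - dot u u) != 0.
    apply/eqP => h; move: g2; rewrite expr2 -mulrA h mulr0 => /eqP.
    by rewrite eq_sym oner_eq0.
  apply: (mulIf v0); rewrite [RHS]mulrA -expr2 g2.
  by transitivity (g * (shell p - dot u p)) => //; rewrite dE kE; ring.
by move: p1 p2 p3; rewrite kE sE opprK; case: (p) => -[x y] z /= -> -> ->.
Qed.

Lemma rest_at_velocity u : dot u u < 1 ->
  forall p, ~~ (1 < energy u p) -> p = (gamma u * u.1.1, gamma u * u.1.2, gamma u * u.2).
Proof.
move=> u1 p; rewrite -leNgt => E1; apply: rest_eq0 => //; apply: dot_eq0.
apply/eqP; rewrite eq_le dot_ge0 andbT -sqr_energy// subr_le0.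
by rewrite expr_le1// energy_rest// ltW// shell_gt0.
Qed.

Lemma polar_angle (a b : R) : exists t : R,
  [/\ 0 <= t < 2 * pi, Num.sqrt (a ^+ 2 + b ^+ 2) * cos t = a
    & Num.sqrt (a ^+ 2 + b ^+ 2) * sin t = b].
Proof.
set n := Num.sqrt _.
have n2 : n ^+ 2 = a ^+ 2 + b ^+ 2 by rewrite sqr_sqrtr// addr_ge0 ?sqr_ge0.
have pi0 := @pi_gt0 R.
have [n0|n0] := eqVneq n 0.
  have /eqP : a ^+ 2 + b ^+ 2 = 0 by rewrite -n2 n0 expr0n.
  rewrite paddr_eq0 ?sqr_ge0// !sqrf_eq0 => /andP[/eqP -> /eqP ->].
  by exists 0; rewrite n0 !mul0r lexx mulr_gt0.
have ngt0 : 0 < n by rewrite lt_neqAle eq_sym n0 sqrtr_ge0.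
have abn : (a / n) ^+ 2 + (b / n) ^+ 2 = 1.
  by rewrite !expr_div_n -mulrDl -n2 divff// expf_neq0.
have an : -1 <= a / n <= 1.
  by rewrite -ler_norml -(@expr_le1 _ 2)// real_normK ?num_real// -abn lerDl sqr_ge0.
have sn : sin (acos (a / n)) = `|b / n|.
  by rewrite sin_acos// -sqrtr_sqr; congr Num.sqrt; rewrite -abn addrC addKr.
have ca : cos (acos (a / n)) = a / n by rewrite acosK.
have [b0|b0] := leP 0 b.
  exists (acos (a / n)); split.
  - by rewrite acos_ge0//= (le_lt_trans (acos_lepi an))// mulr_natl mulr2n ltrDl.
  - by rewrite ca mulrCA divff// mulr1.
  - by rewrite sn ger0_norm ?divr_ge0 ?(ltW ngt0)// mulrCA divff// mulr1.
have an1 : -1 <= a / n < 1.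
  have [h1 h2] := andP an; rewrite h1 lt_neqAle h2 andbT/=.
  apply/eqP => e; move: abn; rewrite e expr1n => /eqP.
  rewrite -[X in _ == X]addr0 (inj_eq (addrI _)) expf_eq0 mulf_eq0 invr_eq0 (negbTE n0).
  by rewrite orbF lt_eqF.
have ac := acos_gt0 an1.
exists (pi *+ 2 - acos (a / n)); split.
- rewrite subr_ge0 mulr_natl gtrBl ac andbT (le_trans (acos_lepi an))//.
  by rewrite mulr2n lerDl ltW.
- by rewrite addrC cosD2pi cosN ca mulrCA divff// mulr1.
- have bn : b / n < 0 by rewrite pmulr_llt0// invr_gt0.
  by rewrite addrC sinD2pi sinN sn (ltr0_norm bn) opprK mulrCA divff// mulr1.
Qed.

(** The three components of the direction form a unit vector, so some pair of
angles satisfies the defining equations; only these equations matter, not which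
pair is chosen. *)
Lemma anglesP u p : dot u u < 1 -> 1 < energy u p ->
  let r := Num.sqrt (energy u p ^+ 2 - 1) in
  let c := Num.sqrt (1 - (angles u p).1 ^+ 2) in
  rest u p = (r * c * cos (angles u p).2, r * c * sin (angles u p).2, r * (angles u p).1) /\
  c ^+ 2 + (angles u p).1 ^+ 2 = 1.
Proof.
move=> u1 E1 r c.
have n0 : 0 < energy u p ^+ 2 - 1 by rewrite subr_gt0 expr_gt1// (le_trans _ (ltW E1)).
have r0 : 0 < r by rewrite sqrtr_gt0.
pose d i := direction u p (inord i).
have dE i : r * d i = Defs.coord (rest u p) (inord i).
  by rewrite /d directionE -/r mulVKf// gt_eqF.
have c0 : Defs.coord (rest u p) (inord 0) = (rest u p).1.1.
  by rewrite /Defs.coord (tnth_nth 0) inordK.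
have c1 : Defs.coord (rest u p) (inord 1) = (rest u p).1.2.
  by rewrite /Defs.coord (tnth_nth 0) inordK.
have c2 : Defs.coord (rest u p) (inord 2) = (rest u p).2.
  by rewrite /Defs.coord (tnth_nth 0) inordK.
have d1 : d 0%N ^+ 2 + d 1%N ^+ 2 + d 2%N ^+ 2 = 1.
  have r2 : r ^+ 2 != 0 by rewrite expf_neq0// gt_eqF.
  apply: (mulfI r2); rewrite !mulrDr -!exprMn !dE c0 c1 c2 mulr1.
  by rewrite sqr_sqrtr ?(ltW n0)// sqr_energy// /dot !expr2.
have [t [t2pi tc ts]] := polar_angle (d 0%N) (d 1%N).
have e12 : d 0%N ^+ 2 + d 1%N ^+ 2 = 1 - d 2%N ^+ 2 by rewrite -d1 addrK.
have : [set a : R * R |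
    [/\ -1 <= a.1 <= 1, 0 <= a.2 < 2 * pi,
        Num.sqrt (1 - a.1 ^+ 2) * cos a.2 = direction u p (inord 0),
        Num.sqrt (1 - a.1 ^+ 2) * sin a.2 = direction u p (inord 1)
      & a.1 = direction u p (inord 2)]] (angles u p).
  apply: getPex; exists (d 2%N, t); split => //=; last 2 first.
  - by rewrite -e12.
  - by rewrite -e12.
  rewrite -ler_norml -(@expr_le1 _ 2)// real_normK ?num_real// -subr_ge0 -e12.
  by rewrite addr_ge0 ?sqr_ge0.
move=> [a1 _ ac as_ ad]; split.
  rewrite -!mulrA ac as_ ad -/(d 0%N) -/(d 1%N) -/(d 2%N) !dE c0 c1 c2.
  by case: (rest u p) => -[].
rewrite sqr_sqrtr ?subrK// subr_ge0.
by move: a1; rewrite -ler_norml -(@expr_le1 _ 2)// real_normK ?num_real.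
Qed.

Lemma solid_harm_rawE u l (m : int) p : dot u u < 1 -> (`|m| <= l)%N -> 1 < energy u p ->
  solid_harm_raw u l m p = solid l m (rest u p).
Proof.
move=> u1 ml E1; have [-> cs] := anglesP u1 E1.
have E0 : 0 <= energy u p by exact: le_trans ler01 (ltW E1).
have n0 : 0 <= energy u p ^+ 2 - 1 by rewrite subr_ge0 expr_ge1// ltW.
rewrite solid_spherical// /solid_harm_raw.
rewrite (sph_harmE _ _ _ (sqrtr_ge0 _) cs) -[RHS]mulrA; congr (_ * _).
rewrite -[in LHS](sqr_sqrtr n0) -(powR_mulrn 2 (sqrtr_ge0 _)) -powRrM mulrCA.
by rewrite divff ?pnatr_eq0// mulr1 powR_mulrn ?sqrtr_ge0.
Qed.

End Kinematics.

(** * The value at rest *)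

Section Limit.
Context {R : realType}.
Local Notation R3 := (R * R * R)%type.
Implicit Types u p : R3.

Lemma continuous_coord : [/\ continuous (fun p : R3 => p.1.1),
  continuous (fun p : R3 => p.1.2) & continuous (fun p : R3 => p.2)].
Proof.
split=> p.
- by apply: (@continuous_comp _ _ _ fst fst); exact: cvg_fst.
- by apply: (@continuous_comp _ _ _ fst snd); [exact: cvg_fst|exact: cvg_snd].
- exact: cvg_snd.
Qed.

Lemma continuousM3 (f g : R3 -> R) : continuous f -> continuous g ->
  continuous (fun p => f p * g p).
Proof. by move=> cf cg p; apply: cvgM; [exact: cf|exact: cg]. Qed.

Lemma continuousD3 (f g : R3 -> R) : continuous f -> continuous g ->
  continuous (fun p => f p + g p).
Proof. by move=> cf cg p; apply: cvgD; [exact: cf|exact: cg]. Qed.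

Lemma continuousB3 (f g : R3 -> R) : continuous f -> continuous g ->
  continuous (fun p => f p - g p).
Proof. by move=> cf cg p; apply: cvgB; [exact: cf|exact: cg]. Qed.

Lemma continuousX3 (f : R3 -> R) n : continuous f -> continuous (fun p => f p ^+ n).
Proof.
move=> cf; elim: n => [|n IH].
  by under eq_fun do rewrite expr0; move=> p; exact: cvg_cst.
by under eq_fun do rewrite exprS; exact: continuousM3.
Qed.

Lemma continuousc3 (c : R) : continuous (fun _ : R3 => c).
Proof. by move=> p; exact: cvg_cst. Qed.

Lemma continuous_sum3 (I : Type) (r : seq I) (P : pred I) (F : I -> R3 -> R) :
  (forall i, continuous (F i)) -> continuous (fun p => \sum_(i <- r | P i) F i p).
Proof.
move=> cF; elim: r => [|i r IH].
  by under eq_fun do rewrite big_nil; exact: continuousc3.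
under eq_fun do rewrite big_cons; case: (P i) => //.
exact: continuousD3.
Qed.

Lemma continuous_dot (f g : R3 -> R3) : continuous f -> continuous g ->
  continuous (fun p => dot (f p) (g p)).
Proof.
move=> cf cg; have [c1 c2 c3] := continuous_coord.
have cc (h : R3 -> R) (k : R3 -> R3) : continuous h -> continuous k -> continuous (h \o k).
  by move=> ch ck p; apply: continuous_comp; [exact: ck|exact: ch].
apply: continuousD3; first apply: continuousD3; apply: continuousM3.
- exact: (cc _ _ c1 cf).
- exact: (cc _ _ c1 cg).
- exact: (cc _ _ c2 cf).
- exact: (cc _ _ c2 cg).
- exact: (cc _ _ c3 cf).
- exact: (cc _ _ c3 cg).
Qed.

Lemma continuous_shell : continuous (@shell R).
Proof.
move=> p; apply: (@continuous_comp _ _ _ (fun p => 1 + dot p p) (@Num.sqrt R)).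
  by apply: continuousD3; [exact: continuousc3|apply: continuous_dot => q; exact: cvg_id].
exact: sqrt_continuous.
Qed.

Lemma continuous_rest u : continuous (rest u : R3 -> R3).
Proof.
have [c1 c2 c3] := continuous_coord.
have ck : continuous (fun p => gamma u ^+ 2 / (gamma u + 1) * dot u p - gamma u * shell p).
  apply: continuousB3; apply: continuousM3; try exact: continuousc3.
    by apply: continuous_dot => q; [exact: cvg_cst|exact: cvg_id].
  exact: continuous_shell.
have ce (c : R) (h : R3 -> R) : continuous h -> continuous (fun p =>
    h p + (gamma u ^+ 2 / (gamma u + 1) * dot u p - gamma u * shell p) * c).
  by move=> ch; apply: continuousD3 => //; apply: continuousM3 => //; exact: continuousc3.
move=> p; have := cvg_pair (cvg_pair (ce u.1.1 _ c1 p) (ce u.1.2 _ c2 p)) (ce u.2 _ c3 p).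
exact.
Qed.

Lemma continuous_solid l m : continuous (solid l m : R3 -> R).
Proof.
have [c1 c2 c3] := continuous_coord.
have cd : continuous (fun p : R3 => dot p p) by apply: continuous_dot => q; exact: cvg_id.
have cpow_cont n : continuous (fun p : R3 => (cpow n p.1.1 p.1.2).1) /\
                   continuous (fun p : R3 => (cpow n p.1.1 p.1.2).2).
  elim: n => [|n [IH1 IH2]] /=; first by split; exact: continuousc3.
  by split; [apply: continuousB3|apply: continuousD3]; exact: continuousM3.
apply: continuousM3.
  apply: continuousM3; first exact: continuousc3.
  apply: continuous_sum3 => i; apply: continuousM3; last exact: continuousX3.
  by apply: continuousM3; [exact: continuousc3|exact: continuousX3].
rewrite /sectoral; case: (m < 0); last case: (m == 0).
- by apply: continuousM3; [exact: continuousc3|case: (cpow_cont `|m|%N)].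
- exact: continuousc3.
- by apply: continuousM3; [exact: continuousc3|case: (cpow_cont `|m|%N)].
Qed.

(** Limits at a punctured neighborhood are unique only if the point is not
isolated; it suffices to move the first coordinate. *)
Lemma proper_dnbhs3 p : ProperFilter p^'.
Proof.
case: p => [[x y] z]; apply: Build_ProperFilter_ex => A pA.
pose q (h : R) : R3 := (x + h, y, z).
have cq : q h @[h --> (0 : R)] --> (x, y, z).
  have cx : x + h @[h --> (0 : R)] --> x.
    by rewrite -[X in _ --> X]addr0; apply: cvgD; [exact: cvg_cst|exact: cvg_id].
  by have := cvg_pair (cvg_pair cx (cvg_cst y)) (cvg_cst z); exact.
have nA : \forall h \near (0 : R), q h != (x, y, z) -> A (q h) := cq _ pA.
have [h []] := @filter_ex _ _ (Proper_dnbhs_numFieldType (0 : R)) _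
  (filterI (nbhs_dnbhs nA) (nbhs_dnbhs_neq (0 : R))).
move=> /= hA h0; exists (q h); apply: hA.
apply: contra h0 => /eqP/(congr1 (fun w : R3 => w.1.1)) /= /eqP.
by rewrite -[X in _ == X]addr0 (inj_eq (addrI _)).
Qed.

(** The energy is 1 at a single momentum. Away from it the solid harmonic is a
polynomial in the rest frame, hence continuous, so that the limit there is the
value of the polynomial. *)
Lemma solid_harmE u l (m : int) p : dot u u < 1 -> (`|m| <= l)%N ->
  solid_harm u l m p = solid l m (rest u p).
Proof.
move=> u1 ml; rewrite /solid_harm; case: ifPn => E1; first exact: solid_harm_rawE.
have pp := proper_dnbhs3 p.
have cp : solid l m (rest u q) @[q --> p^'] --> solid l m (rest u p).
  apply: cvg_trans (@continuous_comp _ _ _ (rest u : R3 -> R3) (solid l m : R3 -> R) p _ _).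
  - by apply: cvg_app; exact: nbhs_dnbhs.
  - exact: continuous_rest.
  - exact: continuous_solid.
apply: cvg_lim; first exact: Rhausdorff.
apply: cvg_trans cp; apply: near_eq_cvg.
near=> q; rewrite solid_harm_rawE//.
have qp : q != p by near: q; exact: nbhs_dnbhs_neq.
apply: contraNT qp => /(rest_at_velocity u1) ->.
by rewrite (rest_at_velocity u1 E1).
Unshelve. all: by end_near.
Qed.

End Limit.

(** * Orthonormal families and integrability *)

Section GramIntegrals.
Context {d : measure_display} {X : measurableType d} {R : realType}.
Variable mu : {measure set X -> \bar R}.

Lemma integrable_ge0_fin (f : X -> R) (c : R) :
  measurable_fun setT f -> (forall x, 0 <= f x) -> (\int[mu]_x (f x)%:E = c%:E)%E ->
  mu.-integrable setT (EFin \o f).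
Proof.
move=> mf f0 fE; apply/integrableP; split; first exact/measurable_EFinP.
under eq_integral do rewrite /= ger0_norm//.
by rewrite fE ltry.
Qed.

(** By 2 |f g| <= f^2 + g^2. *)
Lemma integrable_weighted_product (v f g : X -> R) :
  measurable_fun setT v -> measurable_fun setT f -> measurable_fun setT g ->
  (forall x, 0 <= v x) ->
  mu.-integrable setT (EFin \o (fun x => v x * f x * f x)) ->
  mu.-integrable setT (EFin \o (fun x => v x * g x * g x)) ->
  mu.-integrable setT (EFin \o (fun x => v x * f x * g x)).
Proof.
move=> mv mf mg v0 fi gi.
apply: le_integrable (integrableD measurableT fi gi) => //.
  by apply/measurable_EFinP; apply: measurable_funM => //; exact: measurable_funM.
move=> x _ /=; rewrite lee_fin -!mulrA -mulrDr !normrM !(ger0_norm (v0 x)).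
apply: ler_wpM2l => //.
rewrite (@ger0_norm _ (f x * f x + g x * g x)); last by rewrite -!expr2 addr_ge0 ?sqr_ge0.
rewrite -[f x * f x]expr2 -[g x * g x]expr2 -[f x ^+ 2]real_normK ?num_real//.
rewrite -[g x ^+ 2]real_normK ?num_real//.
have := sqr_ge0 (`|f x| - `|g x|); have := normr_ge0 (f x); have := normr_ge0 (g x).
nra.
Qed.

(** A vanishing combination is integrated against each member of the family.
The finite norms make all the products integrable, as linearity of the integral
requires. *)
Lemma orthonormal_free (I : eqType) (s : seq I) (v : X -> R) (f : I -> X -> R) (c : I -> R) :
  measurable_fun setT v -> (forall x, 0 <= v x) ->
  (forall i, i \in s -> measurable_fun setT (f i)) -> uniq s ->
  (forall i j, i \in s -> j \in s ->
    (\int[mu]_x (v x * f i x * f j x)%:E = (i == j)%:R%:E)%E) ->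
  (forall x, \sum_(i <- s) c i * f i x = 0) ->
  forall j, j \in s -> c j = 0.
Proof.
move=> mv v0 mf us fE f0 j js.
have fi i k : i \in s -> k \in s ->
    mu.-integrable setT (EFin \o (fun x => v x * f i x * f k x)).
  have fii i' : i' \in s -> mu.-integrable setT (EFin \o (fun x => v x * f i' x * f i' x)).
    move=> i's; apply: integrable_ge0_fin (fE _ _ i's i's).
      by apply: measurable_funM; [apply: measurable_funM => //|]; exact: mf.
    by move=> x; rewrite -mulrA mulr_ge0// -expr2 sqr_ge0.
  by move=> iS kS; apply: integrable_weighted_product (fii i iS) (fii k kS) => //; exact: mf.
(* the terms outside s are cut off, as nothing is known of their integrals *)
pose h i x : \bar R := if i \in s then ((c i)%:E * (v x * f i x * f j x)%:E)%E else 0%E.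
have hi i : mu.-integrable setT (h i).
  rewrite /h; have [iS|_] := boolP (i \in s); last exact: integrable0.
  exact: integrableZl (fi i j iS js).
have e0 : (\int[mu]_x (\sum_(i <- s) h i x) = 0)%E.
  apply: integral0_eq => x _.
  rewrite (eq_big_seq (fun i => (c i * (v x * f i x * f j x))%:E)); last first.
    by move=> i iS; rewrite /h iS EFinM.
  rewrite sumEFin; congr EFin.
  transitivity (v x * f j x * \sum_(i <- s) c i * f i x); last by rewrite f0 mulr0.
  by rewrite mulr_sumr; apply: eq_bigr => i _; ring.
move: e0; rewrite integral_sum// (eq_big_seq (fun i => (c i * (i == j)%:R)%:E)); last first.
  by move=> i iS; rewrite /h iS integralZl ?fE// fi.
rewrite sumEFin => -[]; rewrite (bigD1_seq j)//= eqxx mulr1 big1 ?addr0//.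
by move=> i /negbTE ->; rewrite mulr0.
Qed.

End GramIntegrals.

Section TransportIntegrable.
Context {d1 d2 : measure_display} {X : measurableType d1} {Y : measurableType d2}
  {R : realType}.
Variables (mu : {measure set X -> \bar R}) (nu : {measure set Y -> \bar R}).

Lemma transports_integrable (T : X -> Y) (w : X -> R) (w' F : _ -> R) :
  measurable_fun setT T -> measurable_fun setT w -> measurable_fun setT F ->
  (forall x, 0 <= w x) -> (forall y, 0 <= w' y) ->
  transports mu nu T w w' ->
  nu.-integrable setT (EFin \o (fun y => F y * w' y)) ->
  mu.-integrable setT (EFin \o (fun x => F (T x) * w x)).
Proof.
move=> mT mw mF w0 w'0 tr /integrableP[_ Fi]; apply/integrableP; split.
  apply/measurable_EFinP; apply: measurable_funM => //.
  exact: (measurableT_comp mF).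
under eq_integral do rewrite /= normrM (ger0_norm (w0 _)).
rewrite (transports_signed w0 w'0 (F := fun y => `|F y|) _ tr); last first.
  exact: measurable_fun_norm.
by under eq_integral => y _ do rewrite -{1}(ger0_norm (w'0 y)) -normrM.
Qed.

End TransportIntegrable.

(** * Latitudinal and radial orthogonality *)

Section LatitudeIntegral.
Context {R : realType}.
Local Notation lambda := (@lebesgue_measure R).

Lemma continuous_latitude l m : continuous (fun t : R => latitude l m (sin t)).
Proof.
move=> t; apply: cvgM; first exact: cvg_cst.
apply: (@continuous_comp _ _ _ (@sin R) (horner (rodrigues l)^`(l + m))).
  exact: continuous_sin.
exact: continuous_horner.
Qed.

Lemma continuous_cosX m : continuous (fun t : R => cos t ^+ m).
Proof.
move=> t; apply: (@continuous_comp _ _ _ (@cos R) (fun x => x ^+ m)).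
  exact: continuous_cos.
exact: exprn_continuous.
Qed.

(** With y = sin t this is the orthogonality of Legendre polynomials; the square
of the normalization of the spherical harmonics cancels all the constants but
2 / (2 l + 1). *)
Lemma latitude_orthogonality l l' m : (m <= l)%N -> (m <= l')%N ->
  (\int[lambda]_t (half_turn t * cos t * ((cos t ^+ m * latitude l m (sin t)) *
     (cos t ^+ m * latitude l' m (sin t))))%:E = ((l == l')%:R * (2 / (2 * l + 1)%:R))%:E)%E.
Proof.
move=> ml ml'.
pose p : {poly R} := (solid_coef l m * solid_coef l' m) *:
  ((1 - 'X^2) ^+ m * ((rodrigues l)^`(l + m) * (rodrigues l')^`(l' + m))).
transitivity (\int[lambda]_t (half_turn t * (cos t * p.[sin t]))%:E)%E.
  apply: eq_integral => t _; congr EFin.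
  rewrite /p /latitude !hornerE /= -cos2sin2 -exprM mulnC exprM; ring.
rewrite integral_latitude /p defintZ legendre_orthogonality//.
have [<-|_] := eqVneq l l'; last by rewrite !mul0r mulr0.
congr EFin; rewrite !mul1r [LHS]mulrA -[RHS]mul1r; congr (_ * _).
rewrite /solid_coef.
have f0 n : n`!%:R != 0 :> R by rewrite pnatr_eq0 -lt0n fact_gt0.
set a := (l - m)`!%:R; set b := (l + m)`!%:R.
have a0 : a != 0 by exact: f0.
have b0 : b != 0 by exact: f0.
have ab : 0 <= a / b by rewrite divr_ge0.
have c0 : 2 ^+ l * l`!%:R != 0 :> R by rewrite mulf_neq0// expf_neq0.
have s2 : (-1) ^+ m * (-1) ^+ m = 1 :> R by rewrite -exprMn mulrNN mulr1 expr1n.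
set c := 2 ^+ l * _ in c0 *.
transitivity (Num.sqrt (a / b) ^+ 2 * ((-1) ^+ m * (-1) ^+ m) * (b / a)).
  by field; rewrite a0 c0.
by rewrite sqr_sqrtr// s2; field; rewrite a0 b0.
Qed.

End LatitudeIntegral.

Section RadialIntegral.
Context {R : realType}.
Local Notation lambda := (@lebesgue_measure R).
Variables (zeta : R) (P : nat -> nat -> {poly R}).
Hypotheses (zeta0 : 0 < zeta) (hP : forall l, orthonormal_polys (omega l zeta) (P l)).

(** If the integral were 0, the weight would be 0 as a quotient by 0, and P_0
could not have norm 1. *)
Lemma bessel_gt0 : 0 < bessel_K 2 zeta.
Proof.
have B0 : 0 <= bessel_K 2 zeta.
  apply: Rintegral_ge0 => x _; rewrite mulr_ge0 ?expR_ge0//.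
  by rewrite /cosh divr_ge0// addr_ge0 ?expR_ge0.
rewrite lt_neqAle B0 andbT; apply/eqP => B.
have [_ _ /(_ 0%N 0%N)] := hP 0; rewrite eqxx integral0_eq => [[]/eqP|x _].
  by rewrite eq_sym oner_eq0.
by rewrite /omega -B !mulr0 invr0 !mulr0 !mul0r mulr0.
Qed.

Let kappa : R := zeta / bessel_K 2 zeta.

Let kappa_gt0 : 0 < kappa. Proof. by rewrite divr_gt0// bessel_gt0. Qed.

Definition root (x : R) : R := Num.sqrt (x ^+ 2 - 1).

Definition above_one (x : R) : R := \1_(`]1, +oo[) x.

Lemma above_oneE x : above_one x = (1 < x)%R%:R.
Proof.
rewrite /above_one indicE; congr (_%:R); congr nat_of_bool.
by apply/idP/idP; rewrite inE/= in_itv/= andbT.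
Qed.

(** The factor root x comes from r^2 dr / sqrt (1 + r^2) = r dx, where
x = sqrt (1 + r^2) and r = root x. *)
Definition radial_weight (x : R) : R := kappa / (4 * pi) * expR (- zeta * x) * root x.

Definition radial (k l : nat) (x : R) : R := (P l k).[x] * root x ^+ l.

Lemma measurable_root : measurable_fun setT root.
Proof.
by apply: measurable_fun_sqrt; apply: measurable_funB => //; exact: measurable_funX.
Qed.

Lemma measurable_above_one : measurable_fun setT above_one.
Proof. exact: measurable_fun_indicator. Qed.

Lemma measurable_radial_weight : measurable_fun setT radial_weight.
Proof.
apply: measurable_funM; last exact: measurable_root.
by apply: measurable_funM => //; apply: measurable_fun_expR; exact: measurable_funM.
Qed.

Lemma radial_weight_ge0 x : 0 <= radial_weight x.
Proof.
rewrite mulr_ge0 ?sqrtr_ge0// mulr_ge0 ?expR_ge0// divr_ge0 ?(ltW kappa_gt0)//.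
by rewrite mulr_ge0// pi_ge0.
Qed.

Lemma measurable_radial k l : measurable_fun setT (radial k l).
Proof.
apply: measurable_funM; first exact: measurable_fun_horner.
by apply: measurable_funX; exact: measurable_root.
Qed.

Lemma omegaE l x : 1 < x ->
  radial_weight x * root x ^+ (2 * l) = (2 * l + 1)%:R / (4 * pi) * omega l zeta x.
Proof.
move=> x1; have y0 : 0 < x ^+ 2 - 1 by rewrite subr_gt0 expr_gt1// (le_trans _ (ltW x1)).
have B0 := bessel_gt0; have pi0 := @pi_gt0 R.
rewrite /omega /radial_weight powRD; last by rewrite (gt_eqF y0) implybT.
rewrite powR_mulrn ?(ltW y0)// powR12_sqrt ?(ltW y0)// -/(root x).
have -> : (x ^+ 2 - 1) ^+ l = root x ^+ (2 * l) by rewrite exprM sqr_sqrtr// ltW.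
rewrite -[(2 * l + 1)%:R]/((2 * l + 1)%:R : R) natrD natrM /kappa.
have c0 : 2 * l%:R + 1 != 0 :> R by rewrite gt_eqF// ltr_wpDl// mulr_ge0.
move: (@pi R) pi0 => w w0.
by field; rewrite (gt_eqF B0) (gt_eqF w0) c0.
Qed.

Lemma omega_ge0 l x : 1 < x -> 0 <= omega l zeta x.
Proof.
move=> x1; rewrite /omega mulr_ge0 ?expR_ge0// divr_ge0//.
  by rewrite mulr_ge0 ?powR_ge0 ?ltW.
by rewrite mulr_ge0 ?(ltW bessel_gt0)// addr_ge0// mulr_ge0.
Qed.

Lemma measurable_omega l : measurable_fun setT (omega l zeta).
Proof.
apply: measurable_funM; last by apply: measurable_fun_expR; exact: measurable_funM.
apply: measurable_funM => //; apply: measurable_funM => //.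
apply: (measurableT_comp (measurable_powR _)).
by apply: measurable_funB => //; exact: measurable_funX.
Qed.

Let pw l x := above_one x * omega l zeta x.

Let poly_orthonormal l j k :
  (\int[lambda]_x (pw l x * (P l j).[x] * (P l k).[x])%:E = (j == k)%:R%:E)%E.
Proof.
have [_ _ /(_ j k) <-] := hP l.
have mf : measurable_fun setT (fun x => (P l j).[x] * (P l k).[x] * omega l zeta x).
  apply: measurable_funM; last exact: measurable_omega.
  by apply: measurable_funM; exact: measurable_fun_horner.
rewrite -integral_itv_obnd_cbnd; last first.
  by apply/measurable_EFinP; exact: measurable_funTS.
rewrite [RHS]integral_mkcond; apply: eq_integral => x _.
rewrite patchE /pw above_oneE; case: (ltP 1 x) => x1.
  by rewrite mem_set ?mul1r /= ?in_itv/= ?x1//; congr EFin; ring.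
by rewrite memNset ?mul0r//= in_itv/= andbT ltNge x1.
Qed.

Let pw_ge0 l x : 0 <= pw l x.
Proof.
rewrite /pw above_oneE; case: (ltP 1 x) => [x1|]; last by rewrite mul0r.
by rewrite mul1r omega_ge0.
Qed.

Let measurable_pw l : measurable_fun setT (pw l).
Proof. by apply: measurable_funM; [exact: measurable_above_one|exact: measurable_omega]. Qed.

Let radialE j k l x : above_one x * radial_weight x * radial j l x * radial k l x =
  (2 * l + 1)%:R / (4 * pi) * (pw l x * (P l j).[x] * (P l k).[x]).
Proof.
rewrite /pw above_oneE; case: (ltP 1 x) => [x1|]; last by rewrite !mul0r mulr0.
rewrite !mul1r.
transitivity (radial_weight x * root x ^+ (2 * l) * (P l j).[x] * (P l k).[x]).
  by rewrite /radial mulnC exprM; ring.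
by rewrite omegaE//; ring.
Qed.

Lemma radial_orthogonality j k l :
  (\int[lambda]_x (above_one x * radial_weight x * radial j l x * radial k l x)%:E =
   ((2 * l + 1)%:R / (4 * pi) * (j == k)%:R)%:E)%E.
Proof.
under eq_integral do rewrite radialE EFinM.
have mP i : measurable_fun setT (fun x => (P l i).[x]) by exact: measurable_fun_horner.
have int_diag i : lambda.-integrable setT (EFin \o (fun x => pw l x * (P l i).[x] * (P l i).[x])).
  apply: integrable_ge0_fin (poly_orthonormal l i i).
    apply: measurable_funM; last exact: mP.
    by apply: measurable_funM; [exact: measurable_pw|exact: mP].
  by move=> x; rewrite -mulrA mulr_ge0 ?pw_ge0// -expr2 sqr_ge0.
have mPl i : measurable_fun setT (fun x : measurableTypeR R => (P l i).[x]) by exact: mP.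
rewrite integralZl//; first by rewrite poly_orthonormal -EFinM.
exact: (@integrable_weighted_product _ (measurableTypeR R) R lambda (pw l) _ _
  (measurable_pw l) (mPl j) (mPl k) (pw_ge0 l) (int_diag j) (int_diag k)).
Qed.

(** The degrees l and l' may differ here: when the angular integrals vanish, the
radial one still has to be finite for Fubini to apply. Finiteness follows from
the two norms. *)
Lemma radial_integrable j l k l' : lambda.-integrable setT
  (EFin \o (fun x => above_one x * radial_weight x * radial j l x * radial k l' x)).
Proof.
pose v x := above_one x * radial_weight x.
have v0 x : 0 <= v x.
  by rewrite /v above_oneE mulr_ge0// radial_weight_ge0.
have mv : measurable_fun setT v.
  by apply: measurable_funM; [exact: measurable_above_one|exact: measurable_radial_weight].
have int_diag k1 l1 :
    lambda.-integrable setT (EFin \o (fun x => v x * radial k1 l1 x * radial k1 l1 x)).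
  apply: integrable_ge0_fin (radial_orthogonality k1 k1 l1).
    by apply: measurable_funM; [apply: measurable_funM => //|]; exact: measurable_radial.
  by move=> x; rewrite -mulrA mulr_ge0 ?v0 -?expr2 ?sqr_ge0.
exact: (@integrable_weighted_product _ (measurableTypeR R) R lambda v _ _
  mv (measurable_radial j l) (measurable_radial k l') v0 (int_diag j l) (int_diag k l')).
Qed.

End RadialIntegral.

(** * Orthonormality *)

Section Gram.
Context {R : realType}.
Local Notation mR := (measurableTypeR R).
Local Notation mR3 := (mR * mR * mR)%type.
Local Notation lambda := (@lebesgue_measure R).
Local Notation space := (@plane_measure R \x lambda)%E.

Lemma measurable_cpow n :
  measurable_fun setT (fun p : mR3 => (cpow n p.1.1 p.1.2).1 : R) /\
  measurable_fun setT (fun p : mR3 => (cpow n p.1.1 p.1.2).2 : R).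
Proof.
elim: n => [|n [IH1 IH2]] /=; first by split; exact: measurable_cst.
have [m1 m2] := (@measurable_coord1 R, @measurable_coord2 R).
by split; [apply: measurable_funB|apply: measurable_funD]; exact: measurable_funM.
Qed.

Lemma measurable_solid l m : measurable_fun setT (solid l m : mR3 -> R).
Proof.
have md : measurable_fun setT (fun p : mR3 => dot p p : R).
  by apply: measurable_funD; first apply: measurable_funD; apply: measurable_funM;
    first [exact: measurable_coord1|exact: measurable_coord2|exact: measurable_coord3].
apply: measurable_funM.
  apply: measurable_funM; first exact: measurable_cst.
  under eq_fun do rewrite /zonal big_mkcond.
  apply: measurable_sum => i; case: (_ <= _)%N; last exact: measurable_cst.
  apply: measurable_funM; last exact: measurable_funX.
  apply: measurable_funM; first exact: measurable_cst.
  by apply: measurable_funX; exact: measurable_coord3.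
have [c1 c2] := measurable_cpow `|m|%N.
rewrite /sectoral; case: (m < 0); last case: (m == 0).
- by apply: measurable_funM => //; exact: measurable_cst.
- exact: measurable_cst.
- by apply: measurable_funM => //; exact: measurable_cst.
Qed.

Variables (u : R * R * R) (theta : R) (P : nat -> nat -> {poly R}).
Hypotheses (hu : enorm u < 1) (theta0 : 0 < theta)
  (hP : forall l, orthonormal_polys (omega l theta^-1) (P l)).

Let zeta := theta^-1.
Let zeta0 : 0 < zeta. Proof. by rewrite invr_gt0. Qed.

Lemma dot_lt1 : dot u u < 1.
Proof. by rewrite -sqr_enorm expr_lt1// sqrtr_ge0. Qed.

Let B := bessel_K 2 zeta.
Let B0 : 0 < B. Proof. exact: bessel_gt0 hP. Qed.

Let c0 : R := zeta / B / (4 * pi).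

(** The weight as a function of the energy. *)
Definition rest_weight (x : R) : R := c0 * expR (- zeta * x).

(** A basis function in terms of the momentum in the rest frame, without the
weight. *)
Definition rest_basis (i : nat * nat * int) (p : R * R * R) : R :=
  (P i.1.2 i.1.1).[shell p] * solid i.1.2 i.2 p.

Lemma rest_weight_gt0 x : 0 < rest_weight x.
Proof.
by rewrite mulr_gt0 ?expR_gt0// !divr_gt0// mulr_gt0// pi_gt0.
Qed.

Lemma weight0E p : weight0 u theta p = rest_weight (shell (rest u p)).
Proof.
rewrite /weight0 energy_rest ?dot_lt1// /rest_weight /c0 -/zeta -/B.
by congr (_ * expR _); [rewrite invfM mulrA mulrAC|rewrite mulrC mulNr mulrN].
Qed.

Lemma basis_funE i p : basis_index i ->
  basis_fun P u theta i p = rest_weight (shell (rest u p)) * rest_basis i (rest u p).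
Proof.
case: i => -[k l] m ml; rewrite /basis_fun weight0E solid_harmE ?dot_lt1//.
by rewrite energy_rest ?dot_lt1// /rest_basis -[LHS]mulrA.
Qed.

Lemma measurable_rest_basis i : measurable_fun setT (rest_basis i : mR3 -> R).
Proof.
apply: measurable_funM; last exact: measurable_solid.
by apply: measurable_fun_horner; exact: measurable_shell.
Qed.

Lemma measurable_rest_weight : measurable_fun setT (fun p : mR3 => rest_weight (shell p)).
Proof.
apply: measurable_funM; first exact: measurable_cst.
apply: measurable_fun_expR; apply: measurable_funM; first exact: measurable_cst.
exact: measurable_shell.
Qed.

Lemma shell_spherical (r t s : R) : shell (spherical (r, t, s)) = Num.sqrt (1 + r ^+ 2).
Proof.
rewrite /shell /dot /spherical /=; congr (Num.sqrt (1 + _)).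
transitivity (r ^+ 2 * (cos t ^+ 2 * (cos s ^+ 2 + sin s ^+ 2) + sin t ^+ 2)); first by ring.
by rewrite cos2Dsin2 mulr1 cos2Dsin2 mulr1.
Qed.

(** The three one-dimensional integrals are (2 l + 1) / (4 pi), 2 / (2 l + 1) and
2 pi on the diagonal. *)
Lemma rest_gram (i j : nat * nat * int) : basis_index i -> basis_index j ->
  (\int[space]_p (rest_weight (shell p) * rest_basis i p * rest_basis j p *
     (shell p)^-1)%:E = (i == j)%:R%:E)%E.
Proof.
case: i j => [[k l] m] [[k' l'] m']; rewrite /basis_index /= => ml ml'.
pose e (r : R) : R := Num.sqrt (1 + r ^+ 2).
pose f (r : R) : R :=
  rest_weight (e r) * ((P l k).[e r] * r ^+ l) * ((P l' k').[e r] * r ^+ l') / e r.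
pose g (t : R) : R := (cos t ^+ `|m|%N * latitude l `|m|%N (sin t)) *
  (cos t ^+ `|m'|%N * latitude l' `|m'|%N (sin t)).
pose h (s : R) : R := azimuth m s * azimuth m' s.
have e_gt0 x : 0 < e x by rewrite sqrtr_gt0 ltr_pwDl// sqr_ge0.
have me : measurable_fun setT e.
  by apply: measurable_fun_sqrt; apply: measurable_funD => //; exact: measurable_funX.
pose rw := radial_weight zeta.
pose F (x : R) := rw x * radial P k l x * radial P k' l' x.
have mF : measurable_fun setT F.
  apply: measurable_funM; last exact: measurable_radial.
  by apply: measurable_funM; [exact: measurable_radial_weight|exact: measurable_radial].
pose w (r : R) : R := \1_(`]0, +oo[) r * (r / e r).
have w0 r : 0 <= w r.
  rewrite /w -/(positive r) positiveE; case: (ltP 0 r) => r0; last by rewrite mul0r.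
  by rewrite mul1r divr_ge0 ?ltW.
have mw : measurable_fun setT w.
  apply: measurable_funM; first exact: measurable_fun_indicator.
  by apply: measurable_funM => //; exact: measurable_fun_inv.
have w'0 r : 0 <= above_one r :> R by rewrite above_oneE.
have radE r : positive r * r ^+ 2 * f r = F (e r) * w r.
  rewrite /w -/(positive r) positiveE; case: (ltP 0 r) => r0; last by rewrite !mul0r mulr0.
  rewrite !mul1r /F /f /rw /radial_weight /radial /rest_weight /c0 -/B.
  have -> : root (e r) = r.
    by rewrite /root sqr_sqrtr ?addr_ge0 ?sqr_ge0// addrAC subrr add0r sqrtr_sqr gtr0_norm.
  by ring.
have te : transports lambda lambda (e : mR -> mR) w above_one by exact: transports_energy.
have Fi : lambda.-integrable setT (EFin \o (fun x => F x * above_one x)).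
  have := radial_integrable zeta0 hP k l k' l'.
  by apply: eq_integrable => // x _ /=; congr EFin; rewrite /F [RHS]mulrC !mulrA.
have fi : lambda.-integrable setT (EFin \o (fun r => positive r * r ^+ 2 * f r)).
  have := @transports_integrable _ _ mR mR R lambda lambda e w above_one F
    me mw mF w0 w'0 te Fi.
  by apply: eq_integrable => // r _ /=; rewrite radE.
have gi : lambda.-integrable setT (EFin \o (fun t => half_turn t * cos t * g t)).
  have := @half_turn_integrable R (fun t => cos t * g t) _.
  have cg : continuous (fun t => cos t * g t).
    move=> t; apply: cvgM; first exact: continuous_cos.
    by apply: cvgM; apply: cvgM; first [exact: continuous_cosX|exact: continuous_latitude].
  by move=> /(_ cg); apply: eq_integrable => // t _ /=; rewrite mulrA.
have hi : lambda.-integrable setT (EFin \o (fun s => full_turn s * h s)).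
  by apply: full_turn_integrable => s; apply: cvgM; exact: continuous_azimuth.
have mG : measurable_fun setT (fun p : mR3 => rest_weight (shell p) *
    rest_basis (k, l, m) p * rest_basis (k', l', m') p * (shell p)^-1).
  apply: measurable_funM; last exact: measurable_invshell.
  apply: measurable_funM; last exact: measurable_rest_basis.
  by apply: measurable_funM; [exact: measurable_rest_weight|exact: measurable_rest_basis].
rewrite (integral_spherical mG _ fi gi hi); last first.
  move=> r t s _ _; rewrite shell_spherical -/(e r) /rest_basis /= shell_spherical -/(e r).
  rewrite /spherical /= !solid_spherical// ?cos2Dsin2//.
  by rewrite /f /g /h; ring.
rewrite /h azimuth_orthogonality.
have [mm'|mm'] := eqVneq m m'; last first.
  by rewrite mul0r mule0 !xpair_eqE (negbTE mm') andbF.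
subst m'; rewrite /g latitude_orthogonality//.
have [ll'|ll'] := eqVneq l l'; last first.
  by rewrite mul0r mule0 mul0e !xpair_eqE (negbTE ll') andbF.
subst l'.
have -> : (\int[lambda]_r (positive r * r ^+ 2 * f r)%:E =
    ((2 * l + 1)%:R / (4 * pi) * (k == k')%:R)%:E)%E.
  under eq_integral do rewrite radE.
  rewrite (@transports_signed _ _ mR mR R lambda lambda e w above_one F w0 w'0 mF te).
  rewrite -(radial_orthogonality zeta0 hP k k' l); apply: eq_integral => x _; congr EFin.
  by rewrite /F [LHS]mulrC !mulrA.
rewrite -!EFinM; congr EFin; rewrite !xpair_eqE !eqxx !andbT /= mul1r.
have l0 : (2 * l + 1)%:R != 0 :> R by rewrite addn1 pnatr_eq0.
have pi0 := @pi_gt0 R; rewrite mulr2n.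
move: (@pi R) ((2 * l + 1)%:R : R) pi0 l0 => w1 w2 pi0 l0.
by field; rewrite l0 gt_eqF.
Qed.

Lemma inner_basis (i j : nat * nat * int) : basis_index i -> basis_index j ->
  inner u theta (basis_fun P u theta i) (basis_fun P u theta j) = (i == j)%:R%:E.
Proof.
move=> bi bj; rewrite -(rest_gram bi bj) /inner lebesgue3E.
pose H (q : mR3) : R := rest_weight (shell q) * rest_basis i q * rest_basis j q.
have mH : measurable_fun setT H.
  apply: measurable_funM; last exact: measurable_rest_basis.
  by apply: measurable_funM; [exact: measurable_rest_weight|exact: measurable_rest_basis].
have := @transports_signed _ _ mR3 mR3 R space space (rest u : mR3 -> mR3) _ _ H
  (@invshell_ge0 R) (@invshell_ge0 R) mH (transports_rest dot_lt1).
move=> <-; apply: eq_integral => p _; congr EFin.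
rewrite mom0 weight0E !basis_funE// /H.
have := rest_weight_gt0 (shell (rest u p)); move: (rest_weight _) => w w0.
have := shell_gt0 p; move: (shell p) => s s0.
by field; rewrite !gt_eqF.
Qed.

Lemma measurable_basis_fun i : basis_index i ->
  measurable_fun setT (basis_fun P u theta i : mR3 -> R).
Proof.
move=> bi.
have -> : basis_fun P u theta i =
    (fun p => rest_weight (shell (rest u p)) * rest_basis i (rest u p)) :> (mR3 -> R).
  by apply/funext => p; exact: basis_funE.
have mr := @measurable_rest R u.
apply: measurable_funM.
  exact: (measurableT_comp measurable_rest_weight mr).
exact: (measurableT_comp (@measurable_rest_basis i) mr).
Qed.

Lemma basis_fun_free : lin_indep basis_index (basis_fun P u theta).
Proof.
move=> s c us sD e0.
pose v (p : mR3) : R := (rest_weight (shell (rest u p)))^-1 * (shell p)^-1.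
apply: (@orthonormal_free _ mR3 R space _ s v
  (fun i p => basis_fun P u theta i p) c) => //.
- apply: measurable_funM; last exact: measurable_invshell.
  apply: measurable_fun_inv.
  exact: (measurableT_comp measurable_rest_weight (@measurable_rest R u)).
- by move=> p; rewrite mulr_ge0 ?invr_ge0 ?(ltW (rest_weight_gt0 _)) ?(ltW (shell_gt0 _)).
- by move=> i /sD; exact: measurable_basis_fun.
- move=> i j /sD bi /sD bj; rewrite -(inner_basis bi bj) /inner lebesgue3E.
  apply: eq_integral => p _; congr EFin.
  by rewrite /v mom0 weight0E; ring.
move=> p; have := congr1 (fun f : R * R * R -> R^o => f p) e0; by rewrite fct_sumE.
Qed.

End Gram.

(** * Linear spans and exchange *)

Section Span.
Context {R : realType} {V : lmodType R}.
Implicit Types (S T : set V) (v w : V).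

Lemma lin_span_gen S v : S v -> lin_span S v.
Proof.
move=> Sv; exists 1%N, (fun=> 1), (fun=> v); split=> //.
by rewrite big_ord1 scale1r.
Qed.

Lemma lin_span0 S : lin_span S 0.
Proof.
by exists 0%N, (fun=> 0), (fun=> 0); split=> [[]//|]; rewrite big_ord0.
Qed.

Lemma lin_spanD S v w : lin_span S v -> lin_span S w -> lin_span S (v + w).
Proof.
move=> [m [a [s [Ss ->]]]] [n [b [t [St ->]]]].
exists (m + n)%N, (fun i => match fintype.split i with inl j => a j | inr j => b j end),
  (fun i => match fintype.split i with inl j => s j | inr j => t j end); split.
  by move=> i; case: (fintype.split i).
rewrite big_split_ord /=; congr (_ + _); apply: eq_bigr => i _.
- by rewrite (unsplitK (inl i)).
- by rewrite (unsplitK (inr i)).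
Qed.

Lemma lin_spanZ S (c : R) v : lin_span S v -> lin_span S (c *: v).
Proof.
move=> [m [a [s [Ss ->]]]]; exists m, (fun i => c * a i), s; split=> //.
by rewrite scaler_sumr; apply: eq_bigr => i _; rewrite scalerA.
Qed.

Lemma lin_span_sum S (I : Type) (r : seq I) (Q : pred I) (f : I -> V) :
  (forall i, Q i -> lin_span S (f i)) -> lin_span S (\sum_(i <- r | Q i) f i).
Proof.
move=> Sf; elim/big_ind : _ => //; first exact: lin_span0.
exact: lin_spanD.
Qed.

End Span.

(** Linearity is taken as a plain hypothesis so that multiplications by a fixed
function qualify as they stand. *)
Lemma lin_span_map (R : realType) (V W : lmodType R) (f : V -> W) (S : set V) (T : set W) :
  (forall (a : R) x y, f (a *: x + y) = a *: f x + f y) ->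
  (forall v, S v -> lin_span T (f v)) -> forall v, lin_span S v -> lin_span T (f v).
Proof.
move=> fl ST v [n [c [s [Ss ->]]]].
have f0 : f 0 = 0.
  have := fl 1 0 0; rewrite !scale1r addr0 => e.
  by apply: (addrI (f 0)); rewrite addr0 -e.
elim: n c s Ss => [|n IH] c s Ss; first by rewrite big_ord0 f0; exact: lin_span0.
rewrite big_ord_recl fl; apply: lin_spanD; last exact: IH.
by apply: lin_spanZ; exact: ST.
Qed.

Lemma lin_span_min (R : realType) (V : lmodType R) (S T : set V) :
  S `<=` lin_span T -> lin_span S `<=` lin_span T.
Proof. by move=> ST v; exact: (@lin_span_map _ _ _ id). Qed.

(** The finite family of vectors in a member of the span may repeat or omit
entries of s; here each entry gets one coefficient. *)
Lemma lin_span_seq (R : realType) (V : lmodType R) (I : eqType) (s : seq I) (f : I -> V) v :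
  lin_span (f @` [set` s]) v ->
  exists c : 'I_(size s) -> R, v = \sum_i c i *: f (tnth (in_tuple s) i).
Proof.
move=> [n [c [t [ts ->]]]]; elim: n c t ts => [|n IH] c t ts.
  by exists (fun=> 0); rewrite big_ord0 big1// => i _; rewrite scale0r.
have [d dE] := IH (fun i => c (lift ord0 i)) (fun i => t (lift ord0 i)) (fun i => ts _).
have [j /= js jt] := ts ord0.
have /tnthP[i ji] : j \in in_tuple s by [].
exists (fun k => c ord0 * (k == i)%:R + d k).
rewrite big_ord_recl dE -jt ji.
under [RHS]eq_bigr do rewrite scalerDl.
rewrite big_split /=; congr (_ + _).
rewrite (bigD1 i)//= eqxx mulr1 big1 ?addr0// => k /negbTE ->.
by rewrite mulr0 scale0r.
Qed.

(** The square matrix of the coordinates of the b i in the v i has trivial kernel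
since the b i are independent. Its inverse expresses the v i in the b i. *)
Lemma free_exchange (R : realType) (V : lmodType R) (I : choiceType) (s : seq I)
    (b v : I -> V) :
  uniq s -> lin_indep [set` s] b ->
  (forall i, i \in s -> lin_span (v @` [set` s]) (b i)) ->
  forall i, i \in s -> lin_span (b @` [set` s]) (v i).
Proof.
move=> us bfree bv.
pose e (i : 'I_(size s)) := tnth (in_tuple s) i.
have es i : e i \in s by exact: mem_tnth.
have /choice[A AE] : forall i, exists c : 'I_(size s) -> R,
    b (e i) = \sum_j c j *: v (e j).
  by move=> i; exact/lin_span_seq/bv.
pose M : 'M[R]_(size s) := \matrix_(i, j) A i j.
have combo (x : 'rV[R]_(size s)) :
    \sum_i x 0 i *: b (e i) = \sum_j (x *m M) 0 j *: v (e j).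
  under eq_bigr do rewrite AE scaler_sumr.
  rewrite exchange_big; apply: eq_bigr => j _.
  rewrite mxE scaler_suml; apply: eq_bigr => i _.
  by rewrite mxE scalerA.
have Mu : M \in unitmx.
  rewrite -row_free_unit -kermx_eq0; apply/eqP/row_matrixP => r.
  set x := row r _; have xM : x *m M = 0 by rewrite -row_mul mulmx_ker row0.
  have x0 : \sum_i x 0 i *: b (e i) = 0.
    by rewrite combo xM big1// => j _; rewrite mxE scale0r.
  rewrite row0; apply/rowP => i; rewrite [RHS]mxE.
  (* the coefficients x, indexed by the entries of s instead of their positions *)
  pose c (k : I) : R := if insub (index k s) is Some j then x 0 j else 0.
  have ce j : c (e j) = x 0 j.
    rewrite /c; have -> : index (e j) s = j.
      by rewrite /e (tnth_nth (e j)) index_uniq.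
    by rewrite valK.
  rewrite -ce; apply: (bfree s c) => //.
  rewrite -[RHS]x0 big_tnth; apply: eq_bigr => j _.
  by rewrite -/(e j) ce.
move=> i /(tnthP (in_tuple s))[k ->].
have -> : v (e k) = \sum_j (row k (invmx M) *m M) 0 j *: v (e j).
  rewrite -row_mul mulVmx// (bigD1 k)//= !mxE eqxx scale1r big1 ?addr0// => j jk.
  by rewrite !mxE eq_sym (negbTE jk) scale0r.
rewrite -combo; apply: lin_span_sum => j _; apply/lin_spanZ/lin_span_gen.
by exists (e j) => //; exact: es.
Qed.

(** * Degree in the momentum *)

Section Degree.
Context {R : realType}.
Local Notation fct := (R * R * R -> R^o).
Implicit Types f g : fct.

Definition momentum_monomial (mu : seq 'I_4) : fct := fun p => \prod_(a <- mu) mom p a.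

(** Filtration of the polynomial functions of p^0, ..., p^3. As (p^0)^2 = 1 + |p|^2
these functions are not independent, so the degree is only bounded above. *)
Definition degree_le (n : nat) : set fct :=
  lin_span [set momentum_monomial mu | mu in [set mu | (size mu <= n)%N]].

Lemma degree_leW m n f : (m <= n)%N -> degree_le m f -> degree_le n f.
Proof.
move=> mn; apply: lin_span_min => _ [mu /= mum <-]; apply: lin_span_gen.
by exists mu => //=; exact: leq_trans mn.
Qed.

Lemma degree_le_const n (c : R) : degree_le n (fun=> c).
Proof.
have -> : (fun=> c) = c *: momentum_monomial [::].
  by apply/funext => p; rewrite /momentum_monomial /= fctE big_nil /GRing.scale/= mulr1.
by apply: lin_spanZ; apply: lin_span_gen; exists [::].
Qed.

Lemma degree_leD n f g : degree_le n f -> degree_le n g ->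
  degree_le n (fun p => f p + g p).
Proof. exact: lin_spanD. Qed.

Lemma degree_leZ n (c : R) f : degree_le n f -> degree_le n (fun p => c * f p).
Proof. exact: lin_spanZ. Qed.

Lemma degree_leN n f : degree_le n f -> degree_le n (fun p => - f p).
Proof.
move=> /(degree_leZ (- 1)); congr degree_le; apply/funext => p; exact: mulN1r.
Qed.

Lemma degree_le_sum n (I : Type) (r : seq I) (Q : pred I) (f : I -> fct) :
  (forall i, Q i -> degree_le n (f i)) ->
  degree_le n (fun p => \sum_(i <- r | Q i) f i p).
Proof.
move=> fn; have := lin_span_sum r fn; congr lin_span.
by apply/funext => p; rewrite fct_sumE.
Qed.

Lemma degree_leM m n f g : degree_le m f -> degree_le n g ->
  degree_le (m + n) (fun p => f p * g p).
Proof.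
move=> fm gn; pose mulg h : fct := fun p => h p * g p.
apply: (@lin_span_map _ _ _ mulg _ _ _ _ f fm).
  by move=> a x y; apply/funext => p; rewrite /mulg /= !fctE mulrDl scalerAl.
move=> _ [mu /= mum <-]; pose mulmu h : fct := fun p => momentum_monomial mu p * h p.
apply: (@lin_span_map _ _ _ mulmu _ _ _ _ g gn).
  by move=> a x y; apply/funext => p; rewrite /mulmu /= !fctE mulrDr scalerAr.
move=> _ [nu /= nun <-]; apply: lin_span_gen; exists (mu ++ nu).
  by rewrite /= size_cat leq_add.
by apply/funext => p; rewrite /momentum_monomial big_cat.
Qed.

Lemma degree_leX k n f : degree_le n f -> degree_le (k * n) (fun p => f p ^+ k).
Proof.
move=> fn; elim: k => [|k IH]; first exact: degree_le_const.
rewrite mulSn; have := degree_leM fn IH; congr degree_le.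
by apply/funext => p; rewrite exprS.
Qed.

Lemma degree_le_horner k n (q : {poly R}) f : (size q <= k.+1)%N -> degree_le n f ->
  degree_le (k * n) (fun p => q.[f p]).
Proof.
move=> qk fn.
have -> : (fun p => q.[f p]) = (fun p => \sum_(i < size q) q`_i * f p ^+ i).
  by apply/funext => p; rewrite horner_coef.
apply: degree_le_sum => i _; apply: degree_leZ.
apply: degree_leW (degree_leX i fn); rewrite leq_mul2r; apply/orP; right.
by have := ltn_ord i; lia.
Qed.

Lemma degree_le_mom a : degree_le 1 (fun p => mom p a).
Proof.
apply: lin_span_gen; exists [:: a] => //.
by apply/funext => p; rewrite /momentum_monomial big_seq1.
Qed.

Lemma degree_le_shell : degree_le 1 shell.
Proof. by have := degree_le_mom ord0; congr degree_le; apply/funext => p; rewrite mom0. Qed.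

Lemma degree_le_coord i : degree_le 1 (fun p => Defs.coord p i).
Proof.
by have := degree_le_mom (lift ord0 i); congr degree_le; apply/funext => p; rewrite momS.
Qed.

Lemma degree_le_coords :
  [/\ degree_le 1 (fun p => p.1.1), degree_le 1 (fun p => p.1.2) & degree_le 1 (fun p => p.2)].
Proof.
split; [exact: (degree_le_coord (@Ordinal 3 0 isT))|
  exact: (degree_le_coord (@Ordinal 3 1 isT))|exact: (degree_le_coord (@Ordinal 3 2 isT))].
Qed.

Lemma degree_le_rest u :
  [/\ degree_le 1 (fun p => (rest u p).1.1), degree_le 1 (fun p => (rest u p).1.2)
    & degree_le 1 (fun p => (rest u p).2)].
Proof.
have [d1 d2 d3] := degree_le_coords.
have dk : degree_le 1 (fun p =>
    gamma u ^+ 2 / (gamma u + 1) * dot u p - gamma u * shell p).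
  apply: degree_leD; last by apply/degree_leN/degree_leZ/degree_le_shell.
  apply: degree_leZ; apply: degree_leD; last exact: degree_leZ.
  by apply: degree_leD; exact: degree_leZ.
have dku c : degree_le 1 (fun p =>
    (gamma u ^+ 2 / (gamma u + 1) * dot u p - gamma u * shell p) * c).
  by have := degree_leZ c dk; congr degree_le; apply/funext => p; rewrite mulrC.
by split; apply: degree_leD.
Qed.

Lemma degree_le_shell_rest u : dot u u < 1 -> degree_le 1 (fun p => shell (rest u p)).
Proof.
move=> u1; have [d1 d2 d3] := degree_le_coords.
have -> : (fun p => shell (rest u p)) = (fun p => gamma u * (shell p - dot u p)).
  by apply/funext => p; rewrite -energy_rest// energyE.
apply: degree_leZ; apply: degree_leD; first exact: degree_le_shell.
apply: degree_leN; apply: degree_leD; last exact: degree_leZ.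
by apply: degree_leD; exact: degree_leZ.
Qed.

Lemma degree_le_cpow n f g : degree_le 1 f -> degree_le 1 g ->
  degree_le n (fun p => (cpow n (f p) (g p)).1) /\
  degree_le n (fun p => (cpow n (f p) (g p)).2).
Proof.
move=> f1 g1; elim: n => [|n [IH1 IH2]]; first by split; exact: degree_le_const.
rewrite -add1n; split; apply: degree_leD; try apply: degree_leN; exact: degree_leM.
Qed.

Lemma degree_le_solid u l m : (`|m| <= l)%N ->
  degree_le l (fun p => solid l m (rest u p)).
Proof.
move=> ml; have [d1 d2 d3] := degree_le_rest u.
have -> : l = (l - `|m| + `|m|)%N by rewrite subnK.
apply: degree_leM; last first.
  have [c1 c2] := degree_le_cpow `|m|%N d1 d2.
  rewrite /sectoral; case: (m < 0); last case: (m == 0).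
  - exact: degree_leZ.
  - exact: degree_le_const.
  - exact: degree_leZ.
apply: degree_leZ; rewrite subnK//.
apply: degree_le_sum => i il.
have -> : (l - `|m| = (2 * i - (l + `|m|)) * 1 + (l - i) * (1 + 1))%N.
  by have := ltn_ord i; lia.
apply: degree_leM; first by apply: degree_leZ; exact: degree_leX.
apply: degree_leX; apply: degree_leD; last exact: degree_leM.
by apply: degree_leD; exact: degree_leM.
Qed.

End Degree.

(** * Reduced monomials *)

Section Reduction.
Context {R : realType}.
Local Notation fct := (R * R * R -> R^o).

(** The reduced monomials, at most linear in p^0, are indexed by the indices of
the basis: (p^1)^k (p^2)^m (p^3)^(l-m) if m >= 0, and
p^0 (p^1)^k (p^2)^(|m|-1) (p^3)^(l-|m|) if m < 0. Both have degree k + l. *)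
Definition reduced (i : nat * nat * int) : fct := fun p =>
  shell p ^+ (i.2 < 0)%R * p.1.1 ^+ i.1.1 * p.1.2 ^+ (`|i.2| - (i.2 < 0)%R) *
  p.2 ^+ (i.1.2 - `|i.2|).

(** The indexing of the reduced monomials is onto: the exponent e of p^0 is
encoded in the sign of m, at the cost of one unit of |m|, so m is c or - (c + 1). *)
Lemma reducedE (e : bool) (b c d n : nat) : (e + b + c + d <= n)%N ->
  exists2 i, basis_index_le n i &
    reduced i = fun p => shell p ^+ e * p.1.1 ^+ b * p.1.2 ^+ c * p.2 ^+ d.
Proof.
move=> en; pose m : int := if e then - c.+1%:Z else c%:Z.
have m0 : (m < 0)%R = e by rewrite /m; case: e {en m}; lia.
have mE : `|m|%N = (c + e)%N by rewrite /m; case: e {en m m0}; lia.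
exists (b, (c + e + d)%N, m).
  by split; rewrite /basis_index /=; [rewrite mE leq_addr|lia].
by rewrite /reduced /= m0 mE addnK addKn.
Qed.

(** Only the product of p^0 with a monomial containing p^0 leaves the reduced
form; it is brought back by (p^0)^2 = 1 + |p|^2. *)
Lemma reduced_mom a n i : basis_index_le n i ->
  lin_span (reduced @` basis_index_le n.+1) (fun p => mom p a * reduced i p : R^o).
Proof.
case: i => [[k l] m] []; rewrite /basis_index /= => ml kl.
pose e := (m < 0)%R; pose c := (`|m| - e)%N; pose d := (l - `|m|)%N.
have tot : (e + k + c + d <= n)%N.
  rewrite /c /d /e; move: ml kl; case: (ltP m 0) => /=; lia.
have gen (f : fct) (e' : bool) b' c' d' : (e' + b' + c' + d' <= n.+1)%N ->
    f = (fun p => shell p ^+ e' * p.1.1 ^+ b' * p.1.2 ^+ c' * p.2 ^+ d') ->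
    lin_span (reduced @` basis_index_le n.+1) f.
  move=> le ->; have [i iD <-] := reducedE le.
  by apply: lin_span_gen; exists i.
case: (unliftP ord0 a) => [j ->|->].
  case: j => -[|[|[|//]]] hj.
  - apply: (gen _ e k.+1 c d); first by lia.
    by apply/funext => p; rewrite momS /reduced /Defs.coord /tnth /= exprS; ring.
  - apply: (gen _ e k c.+1 d); first by lia.
    by apply/funext => p; rewrite momS /reduced /Defs.coord /tnth /= exprS; ring.
  - apply: (gen _ e k c d.+1); first by lia.
    by apply/funext => p; rewrite momS /reduced /Defs.coord /tnth /= exprS; ring.
have eE : e = (m < 0)%R by [].
case: e eE @c @d tot gen => eE c d tot gen; last first.
  apply: (gen _ true k c d); first by lia.
  by apply/funext => p; rewrite mom0 /reduced /= -eE expr0 expr1 !mul1r !mulrA.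
have -> : (fun p => mom p ord0 * reduced (k, l, m) p : R^o) =
    (fun p => 1 * p.1.1 ^+ k * p.1.2 ^+ c * p.2 ^+ d) +
    ((fun p => 1 * p.1.1 ^+ k.+2 * p.1.2 ^+ c * p.2 ^+ d) +
     ((fun p => 1 * p.1.1 ^+ k * p.1.2 ^+ c.+2 * p.2 ^+ d) +
      (fun p => 1 * p.1.1 ^+ k * p.1.2 ^+ c * p.2 ^+ d.+2))) :> fct.
  apply/funext => p; rewrite !fctE mom0 /reduced /= -eE expr1 -/c -/d.
  transitivity (shell p ^+ 2 * (p.1.1 ^+ k * p.1.2 ^+ c * p.2 ^+ d)); first by ring.
  by rewrite sqr_shell /dot !exprS; ring.
by apply: lin_spanD; [|apply: lin_spanD; [|apply: lin_spanD]];
  [apply: (gen _ false k c d)|apply: (gen _ false k.+2 c d)|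
   apply: (gen _ false k c.+2 d)|apply: (gen _ false k c d.+2)] => //; lia.
Qed.

Lemma degree_le_reduced n (f : fct) : degree_le n f ->
  lin_span (reduced @` basis_index_le n) f.
Proof.
apply: lin_span_min => _ [mu /= mun <-].
have sub : lin_span (reduced @` basis_index_le (size mu)) `<=`
    lin_span (reduced @` basis_index_le n).
  apply: lin_span_min => _ [i [iD il] <-]; apply: lin_span_gen; exists i => //.
  by split=> //; exact: leq_trans mun.
apply: sub; elim: mu {mun} => [|a mu IH].
  have [i iD iE] := @reducedE false 0 0 0 0 isT.
  apply: lin_span_gen; exists i => //; rewrite iE; apply/funext => p.
  by rewrite /momentum_monomial big_nil !mulr1.
pose mula (h : fct) : fct := fun p => mom p a * h p.
have -> : momentum_monomial (a :: mu) = mula (momentum_monomial mu).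
  by apply/funext => p; rewrite /momentum_monomial big_cons.
apply: (@lin_span_map _ _ _ mula _ _ _ _ _ IH).
  by move=> x f1 f2; apply/funext => p; rewrite /mula /= !fctE mulrDr scalerAr.
by move=> _ [i iD <-]; exact: reduced_mom.
Qed.

Lemma basis_index_le_seq n : exists2 s : seq (nat * nat * int), uniq s &
  [set` s] = basis_index_le n.
Proof.
(* the orders, between - n and n, are enumerated through m + n *)
pose t : seq (nat * nat * int) := [seq (kl.1, kl.2, m) |
  kl <- [seq (k, l) | k <- iota 0 n.+1, l <- iota 0 n.+1],
  m <- [seq j%:Z - n%:Z | j <- iota 0 (2 * n).+1]].
have tP i : basis_index_le n i -> i \in t.
  case: i => [[k l] m] []; rewrite /basis_index /= => ml kl.
  apply/allpairsP; exists ((k, l), m); split; last by [].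
    apply/allpairsP; exists (k, l); split; last by [].
    - by rewrite mem_iota -[fst _]/k; lia.
    - by rewrite mem_iota -[snd _]/l; lia.
  apply/mapP; exists (absz (m + n%:Z)); last by rewrite -[snd _]/m; lia.
  by rewrite mem_iota; lia.
move: t tP => t tP.
exists (undup [seq i <- t | (`|i.2| <= i.1.2)%N && (i.1.1 + i.1.2 <= n)%N]).
  exact: undup_uniq.
apply/seteqP; split => i /=; rewrite mem_undup mem_filter.
  by move=> /andP[/andP[]].
by move=> iD; rewrite tP// andbT; apply/andP; case: iD.
Qed.

End Reduction.

(** * The basis *)

Section Completeness.
Context {R : realType}.
Local Notation fct := (R * R * R -> R^o).
Variables (u : R * R * R) (theta : R) (P : nat -> nat -> {poly R}).
Hypotheses (hu : enorm u < 1) (theta0 : 0 < theta)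
  (hP : forall l, orthonormal_polys (omega l theta^-1) (P l)).

Definition weighted (f : fct) : fct := fun p => f p * weight0 u theta p.

Lemma weighted_linear (a : R) f g : weighted (a *: f + g) = a *: weighted f + weighted g.
Proof. by apply/funext => p; rewrite /weighted /= !fctE mulrDl scalerAl. Qed.

Lemma degree_le_basis_fun i : basis_index i ->
  exists2 f, degree_le (i.1.1 + i.1.2) f & basis_fun P u theta i = weighted f.
Proof.
case: i => [[k l] m] ml; exists (fun p => rest_basis P (k, l, m) (rest u p)).
  apply: degree_leM; last exact: degree_le_solid.
  rewrite -[k in degree_le k]muln1; apply: degree_le_horner.
    by have [-> _ _] := hP l.
  by apply: degree_le_shell_rest; exact: dot_lt1.
by apply/funext => p; rewrite basis_funE// -weight0E// mulrC.
Qed.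

Lemma basis_fun_space_HM n i : basis_index_le n i ->
  space_HM u theta n (basis_fun P u theta i).
Proof.
move=> [iD il]; have [f fn ->] := degree_le_basis_fun iD.
apply: (lin_span_map weighted_linear _ (degree_leW il fn)).
by move=> _ [mu /= mun <-]; apply: lin_span_gen; exists mu.
Qed.

(** The basis functions and the weighted reduced monomials with k + l <= n are
indexed by the same finite set, and the former lie in the span of the latter. *)
Lemma span_basis_fun_le n :
  lin_span (basis_fun P u theta @` basis_index_le n) = space_HM u theta n.
Proof.
apply/seteqP; split.
  by apply: lin_span_min => _ [i iD <-]; exact: basis_fun_space_HM.
have [s us sE] := @basis_index_le_seq n.
have reduce (f : fct) : degree_le n f ->
    lin_span ((weighted \o reduced) @` basis_index_le n) (weighted f).
  move=> /degree_le_reduced; apply: (lin_span_map weighted_linear) => _ [i iD <-].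
  by apply: lin_span_gen; exists i.
have sD i : i \in s -> basis_index_le n i by rewrite -sE.
apply: lin_span_min => _ [mu /= mun <-].
have mun' : degree_le n (momentum_monomial mu : fct) by apply: lin_span_gen; exists mu.
move/reduce: mun'; apply: lin_span_min => _ [j jD <-]; rewrite -sE.
apply: (free_exchange us _ (v := weighted \o reduced)).
- move=> t c ut tD e0; apply: (basis_fun_free hu theta0 hP ut _ e0) => i it.
  by have [] := sD i (tD i it).
- move=> i /sD iD; rewrite sE; have [f fn ->] := degree_le_basis_fun iD.1.
  by apply: reduce; exact: degree_leW iD.2 fn.
- by rewrite -sE in jD.
Qed.

Lemma span_basis_fun : lin_span (basis_fun P u theta @` basis_index) = space_H u theta.
Proof.
apply/seteqP; split; apply: lin_span_min.
  move=> _ [i iD <-].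
  have : space_HM u theta (i.1.1 + i.1.2) (basis_fun P u theta i).
    by apply: basis_fun_space_HM; split.
  apply: lin_span_min => _ [mu _ <-]; apply: lin_span_gen; exact: imageT.
move=> _ [mu _ <-].
have : space_HM u theta (size mu) (monomial_weight u theta mu).
  by apply: lin_span_gen; exists mu => //=.
rewrite -span_basis_fun_le; apply: lin_span_min => _ [i [iD _] <-].
by apply: lin_span_gen; exists i.
Qed.

End Completeness.

Theorem lemma5p1 (R : realType) (u : R * R * R) (theta : R)
    (P : nat -> nat -> {poly R}) (hu : enorm u < 1) (htheta : 0 < theta)
    (hP : forall l, orthonormal_polys (omega l theta^-1) (P l)) :
  orthonormal_basis (inner u theta) (space_H u theta)
    basis_index (basis_fun P u theta) /\
  (forall M : nat, (1 <= M)%N ->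
    orthonormal_basis (inner u theta) (space_HM u theta M)
      (basis_index_le M) (basis_fun P u theta)).
Proof.
split=> [|M _]; split.
- by move=> i j; exact: inner_basis.
- exact: basis_fun_free.
- exact: span_basis_fun.
- by move=> i j [iD _] [jD _]; exact: inner_basis.
- move=> s c us sD; apply: (basis_fun_free hu htheta hP us) => i /sD [].
  by [].
- exact: span_basis_fun_le.
Qed.
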